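(* Let $c:[0,\infty)\to[0,\infty)$ be a convex cost function such that $c(t)=t^2$ for $t\in[0,t_0]$ for some $t_0>0$. There exists a constant $\kappa>0$, depending only on the cost $c$, such that the following holds. Let $\{\mu_\theta\}_{\theta\in\Theta}$ be a family of Borel probability measures on $\mathbb{R}$ such that, for some $a>0$, every $\mu_\theta$ satisfies the inequality $\overline{\mathbf{T}}_{c(a|\cdot|)}$ with constant $1$. Suppose moreover that $$E_\Theta:=\sup_{\theta,\theta'\in\Theta}\Bigl|\int_{\mathbb{R}}x\,\mu_\theta(dx)-\int_{\mathbb{R}}x\,\mu_{\theta'}(dx)\Bigr|<\infty .$$ Then the mixture $\mu_{\mathrm{mix}}$ of the family with respect to a mixing probability measure $m$ on $\Theta$ satisfies the inequality $\overline{\mathbf{T}}_{c(a'|\cdot|)}$ with constant $1$ for $$a'=\kappa\cdot(1/a+E_\Theta)^{-1}.$$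
   Context: Mixture: $(\Theta,\mathfrak{M},m)$ is a probability space, for every Borel set $A\subset\mathbb{R}$ the map $\theta\mapsto\mu_\theta(A)$ is measurable, and $\mu_{\mathrm{mix}}(A):=\int_\Theta \mu_\theta(A)\,dm(\theta)$ for Borel $A\subset\mathbb{R}$. $\mathcal{P}_1(\mathbb{R})$ is the set of Borel probability measures on $\mathbb{R}$ with finite first moment; $H(\nu|\mu):=\int\log\bigl(\frac{d\nu}{d\mu}\bigr)d\nu$ if $\nu\ll\mu$ and $+\infty$ otherwise. For a convex cost $w:\mathbb{R}\to[0,\infty)$ with $w(0)=0$ and probability measures $\mu_1,\mu_2$ on $\mathbb{R}$ with $\mu_2\in\mathcal{P}_1(\mathbb{R})$, the weak transport cost is $$\overline{\mathcal{T}}_w(\mu_2|\mu_1):=\inf_\pi\int_{\mathbb{R}}w\Bigl(x-\int_{\mathbb{R}}y\,p_x(dy)\Bigr)\mu_1(dx),$$ where the infimum is over all couplings $\pi$ of $\mu_1$ and $\mu_2$, and $p_x$ is defined ($\mu_1$-a.s.) by $\pi(dx\,dy)=p_x(dy)\mu_1(dx)$. A probability measure $\mu$ on $\mathbb{R}$ (with finite first moment) satisfies $\overline{\mathbf{T}}_w$ with constant $C\in(0,\infty)$ if for all $\nu\in\mathcal{P}_1(\mathbb{R})$ both $\overline{\mathcal{T}}_w(\mu|\nu)\le C\,H(\nu|\mu)$ and $\overline{\mathcal{T}}_w(\nu|\mu)\le C\,H(\nu|\mu)$. Here $c(a|\cdot|)$ denotes the cost function $x\mapsto c(a|x|)$.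 *)

(* Defs.v *)
From HB Require Import structures.
From mathcomp Require Import all_boot all_order all_algebra.
From mathcomp Require Import all_classical all_reals all_analysis measurable_realfun.

Set Implicit Arguments.
Unset Strict Implicit.
Unset Printing Implicit Defensive.

Import Order.TTheory GRing.Theory Num.Theory.
Import numFieldNormedType.Exports.

Local Open Scope classical_set_scope.
Local Open Scope ring_scope.
Local Open Scope ereal_scope.
Local Open Scope charge_scope.

Section mixture.
Context d d' (Theta : measurableType d) (X : measurableType d') (R : realType).
Context (m : probability Theta R) (mu : Theta -> probability X R).
Context (hmu : forall A, measurable A ->
                 measurable_fun [set: Theta] (fun t => mu t A)).

(** The measurability assumption does not occur in the body: it is an argument
    so that a probability measure can be inferred from [mixture hmu]. *)
Definition mixture (_ : forall A, measurable A ->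
    measurable_fun [set: Theta] (fun t => mu t A)) : set X -> \bar R :=
  fun A => \int[m]_t mu t A.

Local Notation mix := (mixture hmu).

Let mixture0 : mix set0 = 0.
Proof. by rewrite /mixture integral0_eq. Qed.

Let mixture_ge0 A : 0 <= mix A.
Proof. exact: integral_ge0. Qed.

Let mixture_sigma_additive : semi_sigma_additive mix.
Proof.
move=> F mF tF mUF; rewrite /mixture.
rewrite [X in _ --> X](_ : _ = \int[m]_t \sum_(0 <= n <oo) mu t (F n)); last first.
  by apply: eq_integral => t _; rewrite measure_semi_bigcup.
rewrite [X in X @ _](_ : _ =
    (fun n => \int[m]_t \sum_(0 <= i < n) mu t (F i))); last first.
  apply/funext => n; rewrite -ge0_integral_sum// => i; exact: hmu.
apply: cvg_monotone_convergence => //.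
- by move=> n; apply: emeasurable_sum => i; exact: hmu.
- by move=> n t _; exact: sume_ge0.
- by move=> t _ a b ab; exact: ereal_nondecreasing_series.
Qed.

HB.instance Definition _ := isMeasure.Build d' X R mix
  mixture0 mixture_ge0 mixture_sigma_additive.

Let mixture_setT : mix [set: X] = 1.
Proof.
rewrite /mixture (eq_integral (cst 1)); last first.
  by move=> t _; rewrite probability_setT.
by rewrite integral_cst// mul1e; exact: probability_setT.
Qed.

HB.instance Definition _ := Measure_isProbability.Build d' X R mix mixture_setT.

End mixture.

Section weak_transport.
Context (R : realType).
Implicit Types (mu nu : probability R R) (w : R -> R).

Definition finite_first_moment mu := mu.-integrable [set: R] (fun x => x%:E).

(** [lne] is [-oo] on nonpositive arguments; the points where the density is
    nonpositive form a [nu]-null set, so that they do not contribute. *)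
Definition relative_entropy nu mu : \bar R :=
  if pselect (nu `<< mu) then
    \int[nu]_x lne (('d (charge_of_finite_measure nu) '/d mu) x)
  else +oo.

Definition coupling (pi : probability (R * R)%type R) mu1 mu2 :=
  (forall A : set R, measurable A -> pi (fst @^-1` A) = mu1 A) /\
  (forall B : set R, measurable B -> pi (snd @^-1` B) = mu2 B).

Definition disintegration (pi : probability (R * R)%type R) mu1
    (p : R.-pker R ~> R) :=
  forall A B : set R, measurable A -> measurable B ->
    pi (A `*` B) = \int[mu1]_(x in A) p x B.

(** By disintegration every coupling has such a kernel [p], unique up to a
    [mu1]-null set, so that the integral below only depends on [pi]. If [mu2]
    has a finite first moment, [p x] has a barycenter for [mu1]-almost all [x];
    elsewhere the real-valued integral of [y] is a conventional value. *)
Definition weak_transport_cost w mu2 mu1 : \bar R :=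
  ereal_inf [set t | exists (pi : probability (R * R)%type R)
                            (p : R.-pker R ~> R),
    [/\ coupling pi mu1 mu2, disintegration pi mu1 p &
        t = \int[mu1]_x (w (x - (\int[p x]_y y)%R)%R)%:E]].

(** The finite first moment of [mu] is part of the property. *)
Definition weak_transport_inequality w (C : R) mu :=
  finite_first_moment mu /\
  forall nu, finite_first_moment nu ->
    weak_transport_cost w mu nu <= C%:E * relative_entropy nu mu /\
    weak_transport_cost w nu mu <= C%:E * relative_entropy nu mu.

Definition mean_diameter (Theta : Type) (mu : Theta -> probability R R) :
    \bar R :=
  ereal_sup [set `| \int[mu t]_x x - \int[mu t']_x x |%R%:E
            | t in [set: Theta] & t' in [set: Theta]].

End weak_transport.

(* Main.v *)
(** Write [nu = f mu_mix], [h t = \int f dmu_t] and [nu_t = f mu_t / h t]. Then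
    [H(nu|mu_mix)] is the mean of [h t * H(nu_t|mu_t) + h t * ln (h t)]. A point
    drawn from [mu_t] is moved to [nu_t] by the coupling given by the transport
    inequality with probability [min(1, h t)]; otherwise it jumps to a component
    chosen with law proportional to the positive part of [h - 1]. With
    [q = (1 - h t)^+], the jumps displace the barycenter by
    [q * (x - mean t) + q * (mean t - mean s)]. As the cost is quadratic near 0
    and [mu_t] has exponential moments, this costs a multiple of [q^2], and
    Marton's inequality bounds the mean of [q^2] by 4 times that of [h ln h].

    To avoid choosing couplings measurably in [t], the line is cut into finitely
    many bins, [f] is replaced by its averages over the bins, and the mixture by
    a finite mixture with exactly the same bin masses: the mean of a function
    with values in a finite-dimensional space lies in the convex hull of its
    range. The error made on the unbounded bin is controlled by the uniform
    exponential moments and, under [nu], by Fenchel's inequality for the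
    entropy. *)

Require Import Defs.
From HB Require Import structures.
From mathcomp Require Import all_boot all_order all_algebra.
From mathcomp Require Import all_classical all_reals all_analysis measurable_realfun.
From mathcomp Require Import ring lra.

Set Implicit Arguments.
Unset Strict Implicit.
Unset Printing Implicit Defensive.

Import Order.TTheory GRing.Theory Num.Theory.
Import numFieldNormedType.Exports.

Local Open Scope classical_set_scope.
Local Open Scope ring_scope.

(** * Convex costs *)

(** The final constant is 1 because every numerical loss is paid in scale: [C 0 = 0] and convexity
    give [C (t * x) <= t * C x] for [t] in [0, 1], so a smaller argument buys a smaller cost,
    although [C (2 * x)] need not be bounded by a multiple of [C x]. Transport inside the components
    uses a fraction of their mean entropy and the jumps use the entropy of the component weights; by
    the chain rule the two add up to the total, so nothing is counted twice. The two terms of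
    [1/a + E] are two constraints: [a' / a] small makes the coefficient of the squared jump
    probability small through the exponential moments, and [a' * E] small keeps displacements
    between means in the quadratic range. After rescaling by [a] the exponential moments depend on
    the cost alone, hence so does kappa. The two directions are not symmetric: tilted components
    have no uniform moment bound of their own, so when they are the source their points are first
    sent back to [mu_t]. The bins are chosen after [nu], and all discretization errors are multiples
    of one [e] that tends to 0. *)

Record even_convex_cost (R : realType) (C : R -> R) (t0 : R) : Prop := {
  cost_ge0 : forall x, 0 <= C x;
  cost_even : forall x, C (- x) = C x;
  cost_convex : forall t x y, 0 <= t <= 1 ->
    C (t * x + (1 - t) * y) <= t * C x + (1 - t) * C y;
  cost_radius : 0 < t0;
  cost_sq : forall x, `|x| <= t0 -> C x = x ^+ 2 }.

Section even_convex_cost.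
Context (R : realType) (C : R -> R) (t0 : R) (CC : even_convex_cost C t0).

Let C_ge0 := cost_ge0 CC.
Let t0_gt0 := cost_radius CC.

Lemma cost0 : C 0 = 0.
Proof. by rewrite (cost_sq CC) ?expr0n// normr0 ltW. Qed.

Lemma cost_scale t x : 0 <= t <= 1 -> C (t * x) <= t * C x.
Proof.
by move=> /(cost_convex CC x 0); rewrite cost0 !mulr0 !addr0.
Qed.

Lemma cost_norm x : C `|x| = C x.
Proof. by case: (ger0P x) => // _; rewrite (cost_even CC). Qed.

Lemma cost_mono x y : `|x| <= `|y| -> C x <= C y.
Proof.
rewrite -(cost_norm x) -(cost_norm y).
have [->|y0] := eqVneq y 0.
  by rewrite normr0 normr_le0 => /eqP ->; rewrite normr0.
move=> xy; have ny : 0 < `|y| by rewrite normr_gt0.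
have t01 : 0 <= `|x| / `|y| <= 1.
  by rewrite divr_ge0//= ler_pdivrMr// mul1r.
rewrite -{1}(divfK (lt0r_neq0 ny) `|x|).
apply: le_trans (cost_scale _ t01) _.
by case/andP: t01 => _ t1; rewrite ler_piMl// C_ge0.
Qed.

(** Beyond [t0], convexity keeps [C] above the line through the origin and the point
    [(t0, t0 ^+ 2)]; within [t0] the left side is nonpositive. This growth makes exponential tails
    summable and lets costs control first moments. *)
Lemma cost_linear_lb x : t0 * `|x| - t0 ^+ 2 <= C x.
Proof.
have [xt|tx] := leP `|x| t0.
  apply: le_trans (C_ge0 x); rewrite subr_le0 expr2.
  by rewrite ler_pM2l.
have x0 : 0 < `|x| by exact: lt_trans tx.
have t01 : 0 <= t0 / `|x| <= 1.
  by rewrite divr_ge0 ?(ltW t0_gt0)//= ler_pdivrMr// mul1r ltW.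
have := cost_scale `|x| t01; rewrite divfK ?gt_eqF// cost_norm.
have -> : C t0 = t0 ^+ 2 by rewrite (cost_sq CC)// ger0_norm// ltW.
move=> h.
have : t0 * `|x| <= C x.
  move: h; by rewrite expr2 -mulrA ler_pM2l// [_^-1 * _]mulrC ler_pdivlMr.
rewrite expr2; move: (mulr_gt0 t0_gt0 t0_gt0); lra.
Qed.

(** The slope is the supremum of the slopes of chords arriving at [z] from the left, bounded by any
    chord leaving to the right. A supporting line gives Jensen's inequality for sums and integrals
    without differentiating [C]. *)
Lemma cost_subgradient z : exists b, forall x, C z + b * (x - z) <= C x.
Proof.
pose S := [set (C z - C y) / (z - y) | y in [set y | y < z]].
have slope y w : y < z -> z < w -> (C z - C y) / (z - y) <= (C w - C z) / (w - z).
  move=> yz zw; rewrite ler_pdivrMr ?subr_gt0// mulrAC.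
  rewrite ler_pdivlMr ?subr_gt0//.
  have wy : 0 < w - y by rewrite subr_gt0 (lt_trans yz).
  pose t := (w - z) / (w - y).
  have t01 : 0 <= t <= 1.
    rewrite /t divr_ge0 ?(ltW wy) ?subr_ge0 ?(ltW zw)//= ler_pdivrMr// mul1r.
    by rewrite lerD2l lerN2 ltW.
  have := cost_convex CC y w t01.
  have -> : t * y + (1 - t) * w = z.
    by rewrite /t; field; rewrite gt_eqF.
  rewrite -(ler_pM2r wy).
  have -> : (t * C y + (1 - t) * C w) * (w - y) = (w - z) * C y + (z - y) * C w.
    by rewrite /t; field; rewrite gt_eqF.
  lra.
have S0 : S !=set0 by exists ((C z - C (z - 1)) / (z - (z - 1))); exists (z - 1) => //=; rewrite ltrBlDr ltrDl.
have hS : has_sup S.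
  split=> //; exists ((C (z + 1) - C z) / (z + 1 - z)) => _ [y /= yz <-].
  by apply: slope => //; rewrite ltrDl.
exists (sup S) => x.
have [xz|zx|->] := ltgtP x z; last by rewrite subrr mulr0 addr0.
- have : (C z - C x) / (z - x) <= sup S by apply: ub_le_sup; [exact: hS.2|exists x].
  rewrite ler_pdivrMr ?subr_gt0//; lra.
- have : sup S <= (C x - C z) / (x - z).
    by apply: ge_sup => // _ [y /= yz <-]; exact: slope.
  rewrite ler_pdivlMr ?subr_gt0//; lra.
Qed.

Lemma cost_jensen_sum (I : finType) (p x : I -> R) :
  (forall i, 0 <= p i) -> \sum_i p i = 1 ->
  C (\sum_i p i * x i) <= \sum_i p i * C (x i).
Proof.
move=> p0 p1; set z := \sum_i _.
have [b hb] := cost_subgradient z.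
have : \sum_i p i * (C z + b * (x i - z)) <= \sum_i p i * C (x i).
  by apply: ler_sum => i _; apply: ler_wpM2l.
apply: le_trans; under eq_bigr do rewrite mulrDr (mulrCA (p _)) mulrBr.
rewrite big_split/= -mulr_suml p1 mul1r -mulr_sumr sumrB -mulr_suml p1 mul1r.
by rewrite subrr mulr0 addr0.
Qed.

(** Convexity replaces the triangle inequality. Since [C] may grow faster than any power, the factor
    2 stays inside the argument and is charged to the scale. *)
Lemma cost_split2 x y : C (x + y) <= (C (2 * x) + C (2 * y)) / 2.
Proof.
have h : 0 <= (2^-1 : R) <= 1 by apply/andP; split; lra.
have := cost_convex CC (2 * x) (2 * y) h.
have -> : 2^-1 * (2 * x) + (1 - 2^-1) * (2 * y) = x + y by field.
lra.
Qed.

Lemma cost_split3 x y z :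
  C (x + y + z) <= (C (3 * x) + C (3 * y) + C (3 * z)) / 3.
Proof.
have h : 0 <= (2 / 3 : R) <= 1 by apply/andP; split; lra.
have := cost_convex CC (3 / 2 * (x + y)) (3 * z) h.
have -> : 2 / 3 * (3 / 2 * (x + y)) + (1 - 2 / 3) * (3 * z) = x + y + z by field.
have := cost_split2 (3 / 2 * x) (3 / 2 * y).
have -> : 3 / 2 * x + 3 / 2 * y = 3 / 2 * (x + y) by field.
have -> : 2 * (3 / 2 * x) = 3 * x by field.
have -> : 2 * (3 / 2 * y) = 3 * y by field.
lra.
Qed.

Lemma cost_split4 x y z w :
  C (x + y + z + w) <= (C (4 * x) + C (4 * y) + C (4 * z) + C (4 * w)) / 4.
Proof.
have := cost_split2 (x + y) (z + w).
have := cost_split2 (2 * x) (2 * y); have := cost_split2 (2 * z) (2 * w).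
rewrite -!mulrDr !mulrA -!natrM addrA; lra.
Qed.

Lemma measurable_cost : measurable_fun [set: R] C.
Proof.
have -> : C = (fun x => C (Num.max x 0)) \o (fun x => `|x|).
  by apply/funext => x /=; rewrite max_l// cost_norm.
apply: measurableT_comp; last exact: normr_measurable.
apply: nondecreasing_measurable => // x y xy.
have m0 (z : R) : 0 <= Num.max z 0 by rewrite le_max lexx orbT.
apply: cost_mono; rewrite !ger0_norm//.
by rewrite ge_max !le_max xy lexx/= orbT.
Qed.

(* For [k q y <= t0] the left side is quadratic in [k q y]; otherwise
   [1 < k q y / t0] pays for the second factor [k q]. *)
Lemma cost_scale_sq : exists2 M, 0 < M & forall k q y,
  0 <= k <= 1 -> 0 <= q <= 1 ->
  C (k * q * y) <= (k * q) ^+ 2 * (M * expR (C y / 2)).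
Proof.
pose D := t0 + t0^-1 + 1.
have ti : 0 < t0^-1 by rewrite invr_gt0.
have D1 : 1 <= D by rewrite /D lerDr addr_ge0// ltW.
have tt : t0 * t0^-1 = 1 by rewrite divff// gt_eqF.
have boundy y : `|y| <= D * (1 + C y).
  have := cost_linear_lb y; have := C_ge0 y => c0 h.
  have {}h : `|y| <= t0 + C y * t0^-1.
    rewrite -(ler_pM2l t0_gt0) mulrDr (mulrC (C y)) mulrA tt mul1r.
    by move: h; rewrite expr2; lra.
  apply: le_trans h _; rewrite /D mulrDr mulr1.
  have : C y * t0^-1 <= (t0 + t0^-1 + 1) * C y.
    by rewrite mulrC ler_wpM2r//; move: (ltW t0_gt0); lra.
  by move: (ltW ti); lra.
have expb u : 0 <= u -> (1 + u) ^+ 2 <= 16 * expR (u / 2).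
  move=> u0; have : 1 + u / 4 <= expR (u / 4) by exact: expR_ge1Dx.
  move=> h; have -> : u / 2 = u / 4 * 2%:R by field.
  rewrite [u / 4 * _]mulrC expRM_natl.
  have h2 : (1 + u / 4) ^+ 2 <= expR (u / 4) ^+ 2.
    by rewrite ler_sqr ?nnegrE ?expR_ge0//; lra.
  apply: le_trans (_ : 16 * (1 + u / 4) ^+ 2 <= _); last by rewrite ler_pM2l.
  by rewrite !expr2; nra.
(* [D ^+ 2] serves the quadratic range and [D / t0] the other one; the 16 of [expb] comes from
   [(1 + u) ^+ 2 <= 16 * (1 + u / 4) ^+ 2]. *)
pose E := D ^+ 2 + D * t0^-1.
have E0 : 0 < E by rewrite /E addr_gt0 ?exprn_gt0 ?mulr_gt0//; lra.
exists (E * 16); first by rewrite mulr_gt0.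
move=> k q y /andP[k0 k1] /andP[q0 q1].
have kq0 : 0 <= k * q by exact: mulr_ge0.
have kq1 : k * q <= 1 by rewrite mulr_ile1.
apply: (@le_trans _ _ ((k * q) ^+ 2 * (E * (1 + C y) ^+ 2))); last first.
  rewrite ler_wpM2l ?sqr_ge0// -mulrA ler_wpM2l ?(ltW E0)//.
  exact: expb.
have Cy := C_ge0 y; have Dy := boundy y.
have [small|big] := leP `|k * q * y| t0.
  rewrite (cost_sq CC)// exprMn ler_wpM2l ?sqr_ge0//.
  rewrite -real_normK ?num_real//.
  apply: le_trans (_ : (D * (1 + C y)) ^+ 2 <= _).
    by rewrite ler_sqr ?nnegrE ?mulr_ge0//; lra.
  rewrite exprMn ler_wpM2r ?sqr_ge0// /E lerDl mulr_ge0//; lra.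
have := @cost_scale (k * q) y; rewrite kq0 kq1 => /(_ isT) h.
apply: le_trans h _.
rewrite normrM (ger0_norm kq0) in big.
have big1 : 1 <= k * q * `|y| * t0^-1 by rewrite ler_pdivlMr// mul1r ltW.
apply: (@le_trans _ _ ((k * q * C y) * (k * q * `|y| * t0^-1))).
  by rewrite ler_peMr// mulr_ge0.
have -> : k * q * C y * (k * q * `|y| * t0^-1) =
   (k * q) ^+ 2 * (C y * (`|y| * t0^-1)) by ring.
rewrite ler_wpM2l ?sqr_ge0//.
apply: le_trans (_ : C y * (D * (1 + C y) * t0^-1) <= _).
  by rewrite ler_wpM2l// ler_wpM2r// ltW.
have -> : C y * (D * (1 + C y) * t0^-1) = D * t0^-1 * (C y * (1 + C y)) by ring.
apply: le_trans (_ : D * t0^-1 * (1 + C y) ^+ 2 <= _).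
  rewrite ler_wpM2l ?mulr_ge0 ?(ltW ti)//; first lra.
  rewrite expr2 ler_wpM2r//; lra.
by rewrite ler_wpM2r ?sqr_ge0// /E lerDr sqr_ge0.
Qed.

End even_convex_cost.

(** * Mixtures, densities and entropy *)

Lemma probability_integral_cst d (T : measurableType d) (R : realType)
    (P : probability T R) (c : R) : (\int[P]_x c%:E = c%:E)%E.
Proof.
rewrite (@integral_cst _ _ _ P _ measurableT c%:E) -[RHS]mule1.
by congr (_ * _)%E; exact: probability_setT.
Qed.

Section mixture_integral.
Context d d' (T : measurableType d) (X : measurableType d') (R : realType).
Context (al : probability T R) (k : T -> {measure set X -> \bar R}).
Context (mk : forall U, measurable U -> measurable_fun [set: T] (k ^~ U)).
Context (k1 : forall t, k t [set: X] = 1%E).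

(* [al] as a kernel on [unit] and [k] as a kernel on [unit * T], so that the
   mixture is the composition of two kernels. *)
Local Definition source_kernel (_ : unit) : {measure set T -> \bar R} := al.

Let source_kernel_measurable U : measurable U ->
  measurable_fun [set: unit] (source_kernel ^~ U).
Proof. by move=> _; exact: measurable_cst. Qed.

HB.instance Definition _ :=
  isKernel.Build _ _ unit T R source_kernel source_kernel_measurable.

Let source_kernelT x : source_kernel x [set: T] = 1%E.
Proof. exact: probability_setT. Qed.

HB.instance Definition _ :=
  Kernel_isProbability.Build _ _ unit T R source_kernel source_kernelT.

Local Definition target_kernel
  (_ : forall U, measurable U -> measurable_fun [set: T] (k ^~ U))
  (_ : forall t, k t [set: X] = 1%E)
  (x : unit * T) : {measure set X -> \bar R} := k x.2.

Local Notation tk := (target_kernel mk k1).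

Let target_kernel_measurable U : measurable U ->
  measurable_fun [set: (unit * T)%type] (tk ^~ U).
Proof.
move=> mU; apply: (@measurableT_comp _ _ _ _ _ _ (k ^~ U)) => //.
exact: mk.
Qed.

HB.instance Definition _ :=
  isKernel.Build _ _ (unit * T)%type X R tk target_kernel_measurable.

Let target_kernelT x : tk x [set: X] = 1%E.
Proof. exact: k1. Qed.

HB.instance Definition _ :=
  Kernel_isProbability.Build _ _ (unit * T)%type X R tk target_kernelT.

(** Serves both for the mixture and for the second marginal of a coupling known through its
    kernel. *)
Lemma ge0_integral_mixture (be : {measure set X -> \bar R})
    (beE : forall B, measurable B -> (be B = \int[al]_t k t B)%E)
    (f : X -> \bar R) :
  (forall x, 0 <= f x)%E -> measurable_fun [set: X] f ->
  (\int[be]_x f x = \int[al]_t \int[k t]_x f x)%E.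
Proof.
move=> f0 mf; have := integral_kcomp source_kernel tk tt f0 mf.
rewrite /source_kernel/= => <-; apply: eq_measure_integral => A mA _.
by rewrite beE.
Qed.

End mixture_integral.

Section density.
Local Open Scope ereal_scope.
Context d (T : measurableType d) (R : realType) (mu : probability T R).
Context (g : T -> R) (g0 : forall x, (0 <= g x)%R).
Context (mg : measurable_fun [set: T] g).
Context (g1 : \int[mu]_x (g x)%:E = 1).

(* The proofs are arguments so that a probability measure can be inferred. *)
Definition density_measure (_ : forall x, (0 <= g x)%R)
  (_ : measurable_fun [set: T] g) (_ : \int[mu]_x (g x)%:E = 1) :=
  fun A : set T => \int[mu]_(x in A) (g x)%:E.

Local Notation nu := (density_measure g0 mg g1).

Let nu0 : nu set0 = 0. Proof. exact: integral_set0. Qed.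

Let nu_ge0 A : 0 <= nu A.
Proof. by apply: integral_ge0 => x _; rewrite lee_fin. Qed.

Let nu_sigma_additive : semi_sigma_additive nu.
Proof.
move=> F mF tF mUF; rewrite /density_measure.
rewrite ge0_integral_bigcup//.
- apply: is_cvg_ereal_nneg_natsum_cond => n _ _.
  by apply: integral_ge0 => x _; rewrite lee_fin.
- by apply/measurable_EFinP; exact: measurable_funS mg.
- by move=> x _; rewrite lee_fin.
Qed.

HB.instance Definition _ := isMeasure.Build d T R nu
  nu0 nu_ge0 nu_sigma_additive.

HB.instance Definition _ := Measure_isProbability.Build d T R nu g1.

End density.

Section change_of_density.
Local Open Scope ereal_scope.
Context d (T : measurableType d) (R : realType) (mu nu : probability T R).
Context (g : T -> R) (g0 : forall x, (0 <= g x)%R).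
Context (mg : measurable_fun [set: T] g).
Context (nuE : forall A, measurable A -> nu A = \int[mu]_(x in A) (g x)%:E).

Lemma density_dominates : nu `<< mu.
Proof.
apply/null_content_dominatesP => A mA muA; rewrite nuE// null_set_integral//.
by apply/measurable_EFinP; exact: measurable_funTS.
Qed.

(** [g] and the Radon-Nikodym derivative have the same integral over every measurable set, hence
    agree almost everywhere, and the change of variables for the derivative carries over. *)
Lemma ge0_integral_density (h : T -> \bar R) : (forall x, 0 <= h x) ->
  measurable_fun [set: T] h -> \int[nu]_x h x = \int[mu]_x (h x * (g x)%:E).
Proof.
move=> h0 mh; have numu := density_dominates.
rewrite -(Radon_Nikodym_SigmaFinite.change_of_variables numu)//.
set F := Radon_Nikodym_SigmaFinite.f _ _.
have mF : measurable_fun [set: T] F.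
  exact: measurable_int (Radon_Nikodym_SigmaFinite.f_integrable numu).
apply: ae_eq_integral => //.
- exact: emeasurable_funM.
- by apply: emeasurable_funM => //; exact/measurable_EFinP.
- apply: ae_eqe_mul2l; apply: integral_ae_eq => //.
  + exact: (Radon_Nikodym_SigmaFinite.f_integrable numu).
  + exact/measurable_EFinP.
  + by move=> E _ mE; rewrite -nuE// -(Radon_Nikodym_SigmaFinite.f_integral numu).
Qed.

(** Multiplication by [g >= 0] commutes with taking positive and negative parts, so the nonnegative
    case applies to each part, even when the integral is infinite. *)
Lemma integral_density (h : T -> \bar R) : measurable_fun [set: T] h ->
  \int[nu]_x h x = \int[mu]_x (h x * (g x)%:E).
Proof.
move=> mh; rewrite integralE [RHS]integralE; congr (_ - _).
- rewrite ge0_integral_density//; last exact: measurable_funepos.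
  apply: eq_integral => x _; rewrite !funeposE.
  by rewrite maxe_pMl ?lee_fin// mul0e.
- rewrite ge0_integral_density//; last exact: measurable_funeneg.
  apply: eq_integral => x _; rewrite !funenegE.
  by rewrite maxe_pMl ?lee_fin// mul0e mulNe.
Qed.

Lemma density_gt0 : {ae nu, forall x, (0 < g x)%R}.
Proof.
have mg0 : measurable [set x | g x = 0%R].
  by rewrite -[X in measurable X]setTI; exact: (mg measurableT (measurable_set1 0%R)).
exists [set x | g x = 0%R]; split => //.
- by rewrite nuE// integral0_eq// => x /= ->.
- by move=> x /= /negP; rewrite -leNgt => gx; apply/eqP; rewrite eq_le gx g0.
Qed.

End change_of_density.

Lemma exists_density d (T : measurableType d) (R : realType)
    (mu nu : probability T R) : nu `<< mu ->
  exists g : T -> R, [/\ forall x, 0 <= g x, measurable_fun [set: T] g &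
    forall A, measurable A -> (nu A = \int[mu]_(x in A) (g x)%:E)%E].
Proof.
move=> numu; pose F := Radon_Nikodym_SigmaFinite.f nu mu.
have Ffin := Radon_Nikodym_SigmaFinite.f_fin_num numu.
exists (fine \o F); split.
- by move=> x; apply: fine_ge0; exact: (Radon_Nikodym_SigmaFinite.f_ge0 numu).
- apply: measurableT_comp => //.
  exact: measurable_int (Radon_Nikodym_SigmaFinite.f_integrable numu).
- move=> A mA; rewrite (Radon_Nikodym_SigmaFinite.f_integral numu)//.
  by apply: eq_integral => x _; rewrite /= fineK//; exact: Ffin.
Qed.

Section relative_entropy.
Local Open Scope ereal_scope.
Local Open Scope charge_scope.
Context (R : realType) (mu nu : probability R R).
Context (g : R -> R) (g0 : forall x, (0 <= g x)%R).
Context (mg : measurable_fun [set: R] g).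
Context (nuE : forall A, measurable A -> nu A = \int[mu]_(x in A) (g x)%:E).

(** [lne] and [ln] agree where the density is positive, which is [nu]-almost everywhere by
    [density_gt0]; under [mu], the zeros of [g] contribute 0. *)
Lemma relative_entropyE :
  relative_entropy nu mu = \int[mu]_x (g x * ln (g x))%:E.
Proof.
have numu : nu `<< mu by exact: density_dominates nuE.
rewrite /relative_entropy; case: pselect => [{}numu|//].
set F := 'd _ '/d _.
have Ffin x : F x \is a fin_num by exact: Radon_Nikodym_fin_num.
have mF : measurable_fun [set: R] F.
  by apply: (measurable_int mu); exact: Radon_Nikodym_integrable.
have Fg : ae_eq mu [set: R] F (EFin \o g).
  apply: integral_ae_eq => //.
  - exact: Radon_Nikodym_integrable.
  - exact/measurable_EFinP.
  - by move=> E _ mE; rewrite -nuE// -Radon_Nikodym_integral.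
have Fg' : ae_eq nu [set: R] F (EFin \o g) by exact: null_dominates_ae_eq Fg.
rewrite (@ae_eq_integral _ _ _ nu setT (fun x => (ln (g x))%:E))//.
- rewrite (integral_density g0 mg nuE)//.
    by apply: eq_integral => x _; rewrite -EFinM mulrC.
  by apply/measurable_EFinP; exact: measurableT_comp.
- have -> : (fun x => lne (F x)) = (fun x => if (fine (F x) <= 0)%R then -oo
      else (ln (fine (F x)))%:E).
    by apply/funext => x; rewrite -[in LHS](fineK (Ffin x)).
  have mfF : measurable_fun [set: R] (fine \o F) by exact: measurableT_comp.
  apply: measurable_fun_ifT => //.
    by apply: measurable_fun_ler => //.
  by apply/measurable_EFinP; exact: (measurableT_comp _ mfF).
- by apply/measurable_EFinP; exact: measurableT_comp.
- have pos := density_gt0 g0 mg nuE.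
  apply: filterS2 Fg' pos => x /(_ I) Fx gx _ /=.
  by rewrite Fx /= leNgt gx.
Qed.

End relative_entropy.

(** * Means as finite convex combinations *)

Lemma bounded_integrable d (T : measurableType d) (R : realType)
    (P : {finite_measure set T -> \bar R}) (f : T -> R) (M : R) :
  measurable_fun [set: T] f -> (forall x, `|f x| <= M) ->
  P.-integrable [set: T] (EFin \o f).
Proof.
move=> mf fM; apply: measurable_bounded_integrable => //.
  by rewrite ltey_eq fin_num_measure.
exists M; split; first exact: num_real.
by move=> x Mx t _; apply: le_trans (fM t) (ltW Mx).
Qed.

Lemma probability_inhabited d (T : measurableType d) (R : realType)
  (P : probability T R) : exists t : T, True.
Proof.
apply: contrapT => /forallNP hT; have : P [set: T] = 0%E.
  rewrite (_ : [set: T] = set0) ?measure0//.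
  by apply/seteqP; split => // t; case: (hT t).
by rewrite probability_setT => /eqP; rewrite onee_eq0.
Qed.

Lemma Rintegral_prod_mul d (T : measurableType d) (R : realType)
    (P : probability T R) (f g : T -> R) (M : R) :
  measurable_fun [set: T] f -> measurable_fun [set: T] g ->
  (forall x, `|f x| <= M) -> (forall x, `|g x| <= M) ->
  \int[(P \x P)%E]_z (f z.1 * g z.2) = (\int[P]_x f x) * (\int[P]_x g x).
Proof.
move=> mf mg fM gM.
have [t _] := probability_inhabited P.
have M0 : 0 <= M by apply: le_trans (fM t).
have mfg : measurable_fun [set: T * T] (fun z => f z.1 * g z.2).
  by apply: measurable_funM; apply: measurableT_comp.
have ifg : (P \x P)%E.-integrable [set: T * T] (EFin \o (fun z => f z.1 * g z.2)).
  pose PP : probability (T * T)%type R := (P \x P)%E.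
  apply: (@bounded_integrable _ _ _ PP _ (M * M) mfg) => z.
  by rewrite normrM ler_pM.
have intf := bounded_integrable P mf fM; have intg := bounded_integrable P mg gM.
rewrite /Rintegral -(integral12_prod_meas1 ifg) /fubini_F/=.
have inner x : (\int[P]_y (f x * g y)%:E = (f x)%:E * \int[P]_y (g y)%:E)%E.
  by under eq_integral do rewrite EFinM; rewrite integralZl.
under eq_integral do rewrite inner.
have gfin : (\int[P]_y (g y)%:E)%E \is a fin_num by exact: integrable_fin_num.
by rewrite -(fineK gfin) integralZr// fineM//; exact: integrable_fin_num.
Qed.

(** Where [f] is positive, its inverse is [expR (- ln f)], a composition of measurable functions. *)
Lemma measurable_inv_pos d (T : measurableType d) (R : realType) (f h : T -> R) c :
  measurable_fun [set: T] f -> measurable_fun [set: T] h ->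
  measurable_fun [set: T] (fun x => if 0 < f x then h x / f x else c).
Proof.
move=> mf mh.
have -> : (fun x => if 0 < f x then h x / f x else c) =
   (fun x => if 0 < f x then h x * expR (- ln (f x)) else c).
  by apply/funext => x; case: ifPn => // fx; rewrite expRN lnK.
apply: measurable_fun_ifT => //.
  exact: measurable_fun_ltr.
apply: measurable_funM => //; apply: measurableT_comp => //.
by apply: measurableT_comp => //; exact: measurableT_comp.
Qed.

(* Induction on the number of coordinates. If [X] is the last coordinate,
   centred, then the chords from [{X > 0}] to [{X < 0}] meet the hyperplane
   [X = 0], and averaging the intersection points over [m \x m], with density
   proportional to [X s - X t], gives back the mean of [V]. *)
Lemma mean_in_convex_hull (R : realType) n : forall d (T : measurableType d)
    (m : probability T R) (V : 'I_n -> T -> R),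
  (forall k, measurable_fun [set: T] (V k)) ->
  (forall k t, 0 <= V k t <= 1) ->
  exists (J : finType) (lam : J -> R) (th : J -> T),
    [/\ forall j, 0 <= lam j, \sum_j lam j = 1 &
        forall k, \sum_j lam j * V k (th j) = \int[m]_t V k t].
Proof.
elim: n => [|n IH] d T m V mV V01.
  have [t _] := probability_inhabited m.
  exists unit, (fun=> 1), (fun=> t); split => //; last by case.
  by rewrite big_const card_unit/= addr0.
pose z := \int[m]_t V ord_max t.
pose X t := V ord_max t - z.
have V1 k t : `|V k t| <= 1 by case/andP: (V01 k t) => a b; rewrite ger0_norm.
have iV k := bounded_integrable m (mV k) (V1 k).
have icst (c : R) : m.-integrable [set: T] (EFin \o cst c).
  by apply: finite_measure_integrable_cst.
have m1 : fine (m [set: T]) = 1 by rewrite probability_setT.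
have mX : measurable_fun [set: T] X by apply: measurable_funB.
have z1 : `|z| <= 1.
  rewrite /z; apply: le_trans (le_normr_Rintegral _ _) _ => //.
  have -> : 1 = \int[m]_t (1 : R) :> R by rewrite Rintegral_cst// m1 mulr1.
  by apply: le_Rintegral => //; [exact: integrable_norm|exact: icst].
have X2 t : `|X t| <= 2.
  by apply: le_trans (ler_normB _ _) _; exact: lerD (V1 _ _) z1.
have iX := bounded_integrable m mX X2.
have X0 : \int[m]_t X t = 0.
  rewrite /X (RintegralB measurableT (iV ord_max) (icst z)).
  by rewrite Rintegral_cst// m1 mulr1 subrr.
pose p t := Num.max (X t) 0; pose q t := Num.max (- X t) 0.
have mp : measurable_fun [set: T] p by apply: measurable_maxr.
have mq : measurable_fun [set: T] q.
  by apply: measurable_maxr => //; exact: measurableT_comp.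
have p0 t : 0 <= p t by rewrite le_max lexx orbT.
have q0 t : 0 <= q t by rewrite le_max lexx orbT.
have pqX t : X t = p t - q t.
  rewrite /p /q; have [x0|/ltW x0] := leP (X t) 0.
    by rewrite max_l ?oppr_ge0// opprK add0r.
  by rewrite [X in _ - X]max_r ?oppr_le0// subr0.
have p2 t : `|p t| <= 2.
  by rewrite ger0_norm// ge_max ler0n andbT; apply: le_trans (X2 t); exact: ler_norm.
have q2 t : `|q t| <= 2.
  by rewrite ger0_norm// ge_max ler0n andbT; apply: le_trans (X2 t); rewrite -normrN; exact: ler_norm.
pose E := \int[m]_t p t.
have ip := bounded_integrable m mp p2; have iq := bounded_integrable m mq q2.
have qE : \int[m]_t q t = E.
  apply/eqP; rewrite eq_sym -subr_eq0 /E -RintegralB//.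
  by under eq_Rintegral do rewrite -pqX; rewrite X0.
pose mm : probability (T * T)%type R := (m \x m)%E.
pose iz t : R := (X t == 0)%R%:R; pose ipos t : R := (0 < X t)%R%:R.
pose ineg t : R := (X t < 0)%R%:R.
have miz : measurable_fun [set: T] iz.
  have -> : iz = \1_(X @^-1` [set 0]).
    apply/funext => t; rewrite indicE /iz; congr ((nat_of_bool _)%:R).
    by apply/idP/idP; rewrite inE /= => /eqP.
  by apply: measurable_indic; rewrite -[X in measurable X]setTI; exact: mX.
have mpos : measurable_fun [set: T] ipos.
  have -> : ipos = \1_(X @^-1` `]0, +oo[).
    apply/funext => t; rewrite indicE /ipos; congr ((nat_of_bool _)%:R).
    by apply/idP/idP; rewrite inE /= in_itv /= andbT.
  by apply: measurable_indic; rewrite -[X in measurable X]setTI; exact: mX.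
have mneg : measurable_fun [set: T] ineg.
  have -> : ineg = \1_(X @^-1` `]-oo, 0[).
    apply/funext => t; rewrite indicE /ineg; congr ((nat_of_bool _)%:R).
    by apply/idP/idP; rewrite inE /= in_itv.
  by apply: measurable_indic; rewrite -[X in measurable X]setTI; exact: mX.
have part t : iz t + ipos t + ineg t = 1.
  by rewrite /iz /ipos /ineg; case: (ltgtP (X t) 0); rewrite /= ?addr0 ?add0r.
have b01 (b : bool) : 0 <= (b%:R : R) <= 1 by case: b; rewrite ?lexx ?ler01.
(* Unnormalized weights of the two ends of the chord from [w.1] to [w.2]. On a chord from [{X > 0}]
   to [{X < 0}] they are proportional to [q w.2] and [p w.1], which makes the weighted sum of [X]
   vanish; [iz] keeps the points already on the hyperplane. *)
pose A (w : T * T) := iz w.1 + E^-1 * (ipos w.1 * q w.2).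
pose B (w : T * T) := E^-1 * (p w.1 * ineg w.2).
have E0 : 0 <= E by apply: Rintegral_ge0.
have A0 w : 0 <= A w.
  by rewrite /A addr_ge0 ?mulr_ge0 ?invr_ge0 ?q0// /iz /ipos ?ler0n.
have B0 w : 0 <= B w.
  by rewrite /B !mulr_ge0 ?invr_ge0 ?p0// /ineg; case: (X w.2 < 0).
pose D w := A w + B w.
pose Phi (v : T -> R) (w : T * T) := A w * v w.1 + B w * v w.2.
have ABX w : A w * X w.1 + B w * X w.2 = 0.
  have izX t : iz t * X t = 0.
    by rewrite /iz; case: eqP => [->|_]; rewrite ?mulr0 ?mul0r.
  have posX t : ipos t * X t = p t.
    by rewrite /ipos /p; case: (ltP 0 (X t)) => x0; rewrite ?mul1r ?mul0r.
  have negX t : ineg t * X t = - q t.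
    rewrite /ineg /q; case: (ltP (X t) 0) => x0.
      by rewrite mul1r max_l ?opprK// oppr_ge0 ltW.
    by rewrite mul0r max_r ?oppr0// oppr_le0.
  have -> : A w * X w.1 + B w * X w.2 = iz w.1 * X w.1 +
      E^-1 * ((ipos w.1 * X w.1) * q w.2 + p w.1 * (ineg w.2 * X w.2)).
    by rewrite /A /B; ring.
  by rewrite izX posX negX mulrN subrr mulr0 addr0.
have PhiE v w : Phi v w = (iz w.1 * v w.1) * cst 1 w.2 + E^-1 *
    ((ipos w.1 * v w.1) * q w.2 + p w.1 * (ineg w.2 * v w.2)).
  by rewrite /Phi /A /B /=; ring.
have m1P (f : T -> R) : measurable_fun [set: T] f ->
    measurable_fun [set: T * T] (fun w => f w.1).
  by move=> mf; apply: measurableT_comp.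
have m2P (f : T -> R) : measurable_fun [set: T] f ->
    measurable_fun [set: T * T] (fun w => f w.2).
  by move=> mf; apply: measurableT_comp.
have mA : measurable_fun [set: T * T] A.
  apply: measurable_funD; first exact: m1P.
  by apply: measurable_funM => //; apply: measurable_funM; [exact: m1P|exact: m2P].
have mB : measurable_fun [set: T * T] B.
  by apply: measurable_funM => //; apply: measurable_funM; [exact: m1P|exact: m2P].
have mPhi (v : T -> R) : measurable_fun [set: T] v -> measurable_fun [set: T * T] (Phi v).
  move=> mv; apply: measurable_funD; apply: measurable_funM => //.
    exact: m1P.
  exact: m2P.
have Phi_int (v : T -> R) : measurable_fun [set: T] v -> (forall t, `|v t| <= 1) ->
    \int[mm]_w Phi v w = \int[m]_t v t.
  move=> mv v1.
  have bnd (b : T -> bool) t : `|(b t)%:R * v t| <= 2.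
    rewrite normrM; case: (b t); rewrite /= ?normr0 ?normr1 ?mul0r ?mul1r//.
    by apply: le_trans (v1 t) _; rewrite ler1n.
  have mizv : measurable_fun [set: T] (fun t => iz t * v t) by exact: measurable_funM.
  have mposv : measurable_fun [set: T] (fun t => ipos t * v t) by exact: measurable_funM.
  have mnegv : measurable_fun [set: T] (fun t => ineg t * v t) by exact: measurable_funM.
  have iprod (f g : T -> R) : measurable_fun [set: T] f -> measurable_fun [set: T] g ->
      (forall t, `|f t| <= 2) -> (forall t, `|g t| <= 2) ->
      mm.-integrable setT (EFin \o (fun w => f w.1 * g w.2)).
    move=> mf mg f2 g2; apply: (@bounded_integrable _ _ _ mm _ (2 * 2)).
      by apply: measurable_funM; [exact: m1P|exact: m2P].
    by move=> w; rewrite normrM ler_pM.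
  have i1 := bounded_integrable m mizv (bnd (fun t => X t == 0)).
  have i2 := bounded_integrable m mposv (bnd (fun t => 0 < X t)).
  have i3 := bounded_integrable m mnegv (bnd (fun t => X t < 0)).
  have c2 (t : T) : `|cst (1 : R) t| <= 2 by rewrite /= normr1 ler1n.
  under eq_Rintegral do rewrite PhiE.
  have j1 := iprod _ _ mizv (measurable_cst (1 : R)) (bnd (fun t => X t == 0)) c2.
  have j2 := iprod _ _ mposv mq (bnd (fun t => 0 < X t)) q2.
  have j3 := iprod _ _ mp mnegv p2 (bnd (fun t => X t < 0)).
  have j4 : mm.-integrable setT (EFin \o (fun w =>
      ipos w.1 * v w.1 * q w.2 + p w.1 * (ineg w.2 * v w.2))).
    exact: (integrableD measurableT j2 j3).
  have j5 : mm.-integrable setT (EFin \o (fun w => E^-1 * (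
      ipos w.1 * v w.1 * q w.2 + p w.1 * (ineg w.2 * v w.2)))).
    exact: (integrableZl measurableT E^-1 j4).
  rewrite (RintegralD measurableT j1 j5) (RintegralZl _ measurableT j4).
  rewrite (RintegralD measurableT j2 j3).
  rewrite (@Rintegral_prod_mul _ _ _ m (fun t => iz t * v t) (cst (1 : R)) 2)//; last exact: (bnd (fun t => X t == 0)).
  rewrite (@Rintegral_prod_mul _ _ _ m (fun t => ipos t * v t) q 2)//; last exact: (bnd (fun t => 0 < X t)).
  rewrite (@Rintegral_prod_mul _ _ _ m p (fun t => ineg t * v t) 2)//; last exact: (bnd (fun t => X t < 0)).
  rewrite Rintegral_cst// m1 !mulr1 qE -/E.
  (* If [E] is 0 then [X] vanishes almost everywhere; [E^-1] is 0 by convention and the term [iz]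
     alone yields the mean. *)
  have [EE|EE] := eqVneq E 0.
    rewrite EE invr0 mul0r addr0.
    have ae0 (f : T -> R) : measurable_fun [set: T] f -> (forall t, 0 <= f t) ->
        m.-integrable setT (EFin \o f) ->
        \int[m]_t f t = 0 -> ae_eq m setT (EFin \o f) (cst 0%E).
      move=> mf f0 jf; rewrite /Rintegral => h.
      apply/ae_eq_integral_abs => //; first exact/measurable_EFinP.
      under eq_integral do rewrite /= ger0_norm//.
      by rewrite -[LHS]fineK ?h//; exact: integrable_fin_num.
    have aep := ae0 _ mp p0 ip EE.
    have aeq : ae_eq m setT (EFin \o q) (cst 0%E) by apply: ae0 => //; rewrite qE.
    congr fine; apply: ae_eq_integral => //; do ?exact/measurable_EFinP.
    apply: filterS2 aep aeq => t /(_ I) /= [pt] /(_ I) [qt] _.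
    by rewrite /iz pqX pt qt subrr eqxx mul1r.
  have -> : \int[m]_t v t = \int[m]_t (iz t * v t) +
      (\int[m]_t (ipos t * v t) + \int[m]_t (ineg t * v t)).
    have i23 : m.-integrable setT (EFin \o (fun t => ipos t * v t + ineg t * v t)).
      exact: (integrableD measurableT i2 i3).
    rewrite -(RintegralD measurableT i2 i3) -(RintegralD measurableT i1 i23).
    by apply: eq_Rintegral => t _; rewrite -!mulrDl addrA part mul1r.
  by field.
have D0 w : 0 <= D w by rewrite addr_ge0.
have mD : measurable_fun [set: T * T] D by exact: measurable_funD.
have DPhi : D = Phi (cst (1 : R)) by apply/funext => w; rewrite /D /Phi /= !mulr1.
have ge0_fin (f : T * T -> R) (r : R) : (forall w, 0 <= f w) -> 
    measurable_fun setT f -> (exists M, forall w, f w <= M) -> 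
    \int[mm]_w f w = r -> (\int[mm]_w (f w)%:E = r%:E)%E.
  move=> f0 mf [M fM] <-; rewrite /Rintegral fineK//; apply: integrable_fin_num => //.
  by apply: (@bounded_integrable _ _ _ mm _ M) => // w; rewrite ger0_norm.
have bool1 (b : bool) : (b%:R : R) <= 1 by case: b.
have Dbnd w : D w <= 1 + E^-1 * 2 + E^-1 * 2.
  have Ei : 0 <= E^-1 by rewrite invr_ge0.
  rewrite /D /A /B; apply: lerD; first apply: lerD; first exact: bool1.
    by apply: ler_wpM2l => //; rewrite -[2]mul1r ler_pM ?bool1 ?ler0n//; have := q2 w.2; rewrite ger0_norm.
  by apply: ler_wpM2l => //; rewrite -[2]mulr1 ler_pM ?bool1 ?ler0n//; have := p2 w.1; rewrite ger0_norm.
have D1 : (\int[mm]_w (D w)%:E = 1)%E.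
  apply: ge0_fin => //; first by eexists; exact: Dbnd.
  rewrite DPhi Phi_int//; last by move=> t; rewrite normr1.
  by rewrite Rintegral_cst// m1 mulr1.
have [w0 Dw0] : exists w, 0 < D w.
  apply: contrapT => /forallNP hD; have : (\int[mm]_w (D w)%:E = 0)%E.
    rewrite integral0_eq// => w _; congr EFin; apply/eqP.
    by rewrite eq_le D0 andbT leNgt; apply/negP; exact: hD.
  by rewrite D1 => /eqP; rewrite onee_eq0.
pose m' : probability (T * T)%type R := density_measure D0 mD D1.
(* The induction hypothesis may select points where [D] is 0. There [W] repeats its value at [w0],
   so that [tau] can replace such points by [w0], where [D] is positive. *)
pose W k w := if 0 < D w then Phi (V (lift ord_max k)) w / D w
  else Phi (V (lift ord_max k)) w0 / D w0.
have PhiV k w : 0 <= Phi (V k) w <= D w.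
  have [a0 a1] := andP (V01 k w.1); have [b0 b1] := andP (V01 k w.2).
  rewrite /Phi /D; apply/andP; split; first by rewrite addr_ge0 ?(mulr_ge0 (A0 _)) ?(mulr_ge0 (B0 _)).
  by rewrite lerD// ler_piMr.
have mW k : measurable_fun [set: T * T] (W k).
  by apply: measurable_inv_pos => //; exact: mPhi.
have W01 k w : 0 <= W k w <= 1.
  have gen u : 0 < D u -> 0 <= Phi (V (lift ord_max k)) u / D u <= 1.
    move=> Du; have [a b] := andP (PhiV (lift ord_max k) u).
    by rewrite divr_ge0 ?D0//= ler_pdivrMr// mul1r.
  by rewrite /W; case: ifPn => Dw; exact: gen.
have [J [lam [th [lam0 lam1 lamW]]]] := IH _ _ m' W mW W01.
pose tau j := if 0 < D (th j) then th j else w0.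
have Dtau j : 0 < D (tau j) by rewrite /tau; case: ifPn.
have WE k j : W k (th j) = Phi (V (lift ord_max k)) (tau j) / D (tau j).
  by rewrite /W /tau; case: ifPn.
have AB j : A (tau j) / D (tau j) + B (tau j) / D (tau j) = 1.
  rewrite -mulrDl; apply: divff; apply: lt0r_neq0; exact: Dtau.
(* Each selected pair contributes its two ends with weights [A / D] and [B / D]. The last coordinate
   then averages to [z] on every pair separately, and the induction hypothesis handles the
   others. *)
exists (J * bool)%type,
  (fun jb => lam jb.1 * ((if jb.2 then A else B) (tau jb.1) / D (tau jb.1))),
  (fun jb => if jb.2 then (tau jb.1).1 else (tau jb.1).2); split.
- move=> [j b] /=; apply: mulr_ge0 => //; apply: divr_ge0 => //.
  by case: b.
- rewrite -(pair_bigA _ (fun j b => lam j * ((if b then A else B) (tau j) / D (tau j))))/=.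
  rewrite -lam1; apply: eq_bigr => j _.
  by rewrite big_bool /= -mulrDr AB mulr1.
- move=> k; rewrite -(pair_bigA _ (fun j b => lam j * ((if b then A else B) (tau j) / D (tau j)) *
    V k (if b then (tau j).1 else (tau j).2)))/=.
  have comb j : \sum_b lam j * ((if b then A else B) (tau j) / D (tau j)) *
      V k (if b then (tau j).1 else (tau j).2) =
      lam j * (Phi (V k) (tau j) / D (tau j)).
    by rewrite big_bool /Phi /=; set u := (D _)^-1; ring.
  under eq_bigr do rewrite comb.
  case: (unliftP ord_max k) => [k' ->|->].
    under eq_bigr do rewrite -WE.
    rewrite lamW; congr fine; rewrite (@ge0_integral_density _ _ _ mm m' D mD)//.
    + rewrite (eq_integral (fun w => (Phi (V (lift ord_max k')) w)%:E)).
        rewrite (ge0_fin _ (\int[m]_t V (lift ord_max k') t))//.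
        * rewrite /Rintegral fineK//; exact: (integrable_fin_num measurableT (iV _)).
        * by move=> w; case/andP: (PhiV (lift ord_max k') w).
        * exact: mPhi.
        * eexists => w; apply: le_trans (Dbnd w).
          by case/andP: (PhiV (lift ord_max k') w).
        * exact: Phi_int.
      move=> w _; rewrite /W -EFinM; congr EFin.
      case: ifPn => Dw; first by rewrite divfK// gt_eqF.
      have {}Dw : D w = 0 by apply/eqP; rewrite eq_le D0 leNgt Dw.
      have := PhiV (lift ord_max k') w; rewrite Dw mulr0 -eq_le => /eqP //.
    + by move=> w; rewrite lee_fin; case/andP: (W01 k' w).
    + exact/measurable_EFinP.
  have last j : Phi (V ord_max) (tau j) = z * D (tau j).
    have := ABX (tau j); rewrite /X /Phi /D !mulrBr => h.
    apply/eqP; rewrite -subr_eq0; apply/eqP; rewrite -[RHS]h; ring.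
  under eq_bigr => j _ do rewrite last mulfK ?(lt0r_neq0 (Dtau j))//.
  by rewrite -mulr_suml lam1 mul1r.
Qed.

(** * Transport costs and concentration *)

Section cost_integrals.
Context (R : realType) (C : R -> R) (t0 : R) (CC : even_convex_cost C t0).
Let C_ge0 := cost_ge0 CC.
Let t0_gt0 := cost_radius CC.

Lemma measurable_EFin_cost d (T : measurableType d) (f : T -> R) :
  measurable_fun [set: T] f -> measurable_fun [set: T] (fun x => (C (f x))%:E).
Proof.
move=> mf; apply/measurable_EFinP.
exact: (measurableT_comp (measurable_cost CC)).
Qed.

Lemma norm_le_cost x : `|x| <= t0 + t0^-1 * C x.
Proof.
have := cost_linear_lb CC x => h.
rewrite -(ler_pM2l t0_gt0) mulrDr mulrA divff ?gt_eqF// mul1r -expr2; lra.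
Qed.

Lemma cost_integrable d (T : measurableType d) (Q : {measure set T -> \bar R})
    (e : T -> R) : (Q [set: T] < +oo)%E -> measurable_fun [set: T] e ->
  (\int[Q]_x (C (e x))%:E < +oo)%E ->
  Q.-integrable [set: T] (EFin \o e).
Proof.
move=> Qfin me ioo.
have iC : Q.-integrable [set: T] (fun x => (C (e x))%:E).
  apply/integrableP; split; first exact: measurable_EFin_cost.
  by under eq_integral do rewrite gee0_abs ?lee_fin//.
have icst : Q.-integrable [set: T] (EFin \o cst t0).
  apply/integrableP; split; first exact/measurable_EFinP.
  under eq_integral do rewrite /= gtr0_norm//.
  by rewrite integral_cst// lte_mul_pinfty// lee_fin ltW.
apply: (@le_integrable _ _ _ Q _ measurableT _
  (fun x => (t0)%:E + t0^-1%:E * (C (e x))%:E)%E) => //.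
- exact/measurable_EFinP.
- move=> x _ /=; rewrite lee_fin (le_trans (norm_le_cost _))//.
  exact: ler_norm.
- by apply: integrableD => //; exact: integrableZl.
Qed.

(* Unconditional, since the right side is [+oo] unless [e] is integrable. *)
Lemma cost_jensen d (T : measurableType d) (Q : {measure set T -> \bar R})
    (e : T -> R) : Q [set: T] = 1%E -> measurable_fun [set: T] e ->
  ((C (\int[Q]_x e x)%R)%:E <= \int[Q]_x (C (e x))%:E)%E.
Proof.
move=> Q1 me; have Qfin : (Q [set: T] < +oo)%E by rewrite Q1 ltry.
have [ioo|] := boolP ((\int[Q]_x (C (e x))%:E)%E < +oo)%E; last first.
  by rewrite -leNgt leye_eq => /eqP ->; exact: leey.
have ie := cost_integrable Qfin me ioo.
have iC : Q.-integrable [set: T] (fun x => (C (e x))%:E).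
  apply/integrableP; split; first exact: measurable_EFin_cost.
  by under eq_integral do rewrite gee0_abs ?lee_fin//.
set z := (\int[Q]_x e x)%R.
have [b hb] := cost_subgradient CC z.
have icst (c : R) : Q.-integrable [set: T] (EFin \o cst c).
  apply/integrableP; split => /=; first exact/measurable_EFinP.
  by rewrite integral_cst// Q1 mule1 ltry.
rewrite -[leRHS]fineK; last exact: integrable_fin_num.
rewrite lee_fin.
have iz : Q.-integrable setT (EFin \o (fun x => e x - z)).
  exact: (integrableB measurableT ie (icst z)).
have ibz : Q.-integrable setT (EFin \o (fun x => b * (e x - z))).
  exact: (integrableZl measurableT b iz).
have -> : C z = \int[Q]_x (C z + b * (e x - z)).
  rewrite (RintegralD measurableT (icst (C z)) ibz).
  rewrite (RintegralZl _ measurableT iz) (RintegralB measurableT ie (icst z)).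
  by rewrite !Rintegral_cst// Q1/= !mulr1 subrr mulr0 addr0.
apply: le_Rintegral => //.
exact: (integrableD measurableT (icst (C z)) ibz).
Qed.

End cost_integrals.

(** The strict bound selects an almost optimal coupling; only its kernel and its second marginal
    matter later. *)
Lemma weak_transport_kernel (R : realType) (w : R -> R) (mu1 mu2 : probability R R)
    (r : R) : (weak_transport_cost w mu2 mu1 < r%:E)%E ->
  exists p : R.-pker R ~> R,
    (forall B, measurable B -> mu2 B = \int[mu1]_x p x B)%E /\
    (\int[mu1]_x (w (x - (\int[p x]_y y)%R)%R)%:E <= r%:E)%E.
Proof.
move=> /ereal_inf_lt[_ [pi [p [[_ c2] dis ->]]]] /ltW h.
exists p; split => // B mB; rewrite -c2// -dis//.
by congr (pi _); apply/seteqP; split => // x [].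
Qed.

Lemma measurable_Rintegral_kernel d d' (T : measurableType d)
    (X : measurableType d') (R : realType) (k : T -> {measure set X -> \bar R})
    (mk : forall U, measurable U -> measurable_fun [set: T] (k ^~ U))
    (e : X -> R) : measurable_fun [set: X] e ->
  measurable_fun [set: T] (fun t => \int[k t]_x e x).
Proof.
move=> me; apply: measurableT_comp => //.
have -> : (fun t => \int[k t]_x (e x)%:E)%E =
    (fun t => \int[k t]_x (EFin \o e)^\+ x - \int[k t]_x (EFin \o e)^\- x)%E.
  by apply/funext => t; rewrite integralE.
have mE : measurable_fun [set: X] (EFin \o e) by exact/measurable_EFinP.
apply: emeasurable_funB.
- by apply: measurable_fun_integral_kernel => //; exact: measurable_funepos.
- by apply: measurable_fun_integral_kernel => //; exact: measurable_funeneg.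
Qed.

Section concentration.
Local Open Scope ereal_scope.
Context (R : realType) (C : R -> R) (t0 : R) (CC : even_convex_cost C t0).
Context (mu : probability R R) (a : R).
Context (mom : finite_first_moment mu).
Context (wti : forall nu, finite_first_moment nu ->
  weak_transport_cost (fun x => C (a * x)) nu mu <= relative_entropy nu mu).
Let C_ge0 := cost_ge0 CC.
Local Notation m := (\int[mu]_x x)%R.

(** The sign treats the upper and the lower tail at once. *)
Let side (sg : bool) (x : R) : R := ((-1) ^+ sg * (x - m))%R.

Let measurable_side sg : measurable_fun [set: R] (side sg).
Proof. by apply: measurable_funM => //; exact: measurable_funB. Qed.

Let half (s : R) sg := [set x | (s <= side sg x)%R].

Let measurable_half s sg : measurable (half s sg).
Proof.
rewrite (_ : half s sg = side sg @^-1` `[s, +oo[).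
  by rewrite -[X in measurable X]setTI; exact: measurable_side.
by apply/seteqP; split => x /=; rewrite in_itv/= andbT.
Qed.

Let integrable_side (Q : {measure set R -> \bar R}) sg : Q [set: R] = 1 ->
  Q.-integrable setT (fun x => x%:E) -> Q.-integrable setT (EFin \o side sg).
Proof.
move=> Q1 Qmom.
have ic : Q.-integrable [set: R] (EFin \o cst m).
  apply/integrableP; split => /=; first exact/measurable_EFinP.
  by rewrite integral_cst// Q1 mule1 ltry.
apply: (@integrableZl _ _ _ Q _ measurableT ((-1) ^+ sg) (fun x => (x - m)%:E)).
exact: (integrableB measurableT Qmom ic).
Qed.

Let barycenter_half (Q : {measure set R -> \bar R}) s sg : Q [set: R] = 1 ->
  Q.-integrable setT (fun x => x%:E) -> Q (~` half s sg) = 0 ->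
  (s <= side sg (\int[Q]_y y)%R)%R.
Proof.
move=> Q1 Qmom Qhalf.
have ic (c : R) : Q.-integrable [set: R] (EFin \o cst c).
  apply/integrableP; split => /=; first exact/measurable_EFinP.
  by rewrite integral_cst// Q1 mule1 ltry.
have is1 := integrable_side sg Q1 Qmom.
have ixm : Q.-integrable [set: R] (EFin \o (fun x => x - m)%R).
  exact: (integrableB measurableT Qmom (ic m)).
have -> : side sg (\int[Q]_y y)%R = (\int[Q]_y side sg y)%R.
  rewrite (RintegralZl _ measurableT ixm) (RintegralB measurableT Qmom (ic m)).
  by rewrite Rintegral_cst// Q1 mulr1.
(* [Q] charges only the half-line, so [side] may be replaced by a function that is at least [s]
   everywhere. *)
have -> : (\int[Q]_y side sg y = \int[Q]_y Num.max s (side sg y))%R.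
  congr fine; apply: ae_eq_integral => //.
  - exact/measurable_EFinP.
  - by apply/measurable_EFinP; exact: measurable_maxr.
  - exists (~` half s sg); split => //; first exact: measurableC.
    move=> x /= h hx; apply: h => _; congr EFin; rewrite max_r//.
have sE : (\int[Q]_y s)%R = s by rewrite Rintegral_cst// Q1 mulr1.
rewrite -{1}sE.
apply: le_Rintegral => //; first exact: ic.
  apply: (@le_integrable _ _ _ Q _ measurableT _
      (fun y => (`|s|)%:E + `|(side sg y)%:E|)) => //.
  - by apply/measurable_EFinP; exact: measurable_maxr.
  - move=> y _ /=; rewrite lee_fin [leRHS]ger0_norm ?addr_ge0//.
    case: (leP s (side sg y)) => _; first by rewrite lerDr.
    by rewrite lerDl.
  - by apply: integrableD => //; [exact: ic|exact: integrable_abse].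
by move=> y _; rewrite le_max lexx.
Qed.

(* The inequality is applied to [mu] conditioned on a half-line of mass [u]: its
   entropy is [- ln u], and almost all barycenters of the coupling are at distance
   at least [s] from the mean, on the same side. *)
Lemma half_tail s sg : (0 <= s)%R ->
  mu (half s sg) <= (expR (- C (a * s)))%:E.
Proof.
move=> s0; set A := half s sg; have mA : measurable A by exact: measurable_half.
pose u := fine (mu A).
have muA : mu A = u%:E by rewrite fineK// fin_num_measure.
have [u_eq0|u_neq0] := eqVneq u 0%R.
  by rewrite muA u_eq0 lee_fin expR_ge0.
have u0 : (0 < u)%R by rewrite lt_neqAle eq_sym u_neq0 fine_ge0.
have u1 : (u <= 1)%R by rewrite -lee_fin -muA probability_le1.
pose g x : R := (u^-1 * \1_A x)%R.
have g0 x : (0 <= g x)%R by rewrite mulr_ge0 ?invr_ge0// ltW.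
have mg : measurable_fun [set: R] g.
  by apply: measurable_funM => //; exact: measurable_indic.
have int_indic c : \int[mu]_x (c * \1_A x)%:E = (c * u)%:E.
  under eq_integral do rewrite EFinM.
  rewrite integralZl//; last exact: integrable_indic.
  by rewrite integral_indic// setIT EFinM; congr (_ * _).
have g1 : \int[mu]_x (g x)%:E = 1 by rewrite int_indic mulVf.
pose nu : probability R R := density_measure g0 mg g1.
have nuE B : measurable B -> nu B = \int[mu]_(x in B) (g x)%:E by [].
have nu_mom : finite_first_moment nu.
  apply/integrableP; split; first exact: EFin_measurable.
  rewrite (ge0_integral_density mg nuE)//; last by apply: measurableT_comp => //; exact: EFin_measurable.
  apply: (@le_lt_trans _ _ (\int[mu]_x (u^-1%:E * `|x%:E|))).
    apply: ge0_le_integral => //.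
    - by move=> x _; rewrite mule_ge0// lee_fin.
    - apply: emeasurable_funM; first by apply: measurableT_comp => //; exact: EFin_measurable.
      exact/measurable_EFinP.
    - by apply: measurable_funeM; apply: measurableT_comp => //; exact: EFin_measurable.
    - move=> x _; rewrite muleC lee_wpmul2r// lee_fin /g indicE.
      by case: (_ \in _); rewrite ?mulr1// mulr0 invr_ge0 ltW.
  rewrite ge0_integralZl_EFin ?invr_ge0 ?(ltW u0)//; last first.
    by apply: measurableT_comp => //; exact: EFin_measurable.
  by case/integrableP: mom => _ h; rewrite lte_mul_pinfty// lee_fin invr_ge0 ltW.
have H : relative_entropy nu mu = (- ln u)%:E.
  rewrite (relative_entropyE g0 mg nuE).
  rewrite (eq_integral (fun x => ((u^-1 * ln u^-1) * \1_A x)%:E)).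
    by rewrite int_indic mulrAC mulVf// mul1r lnV.
  move=> x _; rewrite /g indicE; case: (_ \in _); rewrite ?mulr1//.
  by rewrite !mulr0 mul0r.
have key e : (0 < e)%R -> (C (a * s) <= - ln u + e)%R.
  move=> e0; have /weak_transport_kernel[p [pE pcost]] :
      weak_transport_cost (fun x => C (a * x)) nu mu < (- ln u + e)%:E.
    by apply: le_lt_trans (wti nu_mom) _; rewrite H lte_fin ltrDl.
  rewrite -lee_fin; apply: le_trans pcost.
  have ae1 : {ae mu, forall x, p x (~` A) = 0}.
    have : ae_eq mu setT (fun x => p x (~` A)) (cst 0).
      apply/ae_eq_integral_abs => //.
        by apply: measurable_kernel; exact: measurableC.
      under eq_integral do rewrite gee0_abs//.
      rewrite -pE ?nuE; [|exact: measurableC..].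
      by rewrite integral0_eq// => x nAx; rewrite /g indicE memNset// mulr0.
    by apply: filterS => x /(_ I).
  have mk U : measurable U -> measurable_fun [set: R] (p ^~ U).
    exact: measurable_kernel.
  have p1 x : p x [set: R] = 1 by exact: prob_kernel.
  (* Almost every [p x] has a barycenter because the second marginal [nu] has a first moment;
     elsewhere the real integral is a conventional value. *)
  have ae2 : {ae mu, forall x, (p x).-integrable setT (fun y => y%:E)}.
    have : mu.-integrable setT (fun x => \int[p x]_y `|y%:E|).
      apply/integrableP; split.
        apply: measurable_fun_integral_kernel => //.
        by apply: measurableT_comp => //; exact: EFin_measurable.
      under eq_integral do rewrite gee0_abs ?integral_ge0//.
      rewrite -(ge0_integral_mixture mk p1 pE)//; last first.
        by apply: measurableT_comp => //; exact: EFin_measurable.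
      by case/integrableP: nu_mom.
    move/(integrable_ae measurableT); apply: filterS => x /(_ I) fin.
    apply/integrableP; split; first exact: EFin_measurable.
    by rewrite ltey_eq fin.
  (* [h x] is a lower bound for the displacement of [x], whose barycenter has [side] at least [s].
     As [side] has mean 0 under [mu], the mean of [h] is at least [s], and Jensen's inequality
     yields [C (a * s)]. *)
  pose h x := Num.max (s - side sg x)%R 0%R.
  have mh : measurable_fun [set: R] h.
    by apply: measurable_maxr => //; exact: measurable_funB.
  have mah : measurable_fun [set: R] (fun x => a * h x)%R.
    exact: measurable_funM.
  have mT : measurable_fun [set: R] (fun x => a * (x - \int[p x]_y y))%R.
    apply: measurable_funM => //; apply: measurable_funB => //.
    exact: measurable_Rintegral_kernel.
  apply: (@le_trans _ _ (\int[mu]_x (C (a * h x))%:E)); last first.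
    apply: ae_ge0_le_integral => //.
    - by move=> x _; rewrite lee_fin.
    - exact: (measurable_EFin_cost CC).
    - by move=> x _; rewrite lee_fin.
    - exact: (measurable_EFin_cost CC).
    - apply: filterS2 ae1 ae2 => x px px2 _; rewrite lee_fin.
      apply: (cost_mono CC); rewrite !normrM ler_wpM2l//.
      have := barycenter_half (p1 x) px2 px.
      rewrite /h ger0_norm ?le_max ?lexx ?orbT// ge_max normr_ge0 andbT /side.
      set T := (\int[p x]_y y)%R => hs.
      apply: (@le_trans _ _ ((-1) ^+ sg * (T - x))%R).
        by move: hs; rewrite !mulrBr; lra.
      apply: le_trans (ler_norm _) _.
      by rewrite normrM normrX normrN1 expr1n mul1r distrC.
  apply: le_trans (cost_jensen CC (probability_setT mu) mah).
  rewrite lee_fin; apply: (cost_mono CC).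
  have ic (r : R) : mu.-integrable setT (EFin \o cst r).
    exact: finite_measure_integrable_cst.
  have iside := integrable_side sg (probability_setT mu) mom.
  have ixm : mu.-integrable setT (EFin \o (fun x => x - m)%R).
    exact: (integrableB measurableT mom (ic m)).
  have ih : mu.-integrable setT (EFin \o (fun x => s - side sg x)%R).
    exact: (integrableB measurableT (ic s) iside).
  have ihm : mu.-integrable setT (EFin \o h).
    have -> : EFin \o h = (EFin \o (fun x => s - side sg x)%R)^\+.
      by apply/funext => x; rewrite funeposE /h /= EFin_max.
    exact: integrable_funepos.
  rewrite (RintegralZl _ measurableT ihm) !normrM ler_wpM2l//.
  rewrite !ger0_norm//; last by apply: Rintegral_ge0 => x _; rewrite le_max lexx orbT.
  have sE : (\int[mu]_x (s - side sg x))%R = s.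
    rewrite (RintegralB measurableT (ic s) iside) (RintegralZl _ measurableT ixm).
    rewrite (RintegralB measurableT mom (ic m)) !Rintegral_cst//.
    have mu1 : fine (mu [set: R]) = 1%R by rewrite probability_setT.
    by rewrite mu1 !mulr1 subrr mulr0 subr0.
  by rewrite -[leLHS]sE; apply: le_Rintegral => // x _; rewrite le_max lexx.
rewrite muA lee_fin.
have Cu : (C (a * s) <= - ln u)%R by apply/ler_addgt0Pr => e e0; exact: key.
by rewrite -(@lnK _ u) ?posrE// ler_expR; lra.
Qed.

End concentration.

Section exponential_moment.
Local Open Scope ereal_scope.
Context (R : realType) (C : R -> R) (t0 : R) (CC : even_convex_cost C t0).
Let t0_gt0 := cost_radius CC.

(** The linear lower bound on [C] dominates the terms by a geometric series of ratio
    [expR (- t0 / 2)]. *)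
Lemma expR_cost_sum : exists2 K : R, (0 < K)%R &
  \sum_(0 <= n <oo) (2 * expR (- C n.+1%:R / 2))%:E <= K%:E.
Proof.
pose r : R := expR (- t0 / 2).
have r0 : (0 < r)%R by exact: expR_gt0.
have r1 : (r < 1)%R by rewrite -[ltRHS]expR0 ltr_expR; move: t0_gt0; lra.
pose D : R := (2 * expR (t0 ^+ 2 / 2))%R.
have D0 : (0 < D)%R by rewrite mulr_gt0// expR_gt0.
have term n : (2 * expR (- C n.+1%:R / 2) <= D * r ^+ n)%R.
  rewrite /D -mulrA ler_pM2l// /r -expRM_natl -expRD ler_expR.
  have := cost_linear_lb CC n.+1%:R; rewrite ger0_norm// => h.
  have : (t0 * n%:R <= t0 * n.+1%:R)%R by rewrite ler_pM2l// ler_nat.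
  lra.
exists (D / (1 - r))%R; first by rewrite divr_gt0// subr_gt0.
apply: lime_le.
  by apply: is_cvg_nneseries => n _ _; rewrite lee_fin mulr_ge0// expR_ge0.
near=> N; rewrite sumEFin lee_fin.
apply: (@le_trans _ _ (series (geometric D r) N)).
  by rewrite /series/= ler_sum.
by apply: geometric_le_lim => //; [exact: ltW|rewrite ger0_norm ?ltW].
Unshelve. all: by end_near.
Qed.

(** Where [a * |x - mean|] lies between [n + 1] and [n + 2], a quarter of it is at most
    [(n + 1) / 2], so by convexity the exponent is at most [C (n + 1) / 2], against a tail of mass
    at most [2 * expR (- C (n + 1))]. The order of the quantifiers matters: [K] is fixed before [mu]
    and [a]. *)
Lemma exponential_moment : exists2 K : R, (0 < K)%R &
  forall (mu : probability R R) (a : R), (0 < a)%R ->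
  finite_first_moment mu ->
  (forall nu, finite_first_moment nu ->
    weak_transport_cost (fun x => C (a * x)) nu mu <= relative_entropy nu mu) ->
  \int[mu]_x (expR (C (a * (x - \int[mu]_y y) / 4)))%:E <= K%:E.
Proof.
have [S S0 sumS] := expR_cost_sum.
exists (expR (C (1 / 4)) + S)%R; first by rewrite addr_gt0// expR_gt0.
move=> mu a a0 mom wti; set m := (\int[mu]_y y)%R.
pose B n := [set x : R | (n.+1%:R <= a * `|x - m|)%R].
have mY : measurable_fun [set: R] (fun x => a * `|x - m|)%R.
  apply: measurable_funM => //; apply: measurableT_comp => //.
  exact: measurable_funB.
have mB n : measurable (B n).
  rewrite (_ : B n = (fun x => a * `|x - m|)%R @^-1` `[n.+1%:R, +oo[).
    by rewrite -[X in measurable X]setTI; exact: mY.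
  by apply/seteqP; split => x /=; rewrite in_itv/= andbT.
have muB n : mu (B n) <= (2 * expR (- C n.+1%:R))%:E.
  pose h (sg : bool) := [set x : R | (n.+1%:R / a <= (-1) ^+ sg * (x - m))%R].
  have mh sg : measurable (h sg).
    rewrite (_ : h sg = (fun x => (-1) ^+ sg * (x - m))%R @^-1` `[(n.+1%:R / a)%R, +oo[).
      rewrite -[X in measurable X]setTI.
      have : measurable_fun [set: R] (fun x => (-1) ^+ sg * (x - m))%R.
        by apply: measurable_funM => //; exact: measurable_funB.
      exact.
    by apply/seteqP; split => x /=; rewrite in_itv/= andbT.
  have muh (sg : bool) : mu (h sg) <= (expR (- C n.+1%:R))%:E.
    have := half_tail CC mom wti (s := (n.+1%:R / a)%R) sg.
    by rewrite mulrCA divff ?gt_eqF// mulr1; apply; rewrite divr_ge0// ltW.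
  apply: (@le_trans _ _ (mu (h false `|` h true))).
    apply: le_measure; rewrite ?inE//; first exact: measurableU.
    move=> x; rewrite /B /h /= -ler_pdivrMl// mulrC.
    rewrite expr0 expr1 mul1r mulN1r.
    by case: (ler0P (x - m)) => _; [right|left].
  apply: le_trans (measureU2 _ _ _) _ => //.
  by apply: le_trans (leeD (muh _) (muh _)) _; rewrite -EFinD lee_fin; lra.
pose F n x := (\1_(B n) x * expR (C n.+1%:R / 2))%:E : \bar R.
have mF n : measurable_fun [set: R] (F n).
  by apply/measurable_EFinP; apply: measurable_funM.
have F0 n x : 0 <= F n x by rewrite lee_fin mulr_ge0// expR_ge0.
pose G x := \sum_(0 <= n <oo) F n x.
have G0 x : 0 <= G x by apply: nneseries_ge0.
have mG : measurable_fun [set: R] G.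
  by apply: ge0_emeasurable_sum => //.
apply: (@le_trans _ _ (\int[mu]_x ((expR (C (1 / 4)))%:E + G x))).
  apply: ge0_le_integral => //.
  - apply/measurable_EFinP; apply: measurableT_comp => //.
    apply: (measurableT_comp (measurable_cost CC)).
    apply: measurable_funM => //; apply: measurable_funM => //.
    exact: measurable_funB.
  - exact: emeasurable_funD.
  - move=> x _; pose Y := (a * `|x - m|)%R.
    have Y0 : (0 <= Y)%R by rewrite mulr_ge0// ltW.
    have -> : C (a * (x - m) / 4) = C (Y / 4).
      by rewrite -(cost_norm CC) !normrM (gtr0_norm a0) normfV [`|4|%R]ger0_norm.
    have [Y1|Y1] := ltP Y 1%R.
      apply: le_trans (leeDl _ (G0 x)); rewrite lee_fin ler_expR.
      apply: (cost_mono CC); by rewrite !ger0_norm ?divr_ge0//; lra.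
    have /andP[] := truncn_itv Y0; set n := Num.Def.trunc Y => nY Yn.
    have n1 : (0 < n)%N by rewrite /n truncn_gt0.
    case: n n1 nY Yn => // n _ nY Yn.
    apply: (@le_trans _ _ (G x)); last by rewrite leeDr// lee_fin expR_ge0.
    have h := nneseries_lim_ge (P := xpredT) (m := 0) n.+1 (fun k _ _ => F0 k x).
    apply: le_trans h; rewrite big_nat_recr//=.
    apply: (@le_trans _ _ (F n x)); last by rewrite leeDr// sume_ge0.
    rewrite /F indicE mem_set// mul1r lee_fin ler_expR.
    have h2 : (C (2^-1 * n.+1%:R) <= 2^-1 * C n.+1%:R)%R.
      by apply: (cost_scale CC); apply/andP; split; lra.
    rewrite (mulrC _ (2^-1)%R); apply: le_trans h2.
    apply: (cost_mono CC); rewrite !ger0_norm ?divr_ge0 ?mulr_ge0 ?(ltW a0)//.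
    have : (n.+2%:R <= 2 * n.+1%:R :> R)%R by rewrite -natrM ler_nat mul2n -addnn addnS addSn ltnS leq_addr.
    by lra.
rewrite ge0_integralD//.
rewrite probability_integral_cst EFinD leeD2l//.
rewrite integral_nneseries//; apply: le_trans sumS.
apply: lee_nneseries => [n _ _|n _]; first exact: integral_ge0.
under eq_integral do rewrite /F mulrC EFinM.
rewrite ge0_integralZl_EFin ?expR_ge0//; last first.
  by apply/measurable_EFinP; exact: measurable_indic.
rewrite integral_indic// setIT.
apply: le_trans (lee_wpmul2l _ (muB n)) _; first by rewrite lee_fin expR_ge0.
rewrite -EFinM lee_fin mulrCA -expRD ler_pM2l// ler_expR; lra.
Qed.

End exponential_moment.

(** * Discretization of the line *)

Section bins.
Context (R : realType) (K : finType) (kap : R -> K).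
Context (mkap : forall k, measurable (kap @^-1` [set k])).
Local Notation bin k := (kap @^-1` [set k]).

Definition mass (P : set R -> \bar R) (k : K) : R := fine (P (bin k)).

Lemma comp_binE (g : K -> R) x : g (kap x) = \sum_k g k * \1_(bin k) x.
Proof.
rewrite (bigD1 (kap x))//= big1 ?addr0.
  by rewrite indicE mem_set// mulr1.
by move=> k /eqP kx; rewrite indicE memNset ?mulr0//= => /esym.
Qed.

Lemma measurable_comp_bin (g : K -> R) : measurable_fun [set: R] (g \o kap).
Proof.
have -> : g \o kap = (fun x => \sum_k g k * \1_(bin k) x).
  by apply/funext => x; exact: comp_binE.
apply: measurable_sum => k; apply: measurable_funM => //.
Qed.

Lemma comp_bin_le (g : K -> R) x : `|g (kap x)| <= \sum_k `|g k|.
Proof. by rewrite (bigD1 (kap x))//= lerDl sumr_ge0. Qed.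

Lemma mass_ge0 (P : {measure set R -> \bar R}) k : 0 <= mass P k.
Proof. exact: fine_ge0. Qed.

Section total_mass_one.
Context (Q : {measure set R -> \bar R}) (Q1 : Q [set: R] = 1%E).

Lemma bin_fin_num A : measurable A -> Q A \is a fin_num.
Proof.
move=> mA; rewrite ge0_fin_numE//; apply: le_lt_trans (ltry 1).
by rewrite -Q1; apply: le_measure; rewrite ?inE.
Qed.

Lemma integrable_comp_bin (g : K -> R) :
  Q.-integrable [set: R] (EFin \o (g \o kap)).
Proof.
apply: measurable_bounded_integrable => //; first by rewrite Q1 ltry.
  exact: measurable_comp_bin.
exists (\sum_k `|g k|); split; first exact: num_real.
by move=> x Mx t _; apply: le_trans (comp_bin_le g t) (ltW Mx).
Qed.

Lemma integral_comp_bin (g : K -> R) :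
  (\int[Q]_x (g (kap x))%:E = (\sum_k mass Q k * g k)%:E)%E.
Proof.
under eq_integral do rewrite comp_binE -sumEFin.
have ind k : Q.-integrable [set: R] (fun x => (\1_(bin k) x)%:E).
  apply: measurable_bounded_integrable => //; first by rewrite Q1 ltry.
  exists 1; split; first exact: num_real.
  by move=> x Mx t _ /=; rewrite indicE; case: (_ \in _); rewrite ?normr1 ?normr0 ?ltW// (lt_trans _ Mx).
rewrite integral_sum//; last first.
  by move=> k; exact: (integrableZl measurableT (g k) (ind k)).
rewrite -sumEFin; apply: eq_bigr => k _.
under eq_integral do rewrite EFinM.
rewrite integralZl// integral_indic// setIT muleC EFinM /mass fineK//.
exact: bin_fin_num.
Qed.

Lemma Rintegral_comp_bin (g : K -> R) :
  \int[Q]_x g (kap x) = \sum_k mass Q k * g k.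
Proof. by rewrite /Rintegral integral_comp_bin. Qed.

Lemma sum_mass : \sum_k mass Q k = 1.
Proof.
have := integral_comp_bin (fun=> 1); rewrite integral_cst// Q1 mule1 => -[->].
by apply: eq_bigr => k _; rewrite mulr1.
Qed.

End total_mass_one.

Lemma ge0_integral_bins (Q : {measure set R -> \bar R}) (f : R -> \bar R) :
  (forall x, 0 <= f x)%E -> measurable_fun [set: R] f ->
  (\int[Q]_x f x = \sum_k \int[Q]_(x in bin k) f x)%E.
Proof.
move=> f0 mf; under [RHS]eq_bigr do rewrite integral_mkcond.
rewrite -ge0_integral_sum//.
- apply: eq_integral => x _; rewrite (bigD1 (kap x))//= big1 ?adde0.
    by rewrite patchE mem_set.
  by move=> k /eqP kx; rewrite patchE memNset//= => /esym.
- by move=> k; apply/(measurable_restrict _ (mkap k) measurableT); exact: measurable_funTS.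
- by move=> k x _; rewrite patchE; case: ifP.
Qed.

Lemma Rintegral_bins (Q : {measure set R -> \bar R}) (f : R -> R) :
  Q.-integrable [set: R] (EFin \o f) ->
  \int[Q]_x f x = \sum_k \int[Q]_(x in bin k) f x.
Proof.
move=> fi; pose F k := (EFin \o f) \_ (bin k).
have fik k : Q.-integrable (bin k) (EFin \o f).
  exact: (integrableS measurableT (mkap k) (@subsetT _ _) fi).
have Fi k : Q.-integrable [set: R] (F k).
  by rewrite /F -integrable_mkcond.
apply: EFin_inj; rewrite -sumEFin.
transitivity (\int[Q]_x (f x)%:E)%E.
  by rewrite /Rintegral fineK//; exact: (integrable_fin_num measurableT fi).
transitivity (\sum_k \int[Q]_x F k x)%E; last first.
  apply: eq_bigr => k _; rewrite /F -integral_mkcond /Rintegral fineK//.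
  exact: (integrable_fin_num (mkap k) (fik k)).
rewrite -(integral_sum measurableT Fi).
apply: eq_integral => x _; rewrite (bigD1 (kap x))//= big1 ?adde0.
  by rewrite /F patchE mem_set.
by move=> k /eqP kx; rewrite /F patchE memNset//= => /esym.
Qed.

End bins.

Section conditional_jensen.
Context (R : realType) (C : R -> R) (t0 : R) (CC : even_convex_cost C t0).

(** The supporting line at [w] is integrated over [A]. Everything is multiplied by the mass of [A],
    which covers null sets. *)
Lemma cost_conditional_jensen (al : probability R R) (A : set R) (u : R -> R)
    (D w : R) :
  measurable A -> measurable_fun [set: R] u -> (forall x, `|u x| <= D) ->
  \int[al]_(x in A) u x = fine (al A) * w ->
  ((fine (al A) * C w)%:E <= \int[al]_(x in A) (C (u x))%:E)%E.
Proof.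
move=> mA mu uD uw; have [b hb] := cost_subgradient CC w.
have iu := integrableS measurableT mA (@subsetT _ A) (bounded_integrable al mu uD).
have ic (c : R) : al.-integrable A (EFin \o cst c).
  exact: finite_measure_integrable_cst.
have iuw : al.-integrable A (EFin \o (fun x => u x - w)).
  exact: (integrableB mA iu (ic w)).
have ibuw : al.-integrable A (EFin \o (fun x => b * (u x - w))).
  exact: (integrableZl mA b iuw).
have CD x : `|C (u x)| <= C D.
  rewrite (ger0_norm (cost_ge0 CC _)); apply: (cost_mono CC).
  by apply: le_trans (uD x) (ler_norm _).
have mCu : measurable_fun [set: R] (C \o u).
  exact: (measurableT_comp (measurable_cost CC)).
have iC := integrableS measurableT mA (@subsetT _ A) (bounded_integrable al mCu CD).
rewrite -[leRHS]fineK; last exact: (integrable_fin_num mA iC).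
rewrite lee_fin.
have -> : fine (al A) * C w = \int[al]_(x in A) (C w + b * (u x - w)).
  rewrite (RintegralD mA (ic (C w)) ibuw) (RintegralZl _ mA iuw).
  rewrite (RintegralB mA iu (ic w)) !Rintegral_cst// uw.
  by rewrite [w * _]mulrC subrr mulr0 addr0 mulrC.
apply: le_Rintegral => //.
exact: (integrableD mA (ic (C w)) ibuw).
Qed.

End conditional_jensen.

Section binned_costs.
Context (R : realType) (C : R -> R) (t0 : R) (CC : even_convex_cost C t0).
Context (K : finType) (kap : R -> K).
Context (mkap : forall k, measurable (kap @^-1` [set k])) (z : K -> R).
Local Notation bin k := (kap @^-1` [set k]).
Let C_ge0 := cost_ge0 CC.

Let err (x : R) : R := x - z (kap x).

Let measurable_z_kap : measurable_fun [set: R] (fun x => z (kap x)).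
Proof. exact: measurable_comp_bin. Qed.

Let measurable_err : measurable_fun [set: R] err.
Proof. exact: measurable_funB. Qed.

Lemma cost_shrink_abs q x : 0 <= q <= 1 -> C (q * x) <= C x.
Proof.
move=> /andP[q0 q1]; apply: (cost_mono CC); rewrite normrM (ger0_norm q0).
by rewrite ler_piMl.
Qed.

Section rounding.
Context (Q : {measure set R -> \bar R}) (Q1 : Q [set: R] = 1%E).

(** The two means differ by the mean of [err]. If the right side is finite, the growth of the cost
    makes [s * err] integrable; [s != 0] passes this on to [err], and then to [y], the binned part
    being bounded. *)
Lemma rounded_mean_cost (s : R) : s != 0 ->
  ((C (s * (\int[Q]_y y - \sum_k mass kap Q k * z k)))%:E <=
   \int[Q]_y (C (s * err y))%:E)%E.
Proof.
move=> s0; have me : measurable_fun [set: R] (fun y => s * err y).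
  exact: measurable_funM.
have [fin|] := boolP ((\int[Q]_y (C (s * err y))%:E)%E < +oo)%E; last first.
  by rewrite -leNgt leye_eq => /eqP ->; exact: leey.
have Qfin : (Q [set: R] < +oo)%E by rewrite Q1 ltry.
have ise := cost_integrable CC Qfin me fin.
have iz := integrable_comp_bin mkap Q1 z.
have ie : Q.-integrable setT (EFin \o err).
  have := integrableZl measurableT s^-1 ise.
  apply: eq_integrable => // x _ /=.
  by rewrite -EFinM mulrA mulVf// mul1r.
have iy : Q.-integrable setT (EFin \o (fun x => x)).
  have := integrableD measurableT ie iz.
  by apply: eq_integrable => // x _ /=; rewrite -EFinD /err subrK.
have -> : s * (\int[Q]_y y - \sum_k mass kap Q k * z k) = \int[Q]_y (s * err y).
  rewrite (RintegralZl _ measurableT ie) (RintegralB measurableT iy iz).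
  by rewrite (Rintegral_comp_bin mkap Q1).
exact: (cost_jensen CC Q1 me).
Qed.

End rounding.

(** [M k l] is the conditional probability of reaching bin [l] from bin [k]. The factor 3 pays for
    three displacements: from [x] to its barycenter, the rounding of [x], and the rounding of the
    barycenter, which Jensen's inequality bounds by the rounding cost of [be]. A second use of
    Jensen's inequality merges the points of a bin. *)
Lemma binned_coupling (al be : probability R R)
    (p : R -> {measure set R -> \bar R})
    (mp : forall U, measurable U -> measurable_fun [set: R] (p ^~ U))
    (p1 : forall x, p x [set: R] = 1%E)
    (pE : forall B, measurable B -> (be B = \int[al]_x p x B)%E)
    (b t ea eb : R) : 0 < b ->
  (\int[al]_x (C (3 * b * (x - \int[p x]_y y)))%:E <= t%:E)%E ->
  (\int[al]_x (C (3 * b * err x))%:E <= ea%:E)%E ->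
  (\int[be]_x (C (3 * b * err x))%:E <= eb%:E)%E ->
  exists M : K -> K -> R, [/\ forall k l, 0 <= M k l,
    forall k, \sum_l M k l = 1,
    forall l, \sum_k mass kap al k * M k l = mass kap be l &
    \sum_k mass kap al k * C (b * (z k - \sum_l M k l * z l)) <= t + ea + eb].
Proof.
move=> b0 ht ha hb.
pose W k l : R := \int[al]_(x in bin k) fine (p x (bin l)).
have al1 : al [set: R] = 1%E by exact: probability_setT.
have be1 : be [set: R] = 1%E by exact: probability_setT.
have pfin x l : p x (bin l) \is a fin_num by exact: (bin_fin_num (p1 x) (mkap l)).
have p_ge0 x l : 0 <= fine (p x (bin l)) by exact: fine_ge0.
have p_le1 x l : fine (p x (bin l)) <= 1.
  by rewrite -(sum_mass mkap (p1 x)) (bigD1 l)//= /mass lerDl sumr_ge0.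
have mpl l : measurable_fun [set: R] (fun x => fine (p x (bin l))).
  by apply: measurableT_comp => //; exact: mp.
have WE k l : ((W k l)%:E = \int[al]_(x in bin k) p x (bin l))%E.
  rewrite /W /Rintegral fineK; last first.
    apply: (integrable_fin_num (mkap k)).
    apply: (integrableS measurableT (mkap k) (@subsetT _ _)).
    by apply: (bounded_integrable al (M := 1)) => // x; rewrite ger0_norm.
  by apply: eq_integral => x _; rewrite fineK.
have W0 k l : 0 <= W k l by apply: Rintegral_ge0.
have Wrow k : \sum_l W k l = mass kap al k.
  apply: EFin_inj; rewrite -sumEFin; under eq_bigr do rewrite WE.
  rewrite -ge0_integral_sum//; last by move=> l; apply: measurable_funTS; exact: mp.
  rewrite (eq_integral (cst 1%E)).
    rewrite integral_cst// mul1e /mass fineK//.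
    by apply: (bin_fin_num al1).
  move=> x _; under eq_bigr do rewrite -(fineK (pfin x _)).
  by rewrite sumEFin (sum_mass mkap (p1 x)).
have Wcol l : \sum_k W k l = mass kap be l.
  apply: EFin_inj; rewrite -sumEFin; under eq_bigr do rewrite WE.
  rewrite -(ge0_integral_bins mkap)//; last exact: mp.
  by rewrite -pE// /mass fineK//; exact: (bin_fin_num be1).
(* A null row is filled with the identity so that it sums to 1; its cost is multiplied by 0. *)
pose M k l := if mass kap al k == 0 then (k == l)%:R else W k l / mass kap al k.
have W_null k l : mass kap al k = 0 -> W k l = 0.
  move=> k0; apply/eqP; rewrite eq_le W0 andbT -k0 -Wrow (bigD1 l)//= lerDl.
  exact: sumr_ge0.
have mM k l : mass kap al k * M k l = W k l.
  rewrite /M; case: eqP => k0; first by rewrite k0 mul0r W_null.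
  by rewrite mulrC divfK//; exact/eqP.
pose S x := \sum_l fine (p x (bin l)) * z l.
have mS : measurable_fun [set: R] S.
  by apply: measurable_sum => l; exact: measurable_funM.
pose u x := b * (z (kap x) - S x).
have mu : measurable_fun [set: R] u.
  by apply: measurable_funM => //; exact: measurable_funB.
pose Z := \sum_l `|z l|.
have uD x : `|u x| <= `|b| * (Z + Z).
  rewrite normrM ler_wpM2l//; apply: le_trans (ler_normB _ _) _.
  apply: lerD; first exact: comp_bin_le.
  apply: le_trans (ler_norm_sum _ _ _) _; apply: ler_sum => l _.
  by rewrite normrM ger0_norm// ler_piMl.
have pointwise x : ((C (u x))%:E <= (C (3 * b * (x - \int[p x]_y y)))%:E +
    (C (3 * b * err x))%:E + \int[p x]_y (C (3 * b * err y))%:E)%E.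
  have b3 : 3 * b != 0 by rewrite mulf_neq0// gt_eqF.
  apply: (@le_trans _ _ ((C (3 * b * (x - \int[p x]_y y)))%:E +
    (C (3 * b * err x))%:E +
    (C (3 * b * (\int[p x]_y y - \sum_k mass kap (p x) k * z k)))%:E)%E); last first.
    by rewrite leeD2l//; exact: rounded_mean_cost.
  rewrite -!EFinD lee_fin.
  have := cost_split3 CC (b * (x - \int[p x]_y y)) (b * - err x)
    (b * (\int[p x]_y y - \sum_k mass kap (p x) k * z k)).
  have -> : b * (x - \int[p x]_y y) + b * - err x +
      b * (\int[p x]_y y - \sum_k mass kap (p x) k * z k) = u x.
    by rewrite /u /err /S /mass; ring.
  rewrite !mulrA mulrN (cost_even CC).
  have := C_ge0 (3 * b * (x - \int[p x]_y y)).
  have := C_ge0 (3 * b * err x).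
  have := C_ge0 (3 * b * (\int[p x]_y y - \sum_k mass kap (p x) k * z k)).
  lra.
exists M; split.
- move=> k l; rewrite /M; case: ifP => _; first by rewrite ler0n.
  by rewrite divr_ge0// mass_ge0.
- move=> k; rewrite /M; case: eqP => k0.
    by rewrite (bigD1 k)//= eqxx big1 ?addr0// => l /negbTE; rewrite eq_sym => ->.
  by rewrite -mulr_suml Wrow divff//; exact/eqP.
- by move=> l; under eq_bigr do rewrite mM; exact: Wcol.
rewrite -lee_fin -sumEFin.
apply: (@le_trans _ _ (\sum_k \int[al]_(x in bin k) (C (u x))%:E)%E).
  apply: lee_sum => k _.
  apply: (@cost_conditional_jensen _ _ _ CC al _ u _ _ (mkap k) mu uD).
  rewrite /u.
  have iS : al.-integrable (bin k) (EFin \o S).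
    apply: (integrableS measurableT (mkap k) (@subsetT _ _)).
    apply: (bounded_integrable al (M := Z) mS) => x.
    apply: le_trans (ler_norm_sum _ _ _) _; apply: ler_sum => l _.
    by rewrite normrM ger0_norm// ler_piMl.
  have ic (c : R) : al.-integrable (bin k) (EFin \o cst c).
    exact: finite_measure_integrable_cst.
  have izS : al.-integrable (bin k) (EFin \o (fun x => z k - S x)).
    exact: (integrableB (mkap k) (ic (z k)) iS).
  have -> : \int[al]_(x in bin k) (b * (z (kap x) - S x)) =
      \int[al]_(x in bin k) (b * (z k - S x)).
    by apply: eq_Rintegral => x; rewrite inE /= => ->.
  rewrite (RintegralZl _ (mkap k) izS) (RintegralB (mkap k) (ic (z k)) iS).
  rewrite Rintegral_cst//.
  have -> : \int[al]_(x in bin k) S x = \sum_l W k l * z l.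
    apply: EFin_inj; rewrite /Rintegral fineK; last exact: (integrable_fin_num (mkap k)).
    under eq_integral do rewrite -sumEFin.
    rewrite integral_sum//; last first.
      move=> l; apply: (integrableS measurableT (mkap k) (@subsetT _ _)).
      apply: (bounded_integrable al (M := `|z l|)).
        exact: measurable_funM.
      by move=> x; rewrite normrM ger0_norm// ler_piMl.
    rewrite -sumEFin; apply: eq_bigr => l _.
    under eq_integral do rewrite EFinM.
    have ip : al.-integrable (bin k) (fun x => (fine (p x (bin l)))%:E).
      apply: (integrableS measurableT (mkap k) (@subsetT _ _)).
      by apply: (bounded_integrable al (M := 1)) => // x; rewrite ger0_norm.
    rewrite integralZr// EFinM; congr (_ * _)%E.
    by rewrite WE; apply: eq_integral => x _; rewrite fineK.
  have -> : \sum_l W k l * z l = mass kap al k * \sum_l M k l * z l.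
    by rewrite mulr_sumr; apply: eq_bigr => l _; rewrite mulrA mM.
  change (b * (z k * mass kap al k - mass kap al k * \sum_l M k l * z l) =
    mass kap al k * (b * (z k - \sum_l M k l * z l))).
  by ring.
rewrite -(ge0_integral_bins mkap); last 2 first.
- by move=> x; rewrite lee_fin.
- exact: (measurable_EFin_cost CC).
have mT : measurable_fun [set: R] (fun x => 3 * b * (x - \int[p x]_y y)).
  apply: measurable_funM => //; apply: measurable_funB => //.
  exact: measurable_Rintegral_kernel.
have me : measurable_fun [set: R] (fun x => 3 * b * err x).
  exact: measurable_funM.
have mi : measurable_fun [set: R] (fun x => \int[p x]_y (C (3 * b * err y))%:E)%E.
  apply: measurable_fun_integral_kernel => //; first by move=> y; rewrite lee_fin.
  exact: (measurable_EFin_cost CC).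
have m1 : measurable_fun [set: R] (fun x => (C (3 * b * (x - \int[p x]_y y)))%:E).
  exact: (measurable_EFin_cost CC).
have m2 : measurable_fun [set: R] (fun x => (C (3 * b * err x))%:E).
  exact: (measurable_EFin_cost CC).
apply: le_trans (ge0_le_integral al measurableT _ _ _ (fun x _ => pointwise x)) _.
- by move=> x _; rewrite lee_fin.
- exact: (measurable_EFin_cost CC).
- by apply: emeasurable_funD => //; exact: emeasurable_funD.
have i0 x : (0 <= \int[p x]_y (C (3 * b * err y))%:E)%E.
  by apply: integral_ge0 => y _; rewrite lee_fin.
rewrite ge0_integralD//; last 2 first.
- by move=> x _; rewrite adde_ge0// lee_fin.
- exact: emeasurable_funD.
rewrite ge0_integralD//; last 2 first.
- by move=> x _; rewrite lee_fin.
- by move=> x _; rewrite lee_fin.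
rewrite !EFinD; apply: leeD; first exact: leeD.
apply: le_trans hb; rewrite (ge0_integral_mixture mp p1 pE)//.
by move=> y; rewrite lee_fin.
Qed.

(** The two [e] are the rounding of the points and that of the mean. The factor [q] is exploited
    only in the centered term, which will be bounded by a multiple of [q ^+ 2]. *)
Lemma binned_centered_cost (mu : probability R R) (b q v e : R) : 0 < b ->
  0 <= q <= 1 ->
  (\int[mu]_x (C (3 * b * q * (x - \int[mu]_y y)))%:E <= v%:E)%E ->
  (\int[mu]_x (C (3 * b * err x))%:E <= e%:E)%E ->
  \sum_k mass kap mu k * C (b * q * (z k - \sum_l mass kap mu l * z l)) <=
    v + 2 * e.
Proof.
move=> b0 q01 hv he; have mu1 : mu [set: R] = 1%E by exact: probability_setT.
set m := \int[mu]_y y in hv *; set mh := \sum_l mass kap mu l * z l.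
have mh_e : C (3 * b * (m - mh)) <= e.
  rewrite -lee_fin; apply: le_trans he.
  by apply: (rounded_mean_cost mu1); rewrite mulf_neq0// gt_eqF.
have mc : measurable_fun [set: R] (fun x => 3 * b * q * (x - m)).
  by apply: measurable_funM => //; exact: measurable_funB.
have me : measurable_fun [set: R] (fun x => 3 * b * err x).
  exact: measurable_funM.
have m1 := measurable_EFin_cost CC mc.
have m2 := measurable_EFin_cost CC me.
have e0 : 0 <= e by apply: le_trans mh_e.
rewrite -lee_fin -(integral_comp_bin mkap mu1 (fun k => C (b * q * (z k - mh)))).
apply: (@le_trans _ _ (\int[mu]_x ((C (3 * b * q * (x - m)))%:E +
    (C (3 * b * err x))%:E + e%:E))%E).
  apply: ge0_le_integral => //.
  - by move=> x _; rewrite lee_fin.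
  - apply: (measurable_EFin_cost CC); apply: measurable_funM => //.
    exact: measurable_funB.
  - by apply: emeasurable_funD => //; exact: emeasurable_funD.
  move=> x _; rewrite -!EFinD lee_fin.
  have := cost_split3 CC (b * q * (x - m)) (b * q * - err x) (b * q * (m - mh)).
  have -> : b * q * (x - m) + b * q * - err x + b * q * (m - mh) =
      b * q * (z (kap x) - mh) by rewrite /err; ring.
  have -> : 3 * (b * q * (x - m)) = 3 * b * q * (x - m) by ring.
  have -> : 3 * (b * q * - err x) = - (q * (3 * b * err x)) by ring.
  have -> : 3 * (b * q * (m - mh)) = q * (3 * b * (m - mh)) by ring.
  rewrite (cost_even CC).
  have := cost_shrink_abs (3 * b * err x) q01.
  have := cost_shrink_abs (3 * b * (m - mh)) q01.
  have := C_ge0 (3 * b * q * (x - m)); have := C_ge0 (3 * b * err x).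
  have := C_ge0 (3 * b * (m - mh)); lra.
rewrite ge0_integralD//; last 2 first.
- by move=> x _; rewrite adde_ge0// lee_fin.
- exact: emeasurable_funD.
rewrite ge0_integralD//; last 2 first.
- by move=> x _; rewrite lee_fin.
- by move=> x _; rewrite lee_fin.
have -> : v + 2 * e = v + e + e by ring.
rewrite probability_integral_cst !EFinD.
by apply: leeD => //; exact: leeD.
Qed.

End binned_costs.

(** * Gluing couplings along a finite mixture *)

Section entropy_function.
Context (R : realType).
Implicit Types h : R.

Lemma xlnx_ge h : 0 <= h -> h - 1 <= h * ln h.
Proof.
move=> h0; have [->|hn0] := eqVneq h 0; first by rewrite mul0r; lra.
have hp : 0 < h by rewrite lt_neqAle eq_sym hn0.
have hV : 0 < h^-1 by rewrite invr_gt0.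
have : ln h^-1 <= h^-1 - 1.
  have e : 1 + (h^-1 - 1) = h^-1 by ring.
  by rewrite -[X in ln X]e; apply: le_ln1Dx; lra.
rewrite lnV// => hl.
have : h * (- ln h) <= h * (h^-1 - 1) by rewrite ler_pM2l.
by rewrite mulrBr mulfV// mulrN mulr1; lra.
Qed.

(** This is [xlnx_ge] at [s = sqrt h], multiplied by [2 * s]: entropy dominates the squared
    Hellinger distance. *)
Lemma xlnx_ge_sqrt h : 0 <= h -> (1 - Num.sqrt h) ^+ 2 <= h * ln h - h + 1.
Proof.
move=> h0; have [->|hn0] := eqVneq h 0; first by rewrite sqrtr0 mul0r; lra.
have hp : 0 < h by rewrite lt_neqAle eq_sym hn0.
set s := Num.sqrt h; have s0 : 0 < s by rewrite sqrtr_gt0.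
have hs : h = s * s by rewrite -expr2 sqr_sqrtr.
have := xlnx_ge (ltW s0) => hl.
have : s * (s - 1) <= s * (s * ln s) by rewrite ler_pM2l.
rewrite hs lnM ?posrE//; rewrite expr2; nra.
Qed.

(** For [s = sqrt h <= 1], [1 - h] is [(1 - s) * (1 + s)] with second factor at most 2. Here
    [1 - min 1 h] is the jump probability when the mixture is the source. *)
Lemma marton_source h : 0 <= h ->
  (1 - Num.min 1 h) ^+ 2 <= 4 * (h * ln h - h + 1).
Proof.
move=> h0; have := xlnx_ge_sqrt h0; set s := Num.sqrt h => hl.
have s0 : 0 <= s by exact: sqrtr_ge0.
have hs : h = s * s by rewrite -expr2 sqr_sqrtr.
case: (leP 1 h) => h1.
  by rewrite subrr expr0n/=; have := sqr_ge0 (1 - s); lra.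
have s1 : s <= 1 by rewrite -sqrtr1 ler_wsqrtr// ltW.
apply: (@le_trans _ _ (4 * (1 - s) ^+ 2)); last by rewrite ler_pM2l.
have -> : (1 - h) ^+ 2 = (1 - s) ^+ 2 * (1 + s) ^+ 2 by rewrite hs; ring.
rewrite mulrC ler_wpM2r ?sqr_ge0// expr2; nra.
Qed.

(** The counterpart with the tilted law as source: a component then has relative weight [h] and is
    left with probability [(h - min h 1) / h]. For [s = sqrt h >= 1] the factor [(1 + s) / s] is at
    most 2. *)
Lemma marton_target h : 0 < h ->
  h * ((h - Num.min h 1) / h) ^+ 2 <= 4 * (h * ln h - h + 1).
Proof.
move=> h0; have := xlnx_ge_sqrt (ltW h0); set s := Num.sqrt h => hl.
have s0 : 0 < s by rewrite sqrtr_gt0.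
have hs : h = s * s by rewrite -expr2 sqr_sqrtr// ltW.
case: (leP h 1) => h1.
  by rewrite subrr mul0r expr0n/= mulr0; have := sqr_ge0 (1 - s); lra.
have s1 : 1 <= s by rewrite -sqrtr1 ler_wsqrtr// ltW.
apply: (@le_trans _ _ (4 * (1 - s) ^+ 2)); last by rewrite ler_pM2l.
have -> : h * ((h - 1) / h) ^+ 2 = (1 - s) ^+ 2 * ((1 + s) / s) ^+ 2.
  by rewrite hs; field; rewrite gt_eqF.
rewrite mulrC ler_wpM2r ?sqr_ge0//.
have -> : 4 = 2 ^+ 2 :> R by rewrite expr2; lra.
rewrite ler_sqr ?nnegrE ?divr_ge0 ?addr_ge0 ?(ltW s0)//.
by rewrite ler_pdivrMr//; lra.
Qed.

End entropy_function.

Section finite_mixture.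
Context (R : realType) (C : R -> R) (t0 : R) (CC : even_convex_cost C t0).
Let C_ge0 := cost_ge0 CC.
Context (J K : finType) (A B : J -> R) (al be : J -> K -> R)
  (M : J -> K -> K -> R) (z : K -> R) (m : J -> R).
Context (A0 : forall j, 0 <= A j) (B0 : forall j, 0 <= B j)
  (A1 : \sum_j A j = 1) (B1 : \sum_j B j = 1)
  (al0 : forall j k, 0 <= al j k) (be0 : forall j k, 0 <= be j k)
  (al1 : forall j, \sum_k al j k = 1) (be1 : forall j, \sum_k be j k = 1)
  (M0 : forall j k l, 0 <= M j k l) (M1 : forall j k, \sum_l M j k l = 1)
  (Mbe : forall j l, \sum_k al j k * M j k l = be j l).

Let src k := \sum_j A j * al j k.
Let tgt l := \sum_j B j * be j l.
Let s j := Num.min (A j) (B j).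
Let q j := (A j - s j) / A j.

(* Component [j] of the source keeps the mass [min (A j) (B j)] and moves it by
   its own coupling [M j]; the rest of the source is coupled independently with
   the rest of the target. *)
Lemma finite_mixture_coupling (b tau delta : R) (X Y W : J -> R) :
  0 <= delta ->
  (forall j, \sum_k al j k * C (4 * b * (z k - \sum_l M j k l * z l)) <= X j) ->
  (forall j r, 0 <= r <= 1 ->
    \sum_k al j k * C (4 * b * r * (z k - m j)) <= tau * r ^+ 2 + Y j) ->
  (forall i j r, 0 <= r <= 1 ->
    C (4 * b * r * (m j - m i)) <= tau * r ^+ 2 + r * delta) ->
  (forall i, C (4 * b * (m i - \sum_l be i l * z l)) <= W i) ->
  exists P : K -> K -> R, [/\ forall k l, 0 <= P k l,
    forall k, \sum_l P k l = 1,
    forall l, \sum_k src k * P k l = tgt l,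
    forall k l, tgt l = 0 -> P k l = 0 &
    \sum_k src k * C (b * (z k - \sum_l P k l * z l)) <=
    (\sum_j s j * X j + \sum_j A j * Y j + 2 * tau * \sum_j A j * q j ^+ 2 +
     delta + \sum_j B j * W j) / 4].
Proof.
move=> delta0 hX hY hd hW.
have s0 j : 0 <= s j by rewrite le_min A0 B0.
have sA j : s j <= A j by rewrite ge_min lexx.
have sB j : s j <= B j by rewrite ge_min lexx orbT.
have Aq j : A j * q j = A j - s j.
  rewrite /q; have [Aj|Aj] := eqVneq (A j) 0; last by rewrite mulrC divfK.
  by have := sA j; have := s0 j; rewrite Aj mul0r => a1 a2; lra.
have q01 j : 0 <= q j <= 1.
  rewrite /q; have [Aj|Aj] := eqVneq (A j) 0.
    by rewrite Aj invr0 mulr0 lexx ler01.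
  have Ap : 0 < A j by rewrite lt_neqAle eq_sym Aj A0.
  rewrite divr_ge0 ?subr_ge0//= ler_pdivrMr// mul1r; have := s0 j; lra.
have q0 j : 0 <= q j by case/andP: (q01 j).
have q1 j : q j <= 1 by case/andP: (q01 j).
have As0 j : 0 <= A j - s j by rewrite subr_ge0.
have Bs0 j : 0 <= B j - s j by rewrite subr_ge0.
pose V := \sum_j (B j - s j).
have VA : \sum_j (A j - s j) = V by rewrite /V !sumrB A1 B1.
have V0 : 0 <= V by apply: sumr_ge0 => j _; rewrite subr_ge0.
have V1 : V <= 1 by rewrite /V sumrB B1 gerBl sumr_ge0.
(* Law of the component joined after a jump. If [V] is 0 nothing jumps: [n] is 0 by the convention
   on division, and so is every [q j], whence [qn] in both cases. *)
pose n i := (B i - s i) / V.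
have n0 i : 0 <= n i by rewrite divr_ge0// subr_ge0.
have Vn i : V * n i = B i - s i.
  rewrite /n; have [Vz|Vz] := eqVneq V 0; last by rewrite mulrC divfK.
  rewrite Vz mul0r; apply/esym; have /eqP := Vz; rewrite psumr_eq0//.
  by move=> /allP/(_ i (mem_index_enum i))/= /eqP.
have sumn : V != 0 -> \sum_i n i = 1 by move=> Vz; rewrite -mulr_suml divff.
have qV j : V = 0 -> q j = 0.
  move=> Vz; have /eqP := VA; rewrite Vz psumr_eq0//.
  by move=> /allP/(_ j (mem_index_enum j))/= /eqP; rewrite /q => ->; rewrite mul0r.
have qn j : q j * \sum_i n i = q j.
  have [Vz|Vz] := eqVneq V 0; first by rewrite (qV j Vz) mul0r.
  by rewrite sumn// mulr1.
pose N l := \sum_i n i * be i l.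
have N0 l : 0 <= N l by apply: sumr_ge0 => i _; exact: mulr_ge0.
have sumN : \sum_l N l = \sum_i n i.
  rewrite exchange_big/=; apply: eq_bigr => i _.
  by rewrite -mulr_sumr be1 mulr1.
pose L j k l := (1 - q j) * M j k l + q j * N l.
have L0 j k l : 0 <= L j k l.
  by apply: addr_ge0; apply: mulr_ge0 => //; rewrite subr_ge0.
have L1 j k : \sum_l L j k l = 1.
  by rewrite big_split/= -!mulr_sumr M1 mulr1 sumN qn subrK.
pose Q k l := \sum_j A j * al j k * L j k l.
have Q0 k l : 0 <= Q k l by apply: sumr_ge0 => j _; rewrite !mulr_ge0.
have Qrow k : \sum_l Q k l = src k.
  rewrite exchange_big/=; apply: eq_bigr => j _.
  by rewrite -mulr_sumr L1 mulr1.
have Qcol l : \sum_k Q k l = tgt l.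
  rewrite exchange_big/=.
  have -> : tgt l = \sum_j (s j * be j l) + V * N l.
    rewrite /N mulr_sumr -big_split/=; apply: eq_bigr => j _.
    by rewrite mulrA Vn -mulrDl addrC subrK.
  have -> : V * N l = \sum_j (A j * q j) * N l.
    by rewrite -mulr_suml -VA; congr (_ * _); apply: eq_bigr => j _; rewrite Aq.
  rewrite -big_split/=; apply: eq_bigr => j _.
  have -> : s j = A j * (1 - q j) by rewrite mulrBr mulr1 Aq; ring.
  rewrite -Mbe mulr_sumr.
  have -> : A j * q j * N l = \sum_k A j * q j * al j k * N l.
    by rewrite -mulr_suml -mulr_sumr al1 mulr1.
  by rewrite -big_split/=; apply: eq_bigr => k _; rewrite /L; ring.
have src0 k : 0 <= src k by apply: sumr_ge0 => j _; exact: mulr_ge0.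
have tgt0 l : 0 <= tgt l by apply: sumr_ge0 => j _; exact: mulr_ge0.
have src1 : \sum_k src k = 1.
  by rewrite exchange_big/= -A1; apply: eq_bigr => j _; rewrite -mulr_sumr al1 mulr1.
have tgt1 : \sum_k tgt k = 1.
  by rewrite exchange_big/= -B1; apply: eq_bigr => j _; rewrite -mulr_sumr be1 mulr1.
(* A null row is filled with [tgt] rather than with the identity, so that [P k l] vanishes wherever
   [tgt l] does: the continuous coupling will have a density obtained by dividing by [tgt l]. *)
pose P k l := if src k == 0 then tgt l else Q k l / src k.
have Qnull k l : src k = 0 -> Q k l = 0.
  move=> k0; apply/eqP; rewrite eq_le Q0 andbT -k0 -Qrow (bigD1 l)//= lerDl.
  exact: sumr_ge0.
have srcP k l : src k * P k l = Q k l.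
  rewrite /P; case: eqP => k0; first by rewrite k0 mul0r Qnull.
  by rewrite mulrC divfK//; exact/eqP.
exists P; split.
- by move=> k l; rewrite /P; case: ifP => // _; exact: divr_ge0.
- move=> k; rewrite /P; case: eqP => k0 //.
  by rewrite -mulr_suml Qrow divff//; exact/eqP.
- by move=> l; under eq_bigr do rewrite srcP; exact: Qcol.
- move=> k l tl; rewrite /P; case: eqP => // k0.
  suff -> : Q k l = 0 by rewrite mul0r.
  apply/eqP; rewrite eq_le Q0 andbT -tl -Qcol (bigD1 k)//= lerDl.
  exact: sumr_ge0.
(* Given the bin [k], [P] averages the kernels [L j] with the conditional probabilities of the
   components; averaging barycenters lowers the cost. *)
have step1 k : src k * C (b * (z k - \sum_l P k l * z l)) <=
    \sum_j A j * al j k * C (b * (z k - \sum_l L j k l * z l)).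
  have [k0|k0] := eqVneq (src k) 0.
    by rewrite k0 mul0r sumr_ge0// => j _; rewrite !mulr_ge0.
  have kp : 0 < src k by rewrite lt_neqAle eq_sym k0 src0.
  pose w j := A j * al j k / src k.
  have w0 j : 0 <= w j by rewrite divr_ge0// mulr_ge0.
  have w1 : \sum_j w j = 1 by rewrite -mulr_suml divff.
  have -> : b * (z k - \sum_l P k l * z l) =
      \sum_j w j * (b * (z k - \sum_l L j k l * z l)).
    under [RHS]eq_bigr do rewrite mulrCA mulrBr.
    rewrite -mulr_sumr sumrB -mulr_suml w1 mul1r; congr (_ * (_ - _)).
    under [RHS]eq_bigr do rewrite mulr_sumr.
    rewrite exchange_big/=; apply: eq_bigr => l _.
    rewrite /P (negbTE k0) /Q !mulr_suml; apply: eq_bigr => j _.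
    by rewrite /w; ring.
  rewrite -ler_pdivlMl//; apply: le_trans (cost_jensen_sum CC _ w0 w1) _.
  rewrite mulr_sumr; apply: ler_sum => j _.
  by rewrite /w [_ / src k]mulrC -!mulrA.
apply: le_trans (ler_sum _ (fun k _ => step1 k)) _.
rewrite exchange_big/=.
pose bt i := \sum_l be i l * z l.
(* Four displacements: by the own coupling, from [z k] to the reference point [m j], from [m j] to
   the point [m i] of the component joined, and from [m i] to the actual barycenter of [be i]. *)
have step2 j k : C (b * (z k - \sum_l L j k l * z l)) <=
    ((1 - q j) * C (4 * b * (z k - \sum_l M j k l * z l)) +
     C (4 * b * q j * (z k - m j)) + (tau * q j ^+ 2 + q j * delta) +
     q j * \sum_i n i * W i) / 4.
  set T := \sum_l M j k l * z l.
  have -> : \sum_l L j k l * z l = (1 - q j) * T + q j * \sum_i n i * bt i.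
    have Nz : \sum_i n i * bt i = \sum_l N l * z l.
      under [RHS]eq_bigr do rewrite /N mulr_suml.
      rewrite exchange_big/=; apply: eq_bigr => i _.
      by rewrite /bt mulr_sumr; apply: eq_bigr => l _; rewrite mulrA.
    rewrite Nz /T !mulr_sumr -big_split/=; apply: eq_bigr => l _.
    by rewrite /L; ring.
  have -> : b * (z k - ((1 - q j) * T + q j * \sum_i n i * bt i)) =
      (1 - q j) * (b * (z k - T)) + b * q j * (z k - m j) +
      b * q j * \sum_i n i * (m j - m i) +
      q j * (b * \sum_i n i * (m i - bt i)).
    have e1 : \sum_i n i * (m j - m i) = (\sum_i n i) * m j - \sum_i n i * m i.
      by rewrite mulr_suml -sumrB; apply: eq_bigr => i _; rewrite mulrBr.
    have e2 : \sum_i n i * (m i - bt i) = \sum_i n i * m i - \sum_i n i * bt i.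
      by rewrite -sumrB; apply: eq_bigr => i _; rewrite mulrBr.
    rewrite e1 e2; apply/eqP; rewrite -subr_eq0; apply/eqP.
    transitivity (b * m j * (q j - q j * \sum_i n i)); first by ring.
    by rewrite qn subrr mulr0.
  apply: le_trans (cost_split4 CC _ _ _ _) _.
  rewrite ler_pM2r ?invr_gt0//; apply: lerD; first apply: lerD; first apply: lerD.
  - have -> : 4 * ((1 - q j) * (b * (z k - T))) = (1 - q j) * (4 * b * (z k - T)) by ring.
    by apply: (cost_scale CC); have := q01 j; move=> /andP[a1 a2]; apply/andP; split; lra.
  - by rewrite !mulrA.
  - have [Vz|Vz] := eqVneq V 0.
      by rewrite (qV j Vz) mulr0 !mul0r mulr0 (cost0 CC) expr0n/= mulr0 addr0.
    have -> : 4 * (b * q j * \sum_i n i * (m j - m i)) =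
        \sum_i n i * (4 * b * q j * (m j - m i)).
      by rewrite !mulr_sumr; apply: eq_bigr => i _; ring.
    apply: le_trans (cost_jensen_sum CC _ n0 (sumn Vz)) _.
    have -> : tau * q j ^+ 2 + q j * delta =
        \sum_i n i * (tau * q j ^+ 2 + q j * delta).
      by rewrite -mulr_suml (sumn Vz) mul1r.
    apply: ler_sum => i _.
    by apply: ler_wpM2l => //; exact: (hd _ _ _ (q01 j)).
  - have [Vz|Vz] := eqVneq V 0.
      by rewrite (qV j Vz) !mul0r mulr0 (cost0 CC).
    have -> : 4 * (q j * (b * \sum_i n i * (m i - bt i))) =
        q j * \sum_i n i * (4 * b * (m i - bt i)).
      by rewrite !mulr_sumr; apply: eq_bigr => i _; ring.
    apply: le_trans (cost_scale CC _ (q01 j)) _; apply: ler_wpM2l => //.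
    apply: le_trans (cost_jensen_sum CC _ n0 (sumn Vz)) _.
    by apply: ler_sum => i _; apply: ler_wpM2l => //; exact: hW.
set nW := \sum_i n i * W i in step2.
(* [2 * tau] collects the terms in [q j ^+ 2] of the second and third displacements. *)
have step3 j : \sum_k A j * al j k * C (b * (z k - \sum_l L j k l * z l)) <=
    (s j * X j + A j * Y j + 2 * tau * (A j * q j ^+ 2) +
     (A j - s j) * delta + (A j - s j) * nW) / 4.
  pose D := (tau * q j ^+ 2 + q j * delta) + q j * nW.
  apply: (@le_trans _ _ (\sum_k (A j / 4 * ((1 - q j) *
      (al j k * C (4 * b * (z k - \sum_l M j k l * z l))) +
      al j k * C (4 * b * q j * (z k - m j)) + al j k * D)))).
    apply: ler_sum => k _.
    apply: le_trans (ler_wpM2l _ (step2 j k)) _; first exact: mulr_ge0.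
    by rewrite le_eqVlt; apply/orP; left; apply/eqP; rewrite /D; field.
  rewrite -mulr_sumr !big_split/= -mulr_sumr -mulr_suml al1 mul1r.
  have Asj : A j * (1 - q j) = s j by rewrite mulrBr mulr1 Aq; ring.
  have h1 := hX j; have h2 := hY j _ (q01 j).
  have h3 : A j / 4 * ((1 - q j) * \sum_k al j k * C (4 * b * (z k - \sum_l M j k l * z l))) <=
      s j * X j / 4.
    rewrite -Asj; set x := \sum_k _ in h1 *.
    have -> : A j / 4 * ((1 - q j) * x) = (A j * (1 - q j) * x) / 4 by field.
    by rewrite Asj ler_pM2r ?invr_gt0// ler_wpM2l.
  have h4 : A j / 4 * \sum_k al j k * C (4 * b * q j * (z k - m j)) <=
      A j / 4 * (tau * q j ^+ 2 + Y j).
    by apply: ler_wpM2l => //; rewrite divr_ge0.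
  rewrite !mulrDr; apply: le_trans (lerD (lerD h3 h4) (lexx _)) _.
  by rewrite le_eqVlt; apply/orP; left; apply/eqP; rewrite /D -Aq; field.
apply: le_trans (ler_sum _ (fun j _ => step3 j)) _.
rewrite -mulr_suml ler_pM2r ?invr_gt0// !big_split/= -mulr_sumr.
rewrite -!mulr_suml VA; apply: lerD; first apply: lerD => //.
  by rewrite ler_piMl.
rewrite /nW mulr_sumr; apply: ler_sum => i _.
rewrite mulrA Vn ler_wpM2r//; last by rewrite gerBl.
by apply: le_trans (hW i).
Qed.

End finite_mixture.

(** * From discrete to continuous couplings *)

Section kernel_packing.
Context (R : realType) (f : R -> {measure set R -> \bar R}).
Context (mf : forall U, measurable U -> measurable_fun [set: R] (f ^~ U)).
Context (f1 : forall x, f x [set: R] = 1%E).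

Local Definition packed_kernel
  (_ : forall U, measurable U -> measurable_fun [set: R] (f ^~ U))
  (_ : forall x, f x [set: R] = 1%E) : R -> {measure set R -> \bar R} := f.

HB.instance Definition _ := isKernel.Build _ _ R R R (packed_kernel mf f1) mf.

HB.instance Definition _ :=
  Kernel_isProbability.Build _ _ R R R (packed_kernel mf f1) f1.

Lemma exists_probability_kernel :
  exists p : R.-pker R ~> R, forall x, p x = f x.
Proof. by exists (packed_kernel mf f1). Qed.

End kernel_packing.

Section transfer.
Context (R : realType) (C : R -> R) (t0 : R) (CC : even_convex_cost C t0).
Context (K : finType) (kap : R -> K).
Context (mkap : forall k, measurable (kap @^-1` [set k])) (z : K -> R).
Context (src tgt : probability R R) (P : K -> K -> R).
Context (P0 : forall k l, 0 <= P k l) (P1 : forall k, \sum_l P k l = 1)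
  (Ptgt : forall l, \sum_k mass kap src k * P k l = mass kap tgt l)
  (Pnull : forall k l, mass kap tgt l = 0 -> P k l = 0).
Local Notation bin k := (kap @^-1` [set k]).
Let C_ge0 := cost_ge0 CC.

Let src1 : src [set: R] = 1%E. Proof. exact: probability_setT. Qed.
Let tgt1 : tgt [set: R] = 1%E. Proof. exact: probability_setT. Qed.

Let D k l : R := P k l / mass kap tgt l.

Let D0 k l : 0 <= D k l.
Proof. by rewrite divr_ge0// mass_ge0. Qed.

Let massD k l : mass kap tgt l * D k l = P k l.
Proof.
rewrite /D; have [l0|l0] := eqVneq (mass kap tgt l) 0.
  by rewrite Pnull// l0 mul0r.
by rewrite mulrC divfK.
Qed.

Let mD k : measurable_fun [set: R] (fun y => D k (kap y)).
Proof. exact: measurable_comp_bin. Qed.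

Let D1 k : (\int[tgt]_y (D k (kap y))%:E = 1)%E.
Proof.
rewrite (integral_comp_bin mkap tgt1); congr EFin; rewrite -(P1 k).
by apply: eq_bigr => l _; exact: massD.
Qed.

(** From bin [k], a bin [l] is chosen with probability [P k l], then a point in it by [tgt]
    conditioned on [l]. *)
Let kern (x : R) : probability R R :=
  density_measure (fun y => D0 (kap x) (kap y)) (mD (kap x)) (D1 (kap x)).

Let kernE x B : measurable B ->
  kern x B = (\sum_l D (kap x) l * fine (tgt (bin l `&` B)))%:E.
Proof.
move=> mB; rewrite /kern /= /density_measure integral_mkcond.
rewrite (ge0_integral_bins mkap).
- rewrite -sumEFin; apply: eq_bigr => l _.
  rewrite -integral_mkcondr (eq_integral (cst (D (kap x) l)%:E)); last first.
    by move=> y; rewrite inE /= => -[->].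
  have mlB : measurable (bin l `&` B) by exact: measurableI.
  rewrite integral_cst// [RHS]EFinM; congr (_ * _)%E; apply/esym/fineK.
  exact: (bin_fin_num tgt1).
- by move=> y; rewrite patchE; case: ifP => // _; rewrite lee_fin.
- apply/(measurable_restrict _ mB measurableT)/measurable_EFinP.
  exact: measurable_funTS.
Qed.

Let mkern U : measurable U ->
  measurable_fun [set: R] (fun x => (kern x : {measure set R -> \bar R}) U).
Proof.
move=> mU.
rewrite (_ : (fun x => _) = (fun x =>
  (\sum_l D (kap x) l * fine (tgt (bin l `&` U)))%:E)); last first.
  by apply/funext => x; exact: kernE.
apply/measurable_EFinP.
exact: (measurable_comp_bin mkap (fun k => \sum_l D k l * fine (tgt (bin l `&` U)))).
Qed.

Let kern1 x : kern x [set: R] = 1%E.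
Proof. exact: probability_setT. Qed.

Let kern_tgt B : measurable B -> (tgt B = \int[src]_x kern x B)%E.
Proof.
move=> mB; under eq_integral do rewrite kernE//.
rewrite (integral_comp_bin mkap src1
  (fun k => \sum_l D k l * fine (tgt (bin l `&` B)))).
under eq_bigr do rewrite mulr_sumr.
rewrite exchange_big/=.
have -> : \sum_l \sum_k mass kap src k * (D k l * fine (tgt (bin l `&` B))) =
    \sum_l fine (tgt (bin l `&` B)).
  apply: eq_bigr => l _.
  have -> : \sum_k mass kap src k * (D k l * fine (tgt (bin l `&` B))) =
      mass kap tgt l / mass kap tgt l * fine (tgt (bin l `&` B)).
    rewrite -mulrA -{1}(Ptgt l) mulr_suml; apply: eq_bigr => k _.
    by rewrite /D !mulrA.
  have [l0|l0] := eqVneq (mass kap tgt l) 0; last by rewrite divff// mul1r.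
  rewrite l0 mul0r mul0r; apply/esym/eqP; rewrite eq_le fine_ge0// andbT -l0.
  apply: fine_le; [apply: (bin_fin_num tgt1)|apply: (bin_fin_num tgt1)|].
  - exact: measurableI.
  - exact: mkap.
  - by apply: le_measure; rewrite ?inE//; exact: measurableI.
have h0 x : (0 <= (\1_B x : R)%:E)%E by rewrite lee_fin.
have hB : measurable_fun [set: R] (fun x => (\1_B x : R)%:E).
  by apply/measurable_EFinP; exact: measurable_indic.
have := ge0_integral_bins mkap tgt h0 hB.
rewrite integral_indic// setIT => ->.
rewrite -sumEFin; apply: eq_bigr => l _; rewrite integral_indic//.
by rewrite fineK 1?setIC//; apply: (bin_fin_num tgt1); exact: measurableI.
Qed.

Let PP : probability (R * R)%type R := (src \x tgt)%E.

Let G (w : R * R) : R := D (kap w.1) (kap w.2).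

Let mG : measurable_fun [set: R * R] G.
Proof.
rewrite (_ : G = fun w => \sum_(k : K) ((\1_(bin k) w.1 : R) * D k (kap w.2))).
  apply: measurable_sum => k; apply: measurable_funM.
    by apply: measurableT_comp => //; exact: measurable_indic.
  exact: (measurableT_comp (mD k)).
apply/funext => w; rewrite /G (comp_binE kap (fun k => D k (kap w.2)) w.1).
by apply: eq_bigr => k _; rewrite mulrC.
Qed.

Let G1 : (\int[PP]_w (G w)%:E = 1)%E.
Proof.
have mGE : measurable_fun setT (fun w => (G w)%:E) by exact/measurable_EFinP.
have GE0 w : (0 <= (G w)%:E)%E by rewrite lee_fin; exact: D0.
rewrite /PP (fubini_tonelli1 _ mGE GE0) /fubini_F/=; under eq_integral do rewrite /G /= D1.
exact: probability_integral_cst.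
Qed.

Let pi : probability (R * R)%type R :=
  density_measure (fun w => D0 (kap w.1) (kap w.2)) mG G1.

Let pi_rect A B : measurable A -> measurable B ->
  (pi (A `*` B) = \int[src]_(x in A) kern x B)%E.
Proof.
move=> mA mB; rewrite /pi/= /density_measure integral_mkcond.
have mAB : measurable (A `*` B) by exact: measurableX.
set F := _ \_ _; have mF : measurable_fun [set: R * R] F.
  apply/(measurable_restrict _ mAB measurableT)/measurable_EFinP.
  exact: measurable_funTS.
have F0 w : (0 <= F w)%E.
  by rewrite /F patchE; case: ifP => // _; rewrite lee_fin; exact: D0.
rewrite /PP (fubini_tonelli1 _ mF F0) [RHS]integral_mkcond; apply: eq_integral => x _.
rewrite /fubini_F patchE; case: ifPn => xA.
  rewrite /kern/= /density_measure [RHS]integral_mkcond.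
  apply: eq_integral => y _; rewrite /F !patchE in_setX/=.
  by rewrite xA.
apply: integral0_eq => y _; rewrite /F patchE in_setX/=.
by rewrite (negbTE xA).
Qed.

(* The coupling has density [P k l / tgt l] on the product of the bins [k] and
   [l], with respect to [src \x tgt]. *)
Lemma weak_transport_cost_le (b es et : R) : 0 < b ->
  (\int[src]_x (C (3 * b * (x - z (kap x))))%:E <= es%:E)%E ->
  (\int[tgt]_x (C (3 * b * (x - z (kap x))))%:E <= et%:E)%E ->
  (weak_transport_cost (fun x => C (b * x)) tgt src <=
    (es + \sum_k mass kap src k * C (3 * b * (z k - \sum_l P k l * z l)) +
     et)%:E)%E.
Proof.
move=> b0 hs ht.
have [p pE] := exists_probability_kernel mkern kern1.
apply: (@le_trans _ _ (\int[src]_x (C (b * (x - \int[p x]_y y)))%:E)%E).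
  apply: ereal_inf_lbound; exists pi, p; split => //.
    split => [A mA|B mB].
      rewrite (_ : fst @^-1` A = A `*` setT); last first.
        by apply/seteqP; split => // x [].
      rewrite pi_rect//; under eq_integral do rewrite kern1.
      by rewrite integral_cst// mul1e.
    rewrite (_ : snd @^-1` B = setT `*` B); last first.
      by apply/seteqP; split => // x [].
    by rewrite pi_rect// -kern_tgt.
  move=> A B mA mB; rewrite pi_rect//; apply: eq_integral => x _.
  by rewrite pE.
under eq_integral do rewrite pE.
pose err x : R := x - z (kap x).
pose S k := \sum_l P k l * z l.
have massk x l : mass kap (kern x) l = P (kap x) l.
  rewrite /mass kernE//= (bigD1 l)//= big1 ?addr0.
    by rewrite setIid mulrC; exact: massD.
  move=> l' ll'; rewrite (_ : bin l' `&` bin l = set0) ?measure0 ?mulr0//.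
  by apply/seteqP; split => // y [/= -> ] /eqP; rewrite (negbTE ll').
have mz : measurable_fun [set: R] (fun x => z (kap x)) by exact: measurable_comp_bin.
have me : measurable_fun [set: R] (fun x => 3 * b * err x).
  by apply: measurable_funM => //; exact: measurable_funB.
have mCe := measurable_EFin_cost CC me.
have mS : measurable_fun [set: R] (fun x => (C (3 * b * (z (kap x) - S (kap x))))%:E).
  apply: (measurable_EFin_cost CC).
  exact: (measurable_comp_bin mkap (fun k => 3 * b * (z k - S k))).
have mi : measurable_fun [set: R] (fun x => \int[kern x]_y (C (3 * b * err y))%:E)%E.
  by apply: measurable_fun_integral_kernel => // y; rewrite lee_fin.
have i0 x : (0 <= \int[kern x]_y (C (3 * b * err y))%:E)%E.
  by apply: integral_ge0 => y _; rewrite lee_fin.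
(* The three displacements of [binned_coupling] in reverse; the inner integrals average to the
   rounding cost of [tgt], the second marginal of [kern]. *)
apply: (@le_trans _ _ (\int[src]_x ((C (3 * b * err x))%:E +
   (C (3 * b * (z (kap x) - S (kap x))))%:E +
   \int[kern x]_y (C (3 * b * err y))%:E))%E).
  apply: ge0_le_integral => //.
  - by move=> x _; rewrite lee_fin.
  - apply: (measurable_EFin_cost CC); apply: measurable_funM => //.
    by apply: measurable_funB => //; exact: measurable_Rintegral_kernel.
  - by apply: emeasurable_funD => //; exact: emeasurable_funD.
  move=> x _; have b3 : 3 * b != 0 by rewrite mulf_neq0// gt_eqF.
  have := rounded_mean_cost CC mkap z (kern1 x) b3.
  under eq_bigr do rewrite massk; rewrite -/(S (kap x)) => hr.
  apply: le_trans (leeD2l _ hr); rewrite -!EFinD lee_fin.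
  have := cost_split3 CC (b * err x) (b * (z (kap x) - S (kap x)))
    (b * - (\int[kern x]_y y - S (kap x))).
  have -> : b * err x + b * (z (kap x) - S (kap x)) +
     b * - (\int[kern x]_y y - S (kap x)) = b * (x - \int[kern x]_y y).
    by rewrite /err; ring.
  rewrite !mulrA mulrN (cost_even CC).
  have := C_ge0 (3 * b * err x).
  have := C_ge0 (3 * b * (z (kap x) - S (kap x))).
  have := C_ge0 (3 * b * (\int[kern x]_y y - S (kap x))).
  lra.
rewrite ge0_integralD//; last 2 first.
- by move=> x _; rewrite adde_ge0// lee_fin.
- exact: emeasurable_funD.
rewrite ge0_integralD//; last 2 first.
- by move=> x _; rewrite lee_fin.
- by move=> x _; rewrite lee_fin.
rewrite (integral_comp_bin mkap src1 (fun k => C (3 * b * (z k - S k)))).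
rewrite !EFinD; apply: leeD; first exact: leeD.
apply: le_trans ht; rewrite (ge0_integral_mixture mkern kern1 kern_tgt)//.
by move=> y; rewrite lee_fin.
Qed.

End transfer.

(** * Tilting one component *)

(** [x * ln x - x] and [expR] are convex conjugates; the proof is [1 + u <= expR u] at
    [u = y - ln x]. It separates a density from the rounding cost that it multiplies. *)
Lemma fenchel_xlnx (R : realType) (x y : R) : 0 <= x ->
  x * y <= x * ln x - x + expR y.
Proof.
move=> x0; have [->|xn0] := eqVneq x 0.
  by rewrite !mul0r subr0 add0r expR_ge0.
have xp : 0 < x by rewrite lt_neqAle eq_sym xn0.
have := expR_ge1Dx (y - ln x); rewrite expRB lnK ?posrE// => h.
have : x * (1 + (y - ln x)) <= x * (expR y / x) by rewrite ler_pM2l.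
by rewrite [x * (_ / _)]mulrC divfK//; lra.
Qed.

(* [bc_nu] is the law [mu] tilted by [phi], with entropy [bc_H], rounding error
   [bc_e] and couplings [bc_M], [bc_N] from and to [mu]. The identities are
   multiplied by the total mass [h] of [phi mu], so that they say nothing about
   a component with [h = 0]. *)
Record binned_component (R : realType) (C : R -> R) (K : finType) (z : K -> R)
    (b delta : R) (kt : K) (phi mu : K -> R) : Type := BinnedComponent {
  bc_nu : K -> R;
  bc_H : R;
  bc_e : R;
  bc_M : K -> K -> R;
  bc_N : K -> K -> R;
  bc_nu_ge0 : forall k, 0 <= bc_nu k;
  bc_nu_sum : \sum_k bc_nu k = 1;
  bc_nuE : forall k, (\sum_l phi l * mu l) * bc_nu k = phi k * mu k;
  bc_H_ge0 : 0 <= bc_H;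
  bc_e_ge0 : 0 <= bc_e;
  bc_HE : (\sum_l phi l * mu l) * bc_H = \sum_k mu k * (phi k * ln (phi k)) -
    (\sum_l phi l * mu l) * ln (\sum_l phi l * mu l);
  bc_eE : (\sum_l phi l * mu l) * bc_e <= (\sum_l phi l * mu l) * delta +
    mu kt * (phi kt * ln (phi kt)) + delta;
  bc_M_ge0 : forall k l, 0 <= bc_M k l;
  bc_M_sum : forall k, \sum_l bc_M k l = 1;
  bc_M_nu : forall l, \sum_k mu k * bc_M k l = bc_nu l;
  bc_M_cost : \sum_k mu k * C (b * (z k - \sum_l bc_M k l * z l)) <=
    (bc_H + delta) / 8 + 2 * delta + bc_e;
  bc_N_ge0 : forall k l, 0 <= bc_N k l;
  bc_N_sum : forall k, \sum_l bc_N k l = 1;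
  bc_N_mu : forall l, \sum_k bc_nu k * bc_N k l = mu l;
  bc_N_cost : \sum_k bc_nu k * C (b * (z k - \sum_l bc_N k l * z l)) <=
    (bc_H + delta) / 8 + 2 * delta + bc_e }.

Section component.
Context (R : realType) (C : R -> R) (t0 : R) (CC : even_convex_cost C t0).
Context (K : finType) (kap : R -> K).
Context (mkap : forall k, measurable (kap @^-1` [set k])) (z : K -> R) (kt : K).
Context (b delta : R) (b0 : 0 < b) (delta0 : 0 < delta).
Context (off_tail : forall x, kap x != kt -> C (3 * b * (x - z (kap x))) <= delta).
Local Notation bin k := (kap @^-1` [set k]).
Let C_ge0 := cost_ge0 CC.
Let cerr (x : R) : R := C (3 * b * (x - z (kap x))).

Let measurable_err : measurable_fun [set: R] (fun x => 3 * b * (x - z (kap x))).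
Proof.
apply: measurable_funM => //; apply: measurable_funB => //.
exact: measurable_comp_bin.
Qed.

Let measurable_cerr : measurable_fun [set: R] cerr.
Proof. exact: (measurableT_comp (measurable_cost CC)). Qed.

Lemma integral_rounding_le (Q : probability R R) :
  (\int[Q]_x (cerr x)%:E <= delta%:E + \int[Q]_(x in bin kt) (cerr x)%:E)%E.
Proof.
have c0 x : (0 <= (cerr x)%:E)%E by rewrite lee_fin; exact: C_ge0.
have mc : measurable_fun [set: R] (fun x => (cerr x)%:E) by exact/measurable_EFinP.
rewrite (ge0_integral_bins mkap Q c0 mc) (bigD1 kt)//= addeC leeD2r//.
have Q1 : Q [set: R] = 1%E by exact: probability_setT.
apply: (@le_trans _ _ (\sum_(k | k != kt) (delta * mass kap Q k)%:E)%E).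
  apply: lee_sum => k kkt.
  apply: (@le_trans _ _ (\int[Q]_(x in bin k) (cst delta%:E) x)%E).
    apply: ge0_le_integral => //.
    - by apply/measurable_EFinP; exact: measurable_funTS.
    - by move=> x /= xk; rewrite lee_fin; apply: off_tail; rewrite xk.
  rewrite integral_cst// EFinM /mass fineK//.
  exact: (bin_fin_num Q1 (mkap k)).
rewrite sumEFin lee_fin -mulr_sumr -[leRHS]mulr1 ler_pM2l// -(sum_mass mkap Q1).
by rewrite [leRHS](bigD1 kt)//= lerDr mass_ge0.
Qed.

Context (mu : probability R R) (a : R) (ab : 24 * b <= a).
Context (mom : finite_first_moment mu).
Context (wti : forall nu, finite_first_moment nu ->
  (weak_transport_cost (fun x => C (a * x)) mu nu <= relative_entropy nu mu /\
   weak_transport_cost (fun x => C (a * x)) nu mu <= relative_entropy nu mu)%E).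
Context (tail : (\int[mu]_(x in bin kt) (expR (cerr x))%:E <= delta%:E)%E).

Let Gt : R := \int[mu]_(x in bin kt) cerr x.

Let iexp : mu.-integrable (bin kt) (EFin \o (fun x => expR (cerr x))).
Proof.
apply/integrableP; split.
  by apply/measurable_EFinP; apply: measurable_funTS; exact: measurableT_comp.
under eq_integral do rewrite /= ger0_norm ?expR_ge0//.
by apply: le_lt_trans tail _; exact: ltry.
Qed.

Let icerr : mu.-integrable (bin kt) (EFin \o cerr).
Proof.
apply: (le_integrable (mkap kt) _ _ iexp).
  by apply/measurable_EFinP; exact: measurable_funTS.
move=> x _ /=; rewrite lee_fin !ger0_norm ?expR_ge0//.
have := expR_ge1Dx (cerr x); move: (C_ge0 (3 * b * (x - z (kap x)))).
  by rewrite /cerr; lra.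
exact: C_ge0.
Qed.

Let GtE : (\int[mu]_(x in bin kt) (cerr x)%:E = Gt%:E)%E.
Proof. by rewrite /Gt /Rintegral fineK//; exact: (integrable_fin_num (mkap kt)). Qed.

Let Gt_ge0 : 0 <= Gt.
Proof. by apply: Rintegral_ge0 => x _; exact: C_ge0. Qed.

(** The tilt is constant on the tail bin, so its rounding cost there is a multiple of [Gt].
    Integrating Fenchel's inequality with this constant trades it for an entropy term and the
    exponential tail. *)
Let Gt_fenchel x : 0 <= x -> x * Gt <= mass kap mu kt * (x * ln x) + delta.
Proof.
move=> x0.
have ic (r : R) : mu.-integrable (bin kt) (EFin \o cst r).
  exact: finite_measure_integrable_cst.
have i1 := integrableZl (mkap kt) x icerr.
have i2 : mu.-integrable (bin kt) (EFin \o (fun y => x * ln x + expR (cerr y))).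
  exact: (integrableD (mkap kt) (ic _) iexp).
rewrite /Gt -(RintegralZl _ (mkap kt) icerr).
apply: (@le_trans _ _ (\int[mu]_(y in bin kt) (x * ln x + expR (cerr y)))).
  apply: le_Rintegral => // y _.
  by have := fenchel_xlnx (cerr y) x0; lra.
rewrite (RintegralD (mkap kt) (ic _) iexp) Rintegral_cst// mulrC lerD2l.
rewrite -lee_fin /Rintegral fineK//; exact: (integrable_fin_num (mkap kt)).
Qed.

Lemma rounding_cost_le : (\int[mu]_x (cerr x)%:E <= (2 * delta)%:E)%E.
Proof.
apply: le_trans (integral_rounding_le _) _.
rewrite GtE -EFinD lee_fin; have := Gt_fenchel ler01.
by rewrite ln1 !mulr0 mul1r; lra.
Qed.

(** Both transport inequalities are applied to a law whose density with respect to [mu] is constant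
    on the bins: its entropy is a finite sum, and [binned_coupling] discretizes the kernels. The
    record lives in [Type], and the [exists] keeps the choice of kernels in [Prop]. *)
Lemma exists_binned_component (phi : K -> R) : (forall k, 0 <= phi k) ->
  exists _ : binned_component C z b delta kt phi (mass kap mu), True.
Proof.
move=> phi0; set h := \sum_l phi l * mass kap mu l.
have mu1 : mu [set: R] = 1%E by exact: probability_setT.
have h0 : 0 <= h by apply: sumr_ge0 => l _; rewrite mulr_ge0// mass_ge0.
have hnull k : h = 0 -> phi k * mass kap mu k = 0.
  move=> hz; apply/eqP; rewrite eq_le mulr_ge0 ?mass_ge0// andbT -hz /h (bigD1 k)//=.
  by rewrite lerDl sumr_ge0// => l _; rewrite mulr_ge0// mass_ge0.
(* With [h = 0] the component is left untilted; its weight in the tilted mixture is 0. *)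
pose g k := if h == 0 then 1 else phi k / h.
have g0 k : 0 <= g k by rewrite /g; case: ifP => // _; exact: divr_ge0.
have hg k : h * g k * mass kap mu k = phi k * mass kap mu k.
  rewrite /g; case: eqP => [hz|/eqP hz]; first by rewrite hnull// hz !mul0r.
  by rewrite mulrCA mulfV// mulr1.
have sumg : \sum_k mass kap mu k * g k = 1.
  rewrite /g; case: eqP => [hz|/eqP hz].
    by under eq_bigr do rewrite mulr1; exact: (sum_mass mkap mu1).
  under eq_bigr do rewrite mulrC mulrAC.
  by rewrite -mulr_suml -/h divff.
have mg : measurable_fun [set: R] (fun x => g (kap x)).
  exact: (measurable_comp_bin mkap g).
have g1 : (\int[mu]_x (g (kap x))%:E = 1)%E.
  by rewrite (integral_comp_bin mkap mu1 g) sumg.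
pose nu : probability R R := density_measure (fun x => g0 (kap x)) mg g1.
have nuE B : measurable B -> (nu B = \int[mu]_(x in B) (g (kap x))%:E)%E by [].
have nu1 : nu [set: R] = 1%E by exact: probability_setT.
have mass_nu k : mass kap nu k = g k * mass kap mu k.
  rewrite /mass nuE// (eq_integral (cst (g k)%:E)); last first.
    by move=> x; rewrite inE /= => ->.
  by rewrite integral_cst// fineM//; exact: (bin_fin_num mu1 (mkap k)).
pose gs := \sum_k g k.
have gle k : g k <= gs by rewrite /gs (bigD1 k)//= lerDl sumr_ge0.
have nu_mom : finite_first_moment nu.
  have mabs : measurable_fun [set: R] (fun x : R => `|x%:E|%E).
    by apply: measurableT_comp => //; exact: EFin_measurable.
  apply/integrableP; split; first exact: EFin_measurable.
  rewrite (ge0_integral_density mg nuE)//.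
  apply: (@le_lt_trans _ _ (\int[mu]_x (gs%:E * `|x%:E|))%E).
    apply: ge0_le_integral => //.
    - by move=> x _; rewrite mule_ge0// lee_fin.
    - by apply: emeasurable_funM => //; exact/measurable_EFinP.
    - exact: measurable_funeM.
    - by move=> x _; rewrite muleC lee_wpmul2r// lee_fin.
  rewrite ge0_integralZl_EFin//; last exact: sumr_ge0.
  by case/integrableP: mom => _ fin; rewrite lte_mul_pinfty// lee_fin sumr_ge0.
pose H := \sum_k mass kap mu k * (g k * ln (g k)).
have HE : relative_entropy nu mu = H%:E.
  rewrite (relative_entropyE (fun x => g0 (kap x)) mg nuE).
  exact: (integral_comp_bin mkap mu1 (fun k => g k * ln (g k))).
have [cost1 cost2] := wti nu_mom; rewrite HE in cost1 cost2.
(* Nonnegativity of the entropy is read off the transport inequality, whose left side is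
   nonnegative. *)
have H0 : 0 <= H.
  rewrite -lee_fin; apply: le_trans cost1.
  apply: le_ereal_inf_tmp => _ [pi [p [_ _ ->]]].
  by apply: integral_ge0 => x _; rewrite lee_fin.
have hH : h * H = \sum_k mass kap mu k * (phi k * ln (phi k)) - h * ln h.
  have [hz|hz] := eqVneq h 0.
    rewrite hz !mul0r subr0 big1// => k _.
    by rewrite mulrA [mass _ _ _ * _]mulrC hnull// mul0r.
  have hp : 0 < h by rewrite lt_neqAle eq_sym hz.
  rewrite -[h in h * ln h]/(\sum_l phi l * mass kap mu l) mulr_suml -sumrB mulr_sumr.
  apply: eq_bigr => k _; rewrite /g (negbTE hz).
  have [->|pz] := eqVneq (phi k) 0; first by rewrite !(mul0r,mulr0) subr0.
  have pp : 0 < phi k by rewrite lt_neqAle eq_sym pz phi0.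
  by rewrite ln_div ?posrE//; field.
pose e := delta + g kt * Gt.
have e0 : 0 <= e by rewrite addr_ge0 ?mulr_ge0// ltW.
have he : h * e <= h * delta + mass kap mu kt * (phi kt * ln (phi kt)) + delta.
  rewrite mulrDr -addrA lerD2l; apply: le_trans (Gt_fenchel (phi0 kt)).
  rewrite mulrA ler_wpM2r// /g; case: eqP => [->|/eqP hz]; first by rewrite mul0r.
  by rewrite mulrCA mulfV// mulr1.
have enu : (\int[nu]_x (cerr x)%:E <= e%:E)%E.
  apply: le_trans (integral_rounding_le _) _; rewrite EFinD leeD2l//.
  pose F := (fun x => (cerr x)%:E) \_ (bin kt).
  have F0 x : (0 <= F x)%E.
    by rewrite /F patchE; case: ifP => // _; rewrite lee_fin; exact: C_ge0.
  have mF : measurable_fun [set: R] F.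
    apply/(measurable_restrict _ (mkap kt) measurableT)/measurable_EFinP.
    exact: measurable_funTS.
  rewrite integral_mkcond (ge0_integral_density mg nuE F0 mF).
  rewrite (eq_integral (fun x => (g kt)%:E * F x)%E); last first.
    move=> x _; rewrite /F !patchE; case: ifPn => [|_]; last by rewrite mul0e mule0.
    by rewrite inE /= => ->; rewrite muleC.
  rewrite ge0_integralZl_EFin//.
  by rewrite -integral_mkcond GtE EFinM.
(* [3 * b] is at most [a / 8], and shrinking the argument by 8 divides the cost by at least 8: this
   is the 8 of [bc_M_cost] and [bc_N_cost]. *)
have scale (Q : probability R R) (T : R -> R) (r : R) : measurable_fun [set: R] T ->
    (\int[Q]_x (C (a * (x - T x)))%:E <= r%:E)%E ->
    (\int[Q]_x (C (3 * b * (x - T x)))%:E <= (r / 8)%:E)%E.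
  move=> mT hr.
  have a0 : 0 < a by apply: lt_le_trans ab; rewrite mulr_gt0.
  have mS (u : R) : measurable_fun [set: R] (fun x => (C (u * (x - T x)))%:E).
    apply: (measurable_EFin_cost CC); apply: measurable_funM => //.
    exact: measurable_funB.
  apply: (@le_trans _ _ (\int[Q]_x ((8^-1)%:E * (C (a * (x - T x)))%:E))%E).
    apply: ge0_le_integral => //.
    - by move=> x _; rewrite lee_fin.
    - exact: measurable_funeM.
    move=> x _; rewrite -EFinM lee_fin.
    apply: (@le_trans _ _ (C (8^-1 * (a * (x - T x))))).
      apply: (cost_mono CC); rewrite mulrA [leLHS]normrM [leRHS]normrM ler_wpM2r//.
      rewrite !ger0_norm ?mulr_ge0 ?invr_ge0 ?(ltW a0) ?(ltW b0)//.
      by rewrite ler_pdivlMl// mulrA -natrM.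
    by apply: (cost_scale CC); apply/andP; split; lra.
  rewrite ge0_integralZl_EFin//; last by move=> x _; rewrite lee_fin.
  by rewrite mulrC EFinM lee_wpmul2l// lee_fin.
have lt_delta : (H%:E < (H + delta)%:E)%E by rewrite lte_fin ltrDl.
have [p [pE pcost]] := weak_transport_kernel (le_lt_trans cost2 lt_delta).
have [p' [pE' pcost']] := weak_transport_kernel (le_lt_trans cost1 lt_delta).
have mker (k : R.-pker R ~> R) U : measurable U -> measurable_fun [set: R] (k ^~ U).
  exact: measurable_kernel.
have ker1 (k : R.-pker R ~> R) x : k x [set: R] = 1%E by exact: prob_kernel.
have mT (k : R.-pker R ~> R) : measurable_fun [set: R] (fun x => \int[k x]_y y).
  by apply: measurable_Rintegral_kernel => //; exact: mker.
have [M [M0 M1 M2 M3]] := binned_coupling CC mkap (mker p) (ker1 p) pE b0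
  (scale _ _ _ (mT p) pcost) rounding_cost_le enu.
have [N [N0 N1 N2 N3]] := binned_coupling CC mkap (mker p') (ker1 p') pE' b0
  (scale _ _ _ (mT p') pcost') enu rounding_cost_le.
suff d : binned_component C z b delta kt phi (mass kap mu) by exists d.
apply: (@BinnedComponent _ _ _ _ _ _ _ _ _ (mass kap nu) H e M N) => //.
- by move=> k; exact: mass_ge0.
- exact: (sum_mass mkap nu1).
- by move=> k; rewrite mass_nu mulrA hg.
- by apply: le_trans N3 _; rewrite addrAC.
Qed.

End component.

(** * Tilting a finite mixture *)

Section binned_mixture.
Context (R : realType) (C : R -> R) (t0 : R) (CC : even_convex_cost C t0).
Let C_ge0 := cost_ge0 CC.
Context (J K : finType) (lam : J -> R) (mu : J -> K -> R) (phi z : K -> R)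
  (b delta tau : R) (kt : K).
Context (d : forall j, binned_component C z b delta kt phi (mu j)).
Context (lam0 : forall j, 0 <= lam j) (lam1 : \sum_j lam j = 1)
  (mu0 : forall j k, 0 <= mu j k) (mu1 : forall j, \sum_k mu j k = 1)
  (phi0 : forall k, 0 <= phi k) (delta0 : 0 < delta) (tau0 : 0 <= tau <= 2^-1).
Let mix k := \sum_j lam j * mu j k.
Context (phi1 : \sum_k phi k * mix k = 1)
  (tail : mix kt * (phi kt * ln (phi kt)) <= delta).
Let mh j := \sum_l mu j l * z l.
Context (centered : forall j r, 0 <= r <= 1 ->
  \sum_k mu j k * C (b * r * (z k - mh j)) <= tau * r ^+ 2 + 4 * delta).
Context (centers : forall i j r, 0 <= r <= 1 ->
  C (b / 2 * r * (mh j - mh i)) <= tau * r ^+ 2 + r * (4 * delta)).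

Let h j := \sum_l phi l * mu j l.
Let S := \sum_k mix k * (phi k * ln (phi k)).
Let L := \sum_j lam j * (h j * ln (h j)).
Let X j := (bc_H (d j) + delta) / 8 + 2 * delta + bc_e (d j).

Let h0 j : 0 <= h j.
Proof. by apply: sumr_ge0 => l _; exact: mulr_ge0. Qed.

Let lamh : \sum_j lam j * h j = 1.
Proof.
rewrite -phi1; under eq_bigr do rewrite mulr_sumr.
rewrite exchange_big/=; apply: eq_bigr => k _.
by rewrite /mix mulr_sumr; apply: eq_bigr => j _; rewrite mulrCA.
Qed.

Let X_ge0 j : 0 <= X j.
Proof.
have := bc_H_ge0 (d j); have := bc_e_ge0 (d j); rewrite /X.
by move: delta0; lra.
Qed.

(** [h] has mean 1, so adding [1 - h j] changes nothing in total and makes every term nonnegative,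
    as Marton's inequalities require. *)
Let LE : L = \sum_j lam j * (h j * ln (h j) - h j + 1).
Proof.
have -> : \sum_j lam j * (h j * ln (h j) - h j + 1) =
    L - \sum_j lam j * h j + \sum_j lam j.
  by rewrite /L -sumrB -big_split/=; apply: eq_bigr => j _; ring.
by rewrite lamh lam1 subrK.
Qed.

Let L_ge0 : 0 <= L.
Proof.
rewrite LE; apply: sumr_ge0 => j _; apply: mulr_ge0 => //.
by have := xlnx_ge (h0 j); lra.
Qed.

(** Chain rule: [S] is the entropy [L] of the tilted component weights plus the mean entropy of the
    tilted components. *)
Let sumH : \sum_j lam j * h j * bc_H (d j) = S - L.
Proof.
rewrite /S /L; under [X in X - _]eq_bigr do rewrite /mix mulr_suml.
rewrite exchange_big/= -sumrB; apply: eq_bigr => j _.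
rewrite -mulrA /h bc_HE mulrBr mulr_sumr; congr (_ - _).
by apply: eq_bigr => k _; ring.
Qed.

Let SL_ge0 : 0 <= S - L.
Proof.
by rewrite -sumH; apply: sumr_ge0 => j _; rewrite mulr_ge0 ?mulr_ge0// bc_H_ge0.
Qed.

(** [17 / 8] is the [1 / 8 + 2] explicit in [X]; the errors [bc_e] add 3, two from the [delta] terms
    of [bc_eE] and one from the entropy of the tail bin. *)
Let sumX : \sum_j lam j * h j * X j <= (S - L) / 8 + (41 / 8) * delta.
Proof.
have he : \sum_j lam j * h j * bc_e (d j) <= 3 * delta.
  apply: (@le_trans _ _ (\sum_j (lam j * h j * delta +
      lam j * mu j kt * (phi kt * ln (phi kt)) + lam j * delta))).
    apply: ler_sum => j _; rewrite -!mulrA -!mulrDr; apply: ler_wpM2l => //.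
    exact: bc_eE.
  rewrite !big_split/= -!mulr_suml lamh lam1 -/(mix kt).
  by move: tail; lra.
have -> : \sum_j lam j * h j * X j = (\sum_j lam j * h j * bc_H (d j)) / 8 +
    (\sum_j lam j * h j) * (17 / 8 * delta) + \sum_j lam j * h j * bc_e (d j).
  rewrite !mulr_suml -!big_split/=; apply: eq_bigr => j _.
  by rewrite /X; field.
by rewrite sumH lamh; move: he; lra.
Qed.

Let sum_tgt l : \sum_j lam j * h j * bc_nu (d j) l = phi l * mix l.
Proof.
rewrite /mix mulr_sumr; apply: eq_bigr => j _.
by rewrite -mulrA /h bc_nuE mulrCA.
Qed.

(** Here the entropy budget closes. Marton's 4 and [tau <= 1 / 2] bound the jumps by [4 * L], of
    which the division by 4 leaves [L]; the component couplings need only a sixteenth of [S - L].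
    The multiples of [delta] add up to [73 / 16], below 5. *)
Let total q2 Xs Ys Ws : q2 <= 4 * L -> Xs <= (S - L) / 8 + (41 / 8) * delta ->
  Ys + Ws <= (S - L) / 8 + (41 / 8) * delta + 4 * delta ->
  (Xs + Ys + 2 * tau * q2 + 4 * delta + Ws) / 4 <= S + 5 * delta.
Proof.
move=> hq hX hYW; case/andP: tau0 => ta tb.
have : 2 * tau * q2 <= 4 * L.
  apply: le_trans (ler_wpM2l _ hq) _; first by rewrite mulr_ge0.
  by rewrite ler_piMl ?mulr_ge0//; lra.
by move: SL_ge0 L_ge0 delta0; lra.
Qed.

Let cost_half (u : R) : C (2^-1 * u) <= C u.
Proof.
apply: (cost_mono CC); rewrite normrM ger0_norm ?invr_ge0//.
by rewrite ler_piMl//; lra.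
Qed.

Let mixed_coupling_q (q : J -> R) : (forall j, lam j * q j ^+ 2 <=
  lam j * (4 * (h j * ln (h j) - h j + 1))) -> \sum_j lam j * q j ^+ 2 <= 4 * L.
Proof.
move=> hq; rewrite LE mulr_sumr; apply: ler_sum => j _.
by rewrite [leRHS]mulrCA; exact: hq.
Qed.

Lemma mixture_to_tilt : exists P : K -> K -> R, [/\ forall k l, 0 <= P k l,
  forall k, \sum_l P k l = 1,
  forall l, \sum_k mix k * P k l = phi l * mix l,
  forall k l, phi l * mix l = 0 -> P k l = 0 &
  \sum_k mix k * C (b / 8 * (z k - \sum_l P k l * z l)) <= S + 5 * delta].
Proof.
have b4 : 4 * (b / 8) = b / 2 by field.
have B0 j : 0 <= lam j * h j by exact: mulr_ge0.
have hX j : \sum_k mu j k * C (4 * (b / 8) * (z k - \sum_l bc_M (d j) k l * z l)) <= X j.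
  rewrite b4; apply: le_trans (bc_M_cost (d j)).
  apply: ler_sum => k _; apply: ler_wpM2l => //.
  by apply: le_trans (cost_half _); rewrite mulrA [2^-1 * b]mulrC.
have hY j r : 0 <= r <= 1 ->
    \sum_k mu j k * C (4 * (b / 8) * r * (z k - mh j)) <= tau * r ^+ 2 + 4 * delta.
  move=> r01; apply: le_trans (centered j r01).
  apply: ler_sum => k _; apply: ler_wpM2l => //.
  apply: le_trans (cost_half _); rewrite b4 le_eqVlt; apply/orP; left; apply/eqP.
  by congr C; field.
have hd i j r : 0 <= r <= 1 ->
    C (4 * (b / 8) * r * (mh j - mh i)) <= tau * r ^+ 2 + r * (4 * delta).
  by move=> r01; rewrite b4; exact: centers.
(* The barycenter of [bc_nu] differs from [mh i] by the mean displacement of [bc_M], so Jensen's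
   inequality reuses the cost of that coupling. *)
have hW i : C (4 * (b / 8) * (mh i - \sum_l bc_nu (d i) l * z l)) <= X i.
  apply: le_trans (hX i).
  apply: le_trans (cost_jensen_sum CC _ (mu0 i) (mu1 i)).
  rewrite le_eqVlt; apply/orP; left; apply/eqP; congr C.
  under [RHS]eq_bigr do rewrite mulrCA mulrBr.
  rewrite -mulr_sumr sumrB; congr (_ * (_ - _)).
  under eq_bigr do rewrite -bc_M_nu mulr_suml.
  rewrite exchange_big/=; apply: eq_bigr => k _.
  by rewrite mulr_sumr; apply: eq_bigr => l _; rewrite mulrA.
have d4 : 0 <= 4 * delta by rewrite mulr_ge0// ltW.
have [P [P0 P1 P2 P3 P4]] := @finite_mixture_coupling _ _ _ CC _ _ lam
  (fun j => lam j * h j) mu (fun j => bc_nu (d j)) (fun j => bc_M (d j)) z mh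
  lam0 B0 lam1 lamh mu0 (fun j => bc_nu_ge0 (d j)) mu1 (fun j => bc_nu_sum (d j))
  (fun j => bc_M_ge0 (d j)) (fun j => bc_M_sum (d j)) (fun j => bc_M_nu (d j))
  (b / 8) tau (4 * delta) X (fun=> 4 * delta) X d4 hX hY hd hW.
exists P; split => //.
- by move=> l; rewrite P2 sum_tgt.
- by move=> k l hl; apply: P3; rewrite sum_tgt.
apply: le_trans P4 _; apply: total.
- apply: mixed_coupling_q => j.
  have [->|lj] := eqVneq (lam j) 0; first by rewrite !mul0r.
  have lp : 0 < lam j by rewrite lt_neqAle eq_sym lj lam0.
  apply: ler_wpM2l => //.
  have -> : (lam j - Num.min (lam j) (lam j * h j)) / lam j = 1 - Num.min 1 (h j).
    rewrite -{2}[lam j]mulr1 -minr_pMr ?(ltW lp)// mulrBl divff//.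
    by rewrite mulrAC divff// mul1r.
  exact: marton_source.
- apply: le_trans sumX; apply: ler_sum => j _; apply: ler_wpM2r => //.
  by rewrite ge_min lexx orbT.
- by rewrite -mulr_suml lam1 mul1r addrC; move: sumX; lra.
Qed.

Lemma tilt_to_mixture : exists P : K -> K -> R, [/\ forall k l, 0 <= P k l,
  forall k, \sum_l P k l = 1,
  forall l, \sum_k phi k * mix k * P k l = mix l,
  forall k l, mix l = 0 -> P k l = 0 &
  \sum_k phi k * mix k * C (b / 8 * (z k - \sum_l P k l * z l)) <= S + 5 * delta].
Proof.
have b4 : 4 * (b / 8) = b / 2 by field.
have A0 j : 0 <= lam j * h j by exact: mulr_ge0.
have hX j : \sum_k bc_nu (d j) k *
    C (4 * (b / 8) * (z k - \sum_l bc_N (d j) k l * z l)) <= X j.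
  rewrite b4; apply: le_trans (bc_N_cost (d j)).
  apply: ler_sum => k _; apply: ler_wpM2l; first exact: bc_nu_ge0.
  by apply: le_trans (cost_half _); rewrite mulrA [2^-1 * b]mulrC.
(* The source is now the tilted component, for which no centered bound is given. Its points are
   first moved by [bc_N] onto [mu j], at cost at most [X j], where [centered] applies. These two
   stages double the scale, which is why [centered] is assumed at [b] while the gluing works at
   [b / 2]. *)
have hY j r : 0 <= r <= 1 ->
    \sum_k bc_nu (d j) k * C (4 * (b / 8) * r * (z k - mh j)) <=
    tau * r ^+ 2 + (X j + 4 * delta).
  move=> r01; pose T k := \sum_l bc_N (d j) k l * z l.
  apply: (@le_trans _ _ (\sum_k (bc_nu (d j) k * C (b * (z k - T k)) +
      \sum_l bc_nu (d j) k * bc_N (d j) k l * C (b * r * (z l - mh j))))).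
    apply: ler_sum => k _; under eq_bigr do rewrite -mulrA.
    rewrite -mulr_sumr -mulrDr; apply: ler_wpM2l; first exact: bc_nu_ge0.
    have := cost_split2 CC (b / 2 * r * (z k - T k)) (b / 2 * r * (T k - mh j)).
    have -> : b / 2 * r * (z k - T k) + b / 2 * r * (T k - mh j) =
        4 * (b / 8) * r * (z k - mh j) by field.
    have -> : 2 * (b / 2 * r * (z k - T k)) = r * (b * (z k - T k)) by field.
    have -> : 2 * (b / 2 * r * (T k - mh j)) =
        \sum_l bc_N (d j) k l * (b * r * (z l - mh j)).
      under [RHS]eq_bigr do rewrite mulrCA mulrBr.
      rewrite -mulr_sumr sumrB -mulr_suml bc_N_sum mul1r -/(T k).
      by field.
    have := cost_shrink_abs CC (b * (z k - T k)) r01.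
    have := cost_jensen_sum CC (fun l => b * r * (z l - mh j))
      (bc_N_ge0 (d j) k) (bc_N_sum (d j) k).
    have := C_ge0 (\sum_l bc_N (d j) k l * (b * r * (z l - mh j))).
    have := C_ge0 (b * (z k - T k)).
    lra.
  rewrite big_split/= exchange_big/=.
  have -> : \sum_l \sum_k bc_nu (d j) k * bc_N (d j) k l * C (b * r * (z l - mh j)) =
      \sum_l mu j l * C (b * r * (z l - mh j)).
    by apply: eq_bigr => l _; rewrite -mulr_suml bc_N_mu.
  have := bc_N_cost (d j); rewrite -/(X j) => h1.
  by have := centered j r01; move: h1; rewrite /X /T; lra.
have hd i j r : 0 <= r <= 1 ->
    C (4 * (b / 8) * r * (mh j - mh i)) <= tau * r ^+ 2 + r * (4 * delta).
  by move=> r01; rewrite b4; exact: centers.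
have hW i : C (4 * (b / 8) * (mh i - \sum_l mu i l * z l)) <= 0.
  by rewrite subrr mulr0 (cost0 CC).
have d4 : 0 <= 4 * delta by rewrite mulr_ge0// ltW.
have [P [P0 P1 P2 P3 P4]] := @finite_mixture_coupling _ _ _ CC _ _
  (fun j => lam j * h j) lam (fun j => bc_nu (d j)) mu (fun j => bc_N (d j)) z mh
  A0 lam0 lamh lam1 (fun j => bc_nu_ge0 (d j)) mu0 (fun j => bc_nu_sum (d j)) mu1
  (fun j => bc_N_ge0 (d j)) (fun j => bc_N_sum (d j)) (fun j => bc_N_mu (d j))
  (b / 8) tau (4 * delta) X (fun j => X j + 4 * delta) (fun=> 0) d4 hX hY hd hW.
exists P; split => //.
- by move=> l; apply: etrans (P2 l); apply: eq_bigr => k _; rewrite sum_tgt.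
have -> : \sum_k phi k * mix k * C (b / 8 * (z k - \sum_l P k l * z l)) =
    \sum_k (\sum_j lam j * h j * bc_nu (d j) k) * C (b / 8 * (z k - \sum_l P k l * z l)).
  by apply: eq_bigr => k _; rewrite sum_tgt.
apply: le_trans P4 _; apply: total.
- rewrite LE mulr_sumr; apply: ler_sum => j _.
  have [lj|lj] := eqVneq (lam j) 0; first by rewrite lj !mul0r mulr0.
  have lp : 0 < lam j by rewrite lt_neqAle eq_sym lj lam0.
  have [hj|hj] := eqVneq (h j) 0.
    by rewrite hj mulr0 !mul0r subr0 add0r mulr1 mulr_ge0.
  have hp : 0 < h j by rewrite lt_neqAle eq_sym hj h0.
  rewrite -mulrA [leRHS]mulrCA; apply: ler_wpM2l => //.
  have -> : (lam j * h j - Num.min (lam j * h j) (lam j)) / (lam j * h j) =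
      (h j - Num.min (h j) 1) / h j.
    rewrite -{3}[lam j]mulr1 -minr_pMr ?(ltW lp)// -mulrBr.
    by rewrite -mulf_div divff// mul1r.
  exact: marton_target.
- apply: le_trans sumX; apply: ler_sum => j _; apply: ler_wpM2r => //.
  by rewrite ge_min lexx.
- rewrite [X in _ + X]big1 ?addr0; last by move=> j _; rewrite mulr0.
  under eq_bigr do rewrite mulrDr.
  by rewrite big_split/= -mulr_suml lamh mul1r lerD2r.
Qed.

End binned_mixture.

(** * Choice of the bins *)

Lemma exists_bins (R : realType) (m0 N eps : R) : 0 < eps ->
  exists (K : finType) (kap : R -> K) (z : K -> R) (kt : K),
    [/\ forall k, measurable (kap @^-1` [set k]), z kt = m0,
      forall x, (kap x == kt) = (N <= `|x - m0|) &
      forall x, kap x != kt -> `|x - z (kap x)| <= eps].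
Proof.
move=> eps0; pose f x := (x - m0 + N) / eps.
pose n := Num.truncn (2 * N / eps).
pose kap x : option 'I_n.+1 :=
  if `|x - m0| < N then Some (inord (Num.truncn (f x))) else None.
(* The tail bin [None] is represented by [m0], so its rounding error is the deviation [x - m0],
   which the exponential moments control. *)
pose z (k : option 'I_n.+1) := if k is Some i then m0 - N + i%:R * eps else m0.
have inside x : `|x - m0| < N -> 0 <= f x /\ (Num.truncn (f x) < n.+1)%N.
  rewrite ltr_norml => /andP[xl xr].
  have f0 : 0 <= f x by rewrite divr_ge0 ?(ltW eps0)//; lra.
  split=> //; rewrite ltnS /n; apply: le_truncn.
  by rewrite ler_pM2r ?invr_gt0//; lra.
have mf : measurable_fun [set: R] f.
  by apply: measurable_funM => //; apply: measurable_funD => //; exact: measurable_funB.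
have md : measurable_fun [set: R] (fun x : R => `|x - m0|).
  by apply: measurableT_comp => //; exact: measurable_funB.
have mD : measurable [set x : R | `|x - m0| < N].
  rewrite (_ : [set x : R | _] = (fun x : R => `|x - m0|) @^-1` `]-oo, N[).
    by rewrite -[X in measurable X]setTI; exact: md.
  by apply/seteqP; split => x /=; rewrite in_itv.
exists (option 'I_n.+1), kap, z, None; split => //.
- case=> [i|].
    rewrite (_ : kap @^-1` _ = [set x : R | `|x - m0| < N] `&`
        f @^-1` `[i%:R, i.+1%:R[).
      apply: measurableI => //.
      by rewrite -[X in measurable X]setTI; exact: mf.
    apply/seteqP; split => x /=; rewrite /kap.
      case: ifPn => // xN [ix]; split=> //; have [f0 fn] := inside x xN.
      rewrite in_itv/= -ix inordK//; exact: truncn_itv.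
    move=> [xN]; rewrite in_itv/= => /truncn_def fi.
    by rewrite xN fi inord_val.
  rewrite (_ : kap @^-1` _ = ~` [set x : R | `|x - m0| < N]).
    exact: measurableC.
  by apply/seteqP; split => x /=; rewrite /kap; case: ifPn.
- by move=> x; rewrite /kap; case: ltP.
move=> x; rewrite /kap; case: ifPn => // xN _; have [f0 fn] := inside x xN.
rewrite /z inordK//; have /andP[] := truncn_itv f0.
set i := Num.truncn _.
rewrite /f ler_pdivlMr// ltr_pdivrMr// -natr1 => h1 h2.
rewrite ler_norml; apply/andP; split; first by move: eps0; lra.
by move: h2; rewrite mulrDl; lra.
Qed.

(** * Tails, entropy of a bin, and integrability of the entropy density *)

Lemma integrable_norm_tail (R : realType) (P : probability R R) (m0 : R)
    (g : R -> R) (e : R) : P.-integrable [set: R] (EFin \o g) -> 0 < e ->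
  exists N0, forall N, N0 <= N ->
    (\int[P]_(x in [set x | N <= `|x - m0|]%R) `|g x|%:E <= e%:E)%E.
Proof.
move=> ig e0; pose A (N : R) := [set x : R | N <= `|x - m0|].
have mA N : measurable (A N).
  rewrite (_ : A N = (fun x : R => `|x - m0|) @^-1` `[N, +oo[).
    rewrite -[X in measurable X]setTI.
    have : measurable_fun [set: R] (fun x : R => `|x - m0|).
      by apply: measurableT_comp => //; exact: measurable_funB.
    exact.
  by apply/seteqP; split => x /=; rewrite in_itv/= andbT.
have mg : measurable_fun [set: R] g by apply/measurable_EFinP; exact: measurable_int ig.
have mag : measurable_fun [set: R] (fun x => `|g x|%:E).
  by apply/measurable_EFinP; exact: measurableT_comp.
pose f n := (fun x => `|g x|%:E) \_ (A n%:R).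
have mfn n : measurable_fun [set: R] (f n).
  apply/(measurable_restrict _ (mA _) measurableT).
  exact: measurable_funTS.
have f_cvg x : setT x -> f ^~ x @ \oo --> (cst 0%E : R -> \bar R) x.
  move=> _; apply: cvg_near_cst; near=> n.
  rewrite /f patchE memNset// => /=; apply/negP; rewrite -ltNge; near: n.
  exact: nbhs_infty_gtr.
have fg n x : setT x -> (`|f n x| <= `|g x|%:E)%E.
  by move=> _; rewrite /f patchE; case: ifP => _ /=; rewrite lee_fin ?normr_id ?normr0.
have fing x : setT x -> (`|g x|%:E \is a fin_num)%E by [].
have := dominated_cvg measurableT mfn f_cvg fing (integrable_norm ig) fg.
rewrite integral0 => hcvg.
have : \forall n \near \oo, (\int[P]_x f n x < e%:E)%E.
  have h : (0 < e%:E)%E by rewrite lte_fin.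
  exact: (hcvg _ (open_ereal_lt' h)).
move=> [n _ /(_ n (leqnn n)) /= /ltW hn]; exists n%:R => N nN.
apply: le_trans hn; rewrite [X in (_ <= X)%E](_ : _ =
  \int[P]_(x in A n%:R) `|g x|%:E)%E; last by rewrite [RHS]integral_mkcond.
apply: ge0_subset_integral.
- exact: mA.
- exact: mA.
- exact: measurable_funTS.
- by move=> x _; rewrite lee_fin.
- by move=> x /=; exact: le_trans.
Unshelve. all: by end_near.
Qed.

(** One bin of the data processing inequality. Fenchel's inequality at [ln y], integrated over [A],
    gives [key], whose best choice is [y = q / p]. If [q] is 0 and [p] is not, [y = e / p] with [e]
    tending to 0 replaces it; [p = 0] forces [q = 0]. *)
Lemma entropy_jensen (R : realType) (P Q : probability R R) (f : R -> R)
    (A : set R) : (forall x, 0 <= f x) -> measurable_fun [set: R] f ->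
  (forall B, measurable B -> (Q B = \int[P]_(x in B) (f x)%:E)%E) ->
  P.-integrable [set: R] (EFin \o (fun x => f x * ln (f x))) ->
  measurable A ->
  fine (P A) * (fine (Q A) / fine (P A) * ln (fine (Q A) / fine (P A))) <=
  \int[P]_(x in A) (f x * ln (f x)).
Proof.
move=> f0 mf QE ig mA; set p := fine (P A); set q := fine (Q A).
have igA := integrableS measurableT mA (@subsetT _ A) ig.
have ifT : P.-integrable [set: R] (EFin \o f).
  apply/integrableP; split; first exact/measurable_EFinP.
  under eq_integral do rewrite /= ger0_norm//.
  by rewrite -QE// probability_setT ltry.
have ifA := integrableS measurableT mA (@subsetT _ A) ifT.
have ic (c : R) : P.-integrable A (EFin \o cst c).
  exact: finite_measure_integrable_cst.
have QA : \int[P]_(x in A) f x = q by rewrite /q QE.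
have key y : 0 < y -> q * ln y + q - y * p <= \int[P]_(x in A) (f x * ln (f x)).
  move=> y0.
  have i1 := integrableZl mA (ln y + 1) ifA.
  have -> : q * ln y + q - y * p = \int[P]_(x in A) ((ln y + 1) * f x - y).
    rewrite (RintegralB mA i1 (ic y)) (RintegralZl _ mA ifA) QA Rintegral_cst//.
    by rewrite mulrDl mul1r mulrC.
  apply: le_Rintegral => //; first exact: (integrableB mA i1 (ic y)).
  move=> x _; have := fenchel_xlnx (ln y) (f0 x).
  by rewrite lnK ?posrE//; lra.
have p0 : 0 <= p by exact: fine_ge0.
have q0 : 0 <= q by exact: fine_ge0.
have [qz|qz] := eqVneq q 0.
  rewrite qz !mul0r mulr0; have [pz|pz] := eqVneq p 0.
    by have := key 1 ltr01; rewrite qz pz; lra.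
  have pp : 0 < p by rewrite lt_neqAle eq_sym pz.
  apply/ler_addgt0Pr => e e0; have := key (e / p) (divr_gt0 e0 pp).
  by rewrite qz mul0r divfK//; lra.
have pz : p != 0.
  apply/eqP => pz; move/eqP: qz; apply; rewrite /q QE// null_set_integral//.
    by apply/measurable_EFinP; exact: measurable_funTS.
  by rewrite -[LHS]fineK ?fin_num_measure// -/p pz.
have qp : 0 < q / p by rewrite divr_gt0// lt_neqAle eq_sym ?qz ?pz.
have := key _ qp; rewrite divfK// addrK => h.
by rewrite mulrA [p * _]mulrC divfK.
Qed.

(** [x * ln x >= x - 1 >= -1] bounds the integral of the negative part by 1, so an integral below
    [+oo] forces the positive part to be finite. *)
Lemma integrable_xlnx d (T : measurableType d) (R : realType)
    (P : probability T R) (f : T -> R) : (forall x, 0 <= f x) ->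
  measurable_fun [set: T] f ->
  (\int[P]_x (f x * ln (f x))%:E < +oo)%E ->
  P.-integrable [set: T] (EFin \o (fun x => f x * ln (f x))).
Proof.
move=> f0 mf; set g := (fun x => (f x * ln (f x))%:E) => fin.
have mg : measurable_fun [set: T] g.
  apply/measurable_EFinP; apply: measurable_funM => //.
  exact: measurableT_comp.
have negfin : (\int[P]_x g^\- x <= 1%:E)%E.
  rewrite -[leRHS](probability_integral_cst P 1).
  apply: ge0_le_integral => //; first exact: measurable_funeneg.
  move=> x _; rewrite funenegE /g /= -EFin_max lee_fin ge_max ler01 andbT.
  by have := xlnx_ge (f0 x); have := f0 x; lra.
have posfin : (\int[P]_x g^\+ x < +oo)%E.
  move: fin; rewrite integralE; apply: contraTT.
  rewrite -!leNgt !leye_eq => /eqP ->; rewrite addye//.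
  by rewrite eqe_oppLR/=; apply/eqP => h; rewrite h in negfin.
apply/integrableP; split => //.
have e : (\int[P]_x `|g x| = \int[P]_x (g^\+ x + g^\- x))%E.
  by apply: eq_integral => x _; rewrite -/((abse \o g) x) fune_abse.
rewrite [X in (X < _)%E]e.
rewrite ge0_integralD//.
- by rewrite lte_add_pinfty// (le_lt_trans negfin)// ltry.
- exact: measurable_funepos.
- exact: measurable_funeneg.
Qed.

(** * The transport inequality for mixtures *)

Section mixture_transport.
Context (R : realType) (C : R -> R) (t0 : R) (CC : even_convex_cost C t0).
Context d (Theta : measurableType d) (m : probability Theta R)
  (mu : Theta -> probability R R)
  (hmu : forall A : set R, measurable A ->
    measurable_fun [set: Theta] (fun t => mu t A)).
Context (a b E M K0 : R) (th0 : Theta).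
Context (a0 : 0 < a) (b0 : 0 < b) (E0 : 0 <= E) (M0 : 0 < M) (K00 : 0 < K0).
Local Notation mean t := (\int[mu t]_x x).
Context (mom : forall t, finite_first_moment (mu t)).
Context (wti : forall t nu, finite_first_moment nu ->
  (weak_transport_cost (fun x => C (a * x)) (mu t) nu <=
     relative_entropy nu (mu t) /\
   weak_transport_cost (fun x => C (a * x)) nu (mu t) <=
     relative_entropy nu (mu t))%E).
Context (mean_bd : forall t t', `|mean t - mean t'| <= E).
Context (expm : forall t,
  (\int[mu t]_x (expR (C (a * (x - mean t) / 4)))%:E <= K0%:E)%E).
Context (hM : forall k q y, 0 <= k <= 1 -> 0 <= q <= 1 ->
  C (k * q * y) <= (k * q) ^+ 2 * (M * expR (C y / 2))).
Context (ab : 24 * b <= a) (bE : 6 * b * E <= 1) (bEt : 3 / 2 * b * E <= t0)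
  (bM : (12 * b / a) ^+ 2 * (M * K0) <= 2^-1).
Let C_ge0 := cost_ge0 CC.
Let t0_gt0 := cost_radius CC.
Let mix : probability R R := mixture m hmu.
Let m0 := mean th0.
Let G (x : R) : R := C (3 * b * (x - m0)).
Let K1 : R := expR (C 1) * K0.

Let mix_le (f : R -> \bar R) (r : R) : (forall x, 0 <= f x)%E ->
  measurable_fun [set: R] f -> (forall t, \int[mu t]_x f x <= r%:E)%E ->
  (\int[mix]_x f x <= r%:E)%E.
Proof.
move=> f0 mf fr.
have mu1 t : (mu t : {measure set R -> \bar R}) [set: R] = 1%E.
  exact: probability_setT.
have mixE B : measurable B -> (mix B = \int[m]_t mu t B)%E by [].
rewrite (@ge0_integral_mixture _ _ _ _ _ m (fun t => mu t) hmu mu1 mix mixE)//.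
apply: (@le_trans _ _ (\int[m]_t r%:E)%E); last by rewrite probability_integral_cst.
apply: ge0_le_integral => //.
- by move=> t _; exact: integral_ge0.
- exact: measurable_fun_integral_kernel.
- by move=> t _; exact: fr.
Qed.

Let measurable_affine (s u : R) : measurable_fun [set: R] (fun x => s * (x - u)).
Proof. by apply: measurable_funM => //; exact: measurable_funB. Qed.

Let measurable_G : measurable_fun [set: R] G.
Proof. exact: (measurableT_comp (measurable_cost CC)). Qed.

Let measurable_exp2G : measurable_fun [set: R] (fun x => (expR (2 * G x))%:E).
Proof.
apply/measurable_EFinP; apply: measurableT_comp => //.
exact: measurable_funM.
Qed.

(** All components must be controlled from the one center [m0]. The deviation splits into that from
    the own mean, where [6 * b <= a / 4], and the distance of the means, at most 1 at scale [6 * b],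
    whence the factor [expR (C 1)] in [K1]. *)
Let exp2G t : (\int[mu t]_x (expR (2 * G x))%:E <= K1%:E)%E.
Proof.
have mexp : measurable_fun [set: R] (fun x => (expR (C (a * (x - mean t) / 4)))%:E).
  apply/measurable_EFinP; apply: measurableT_comp => //.
  apply: (measurableT_comp (measurable_cost CC)).
  exact: measurable_funM.
apply: (@le_trans _ _ (\int[mu t]_x ((expR (C 1))%:E *
    (expR (C (a * (x - mean t) / 4)))%:E))%E).
  apply: ge0_le_integral => //.
  - exact: measurable_funeM.
  move=> x _; rewrite -EFinM lee_fin -expRD ler_expR.
  have := cost_split2 CC (3 * b * (x - mean t)) (3 * b * (mean t - m0)).
  have -> : 3 * b * (x - mean t) + 3 * b * (mean t - m0) = 3 * b * (x - m0) by ring.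
  rewrite -/(G x).
  have : C (2 * (3 * b * (mean t - m0))) <= C 1.
    apply: (cost_mono CC); rewrite normr1 !mulrA -natrM normrM.
    rewrite ger0_norm ?mulr_ge0 ?(ltW b0)//.
    apply: le_trans bE; apply: ler_wpM2l; last exact: mean_bd.
    by rewrite mulr_ge0// ltW.
  have : C (2 * (3 * b * (x - mean t))) <= C (a * (x - mean t) / 4).
    apply: (cost_mono CC).
    have -> : 2 * (3 * b * (x - mean t)) = 6 * b * (x - mean t) by ring.
    have -> : a * (x - mean t) / 4 = a / 4 * (x - mean t) by ring.
    rewrite [leLHS]normrM [leRHS]normrM; apply: ler_wpM2r => //.
    rewrite !ger0_norm ?mulr_ge0 ?(ltW b0) ?(ltW a0) ?invr_ge0//.
    by rewrite ler_pdivlMr// mulrAC -natrM.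
  lra.
rewrite ge0_integralZl_EFin ?expR_ge0//.
by rewrite /K1 EFinM; apply: lee_wpmul2l => //; exact: expm.
Qed.

Let measurable_far N : measurable [set x : R | N <= `|x - m0|].
Proof.
rewrite (_ : [set x : R | _] = (fun x : R => `|x - m0|) @^-1` `[N, +oo[).
  rewrite -[X in measurable X]setTI.
  have : measurable_fun [set: R] (fun x : R => `|x - m0|).
    by apply: measurableT_comp => //; exact: measurable_funB.
  exact.
by apply/seteqP; split => x /=; rewrite in_itv/= andbT.
Qed.

(** The exponent [2 * G] leaves a spare factor: beyond [N], [expR G <= expR (- C (3 * b * N)) * expR
    (2 * G)], so the tail is small uniformly in the component. *)
Let uniform_tail (e : R) : 0 < e -> exists N0, forall N, N0 <= N -> forall t,
  (\int[mu t]_(x in [set x | N <= `|x - m0|]%R) (expR (G x))%:E <= e%:E)%E.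
Proof.
move=> e0; have K1_gt0 : 0 < K1 by rewrite mulr_gt0// expR_gt0.
have tb : 0 < t0 * (3 * b) by rewrite !mulr_gt0.
(* By the linear lower bound this makes [C (3 * b * N)], hence its exponential, at least
   [K1 / e]. *)
exists (Num.max 0 ((K1 / e + t0 ^+ 2) / (t0 * (3 * b)))) => N.
rewrite ge_max => /andP[N0 hN] t.
have K1e : K1 <= e * expR (C (3 * b * N)).
  have := cost_linear_lb CC (3 * b * N).
  rewrite ger0_norm ?mulr_ge0 ?(ltW b0)// => h.
  move: hN; rewrite ler_pdivrMr// => hN.
  have h1 : K1 / e <= C (3 * b * N).
    have : N * (t0 * (3 * b)) = t0 * (3 * b * N) by ring.
    by lra.
  have h2 : K1 / e <= expR (C (3 * b * N)).
    by have := expR_ge1Dx (C (3 * b * N)); lra.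
  by rewrite mulrC -ler_pdivrMr.
set A := [set x | _].
have mA : measurable A by exact: measurable_far.
pose c := expR (- C (3 * b * N)).
apply: (@le_trans _ _ (\int[mu t]_(x in A) (c%:E * (expR (2 * G x))%:E))%E).
  apply: ge0_le_integral => //.
  - apply/measurable_EFinP; apply: measurable_funTS.
    exact: measurableT_comp.
  - by apply: measurable_funTS; exact: measurable_funeM.
  move=> x xA; rewrite -EFinM lee_fin -expRD ler_expR.
  suff : C (3 * b * N) <= G x by lra.
  apply: (cost_mono CC); rewrite !normrM ler_wpM2l//.
  by rewrite (ger0_norm N0).
apply: (@le_trans _ _ (\int[mu t]_x (c%:E * (expR (2 * G x))%:E))%E).
  apply: ge0_subset_integral => //.
  - exact: measurable_funeM.
  - by move=> x _; rewrite mule_ge0// lee_fin expR_ge0.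
rewrite ge0_integralZl_EFin ?expR_ge0//.
apply: (@le_trans _ _ (c%:E * K1%:E)%E).
  by apply: lee_wpmul2l; [rewrite lee_fin expR_ge0|exact: exp2G].
by rewrite -EFinM lee_fin /c expRN mulrC ler_pdivrMr ?expR_gt0.
Qed.

Lemma mixture_first_moment : finite_first_moment mix.
Proof.
apply/integrableP; split; first exact: EFin_measurable.
pose u := `|m0| + t0 / (3 * b); pose v := t0^-1 / (3 * b).
have b3 : 0 < 3 * b by rewrite mulr_gt0.
have u0 : 0 <= u by rewrite addr_ge0// divr_ge0 ?ltW.
have v0 : 0 <= v by rewrite divr_ge0 ?invr_ge0 ?ltW.
apply: (@le_lt_trans _ _ ((u + v * K1)%:E)); last exact: ltry.
apply: mix_le => //.
  by apply: measurableT_comp => //; exact: EFin_measurable.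
move=> t; apply: (@le_trans _ _ (\int[mu t]_x (u%:E + v%:E * (expR (2 * G x))%:E))%E).
  apply: ge0_le_integral => //.
  - by apply: measurableT_comp => //; exact: EFin_measurable.
  - by apply: emeasurable_funD => //; exact: measurable_funeM.
  move=> x _; rewrite -EFinM -EFinD lee_fin.
  have h1 : `|x| <= `|m0| + `|x - m0| by rewrite -[x in `|x|](subrK m0) addrC ler_normD.
  have h2 : 3 * b * `|x - m0| <= t0 + t0^-1 * G x.
    by have := norm_le_cost CC (3 * b * (x - m0)); rewrite normrM gtr0_norm.
  have h3 : G x <= expR (2 * G x).
    by have := expR_ge1Dx (2 * G x); have := C_ge0 (3 * b * (x - m0)); rewrite -/(G x); lra.
  have h4 : `|x - m0| <= (t0 + t0^-1 * expR (2 * G x)) / (3 * b).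
    rewrite ler_pdivlMr// mulrC; apply: le_trans h2 _.
    by rewrite lerD2l ler_wpM2l// invr_ge0 ltW.
  apply: le_trans h1 _; rewrite /u /v -addrA lerD2l.
  by apply: le_trans h4 _; rewrite mulrDl [_^-1 / _ * _]mulrAC.
rewrite ge0_integralD//; last 2 first.
- by move=> x _; rewrite -EFinM lee_fin mulr_ge0// expR_ge0.
- exact: measurable_funeM.
rewrite probability_integral_cst [leRHS]EFinD; apply: leeD2l.
rewrite ge0_integralZl_EFin//.
by rewrite [leRHS]EFinM; apply: lee_wpmul2l; [rewrite lee_fin|exact: exp2G].
Qed.

Section binned.
Context (e : R) (e0 : 0 < e) (K : finType) (kap : R -> K).
Context (mkap : forall k, measurable (kap @^-1` [set k])) (z : K -> R) (kt : K).
Local Notation bin k := (kap @^-1` [set k]).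
Context (off_tail : forall x, kap x != kt -> C (3 * b * (x - z (kap x))) <= e).
Let cerr x := C (3 * b * (x - z (kap x))).
Context (theta_tail : forall t,
  (\int[mu t]_(x in bin kt) (expR (cerr x))%:E <= e%:E)%E).
Let mh t := \sum_l mass kap (mu t) l * z l.

Let mu1 t : (mu t : {measure set R -> \bar R}) [set: R] = 1%E.
Proof. exact: probability_setT. Qed.

Let measurable_cerr : measurable_fun [set: R] cerr.
Proof.
apply: (measurableT_comp (measurable_cost CC)); apply: measurable_funM => //.
by apply: measurable_funB => //; exact: measurable_comp_bin.
Qed.

Let theta_round t : (\int[mu t]_x (cerr x)%:E <= (2 * e)%:E)%E.
Proof. exact: (rounding_cost_le CC mkap e0 off_tail (theta_tail t)). Qed.

Let mix_round : (\int[mix]_x (cerr x)%:E <= (2 * e)%:E)%E.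
Proof.
apply: mix_le => // [x|]; first by rewrite lee_fin; exact: C_ge0.
exact/measurable_EFinP.
Qed.

Let mix_tail : (\int[mix]_(x in bin kt) (expR (cerr x))%:E <= e%:E)%E.
Proof.
rewrite integral_mkcond; apply: mix_le.
- by move=> x; rewrite patchE; case: ifP => // _; rewrite lee_fin expR_ge0.
- apply/(measurable_restrict _ (mkap kt) measurableT)/measurable_EFinP.
  by apply: measurable_funTS; exact: measurableT_comp.
- by move=> t; rewrite -integral_mkcond; exact: theta_tail.
Qed.

Let centered t r : 0 <= r <= 1 ->
  \sum_k mass kap (mu t) k * C (b * r * (z k - mh t)) <= 2^-1 * r ^+ 2 + 4 * e.
Proof.
move=> r01.
suff h : (\int[mu t]_x (C (3 * b * r * (x - mean t)))%:E <= (2^-1 * r ^+ 2)%:E)%E.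
  have := binned_centered_cost CC mkap b0 r01 h (theta_round t).
  by rewrite mulrA -natrM.
(* [k * r] passes from [a / 4], the scale of the exponential moments, to [3 * b * r]; [bM] makes the
   resulting coefficient of [r ^+ 2] at most [1 / 2]. *)
pose k := 12 * b / a; pose c := (k * r) ^+ 2 * M.
have c0 : 0 <= c by rewrite mulr_ge0 ?sqr_ge0// ltW.
have k01 : 0 <= k <= 1.
  rewrite /k divr_ge0 ?mulr_ge0 ?(ltW a0) ?(ltW b0)//= ler_pdivrMr// mul1r.
  by move: ab b0; lra.
have mexp : measurable_fun [set: R] (fun x => (expR (C (a * (x - mean t) / 4)))%:E).
  apply/measurable_EFinP; apply: measurableT_comp => //.
  apply: (measurableT_comp (measurable_cost CC)).
  exact: measurable_funM.
apply: (@le_trans _ _ (\int[mu t]_x (c%:E *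
    (expR (C (a * (x - mean t) / 4)))%:E))%E).
  apply: ge0_le_integral => //.
  - by move=> x _; rewrite lee_fin; exact: C_ge0.
  - exact: (measurable_EFin_cost CC).
  - exact: measurable_funeM.
  move=> x _; rewrite -EFinM lee_fin.
  have -> : 3 * b * r * (x - mean t) = k * r * (a * (x - mean t) / 4).
    by rewrite /k; field; rewrite gt_eqF.
  apply: le_trans (hM _ k01 r01) _; rewrite /c mulrA.
  rewrite ler_wpM2l// ler_expR ler_pdivrMr//.
  by rewrite ler_peMr ?C_ge0// ler1n.
rewrite ge0_integralZl_EFin//.
apply: (@le_trans _ _ (c%:E * K0%:E)%E).
  by apply: lee_wpmul2l; [rewrite lee_fin|exact: expm].
rewrite -EFinM lee_fin /c exprMn -/k.
have -> : k ^+ 2 * r ^+ 2 * M * K0 = k ^+ 2 * (M * K0) * r ^+ 2 by ring.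
by rewrite ler_wpM2r ?sqr_ge0.
Qed.

Let rounded_mean t : C (3 * b * (mean t - mh t)) <= 2 * e.
Proof.
rewrite -lee_fin; apply: le_trans (theta_round t).
apply: (rounded_mean_cost CC mkap z (mu1 t)).
by rewrite mulf_neq0// gt_eqF.
Qed.

Let centers s t r : 0 <= r <= 1 ->
  C (b / 2 * r * (mh t - mh s)) <= 2^-1 * r ^+ 2 + r * (4 * e).
Proof.
move=> r01; have /andP[r0 r1] := r01.
have := cost_split3 CC (b / 2 * r * (mh t - mean t))
  (b / 2 * r * (mean t - mean s)) (b / 2 * r * (mean s - mh s)).
have -> : b / 2 * r * (mh t - mean t) + b / 2 * r * (mean t - mean s) +
    b / 2 * r * (mean s - mh s) = b / 2 * r * (mh t - mh s) by ring.
have round u : C (3 * (b / 2 * r * (mean u - mh u))) <= r * (2 * e).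
  have -> : 3 * (b / 2 * r * (mean u - mh u)) =
      r * (2^-1 * (3 * b * (mean u - mh u))) by ring.
  apply: le_trans (cost_scale CC _ r01) _; rewrite ler_wpM2l//.
  by apply: le_trans (cost_shrink_abs CC _ _) (rounded_mean u); lra.
have -> : C (3 * (b / 2 * r * (mh t - mean t))) = C (3 * (b / 2 * r * (mean t - mh t))).
  by rewrite -(cost_even CC); congr C; ring.
have mid : `|3 * (b / 2 * r * (mean t - mean s))| <= r * (3 / 2 * b * E).
  have -> : 3 * (b / 2 * r * (mean t - mean s)) =
    r * (3 / 2 * b * (mean t - mean s)) by ring.
  rewrite normrM ger0_norm// ler_wpM2l// normrM ger0_norm; last first.
    by rewrite mulr_ge0 ?ltW//; lra.
  by rewrite ler_wpM2l ?mean_bd// mulr_ge0 ?ltW//; lra.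
have E1 : 0 <= 3 / 2 * b * E by rewrite !mulr_ge0 ?(ltW b0)//; lra.
(* By [bEt] this displacement stays where the cost is a square, hence the factor [r ^+ 2]; [bE]
   makes the coefficient at most [1 / 16]. *)
have : C (3 * (b / 2 * r * (mean t - mean s))) <= r ^+ 2 * (16^-1).
  rewrite (cost_sq CC); last first.
    by apply: le_trans mid (le_trans _ bEt); rewrite ler_piMl.
  rewrite -real_normK ?num_real//.
  apply: (@le_trans _ _ ((r * (3 / 2 * b * E)) ^+ 2)).
    by rewrite lerXn2r// nnegrE mulr_ge0.
  rewrite exprMn ler_wpM2l ?sqr_ge0//.
  have : 3 / 2 * b * E <= 4^-1 by move: bE; lra.
  by move: E1; set x := 3 / 2 * b * E; nra.
have := round t; have := round s; have := sqr_ge0 r.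
have re : 0 <= r * e by rewrite mulr_ge0// ltW.
move: re; lra.
Qed.

(** The masses have to match exactly, not approximately: the discrete coupling is turned back into
    one of the original mixture. *)
Let finite_mixture : exists (J : finType) (lam : J -> R) (th : J -> Theta),
  [/\ forall j, 0 <= lam j, \sum_j lam j = 1 &
      forall k, \sum_j lam j * mass kap (mu (th j)) k = mass kap mix k].
Proof.
pose V (i : 'I_#|K|) t := mass kap (mu t) (enum_val i).
have fin t A : measurable A -> mu t A \is a fin_num by exact: (bin_fin_num (mu1 t)).
have mV i : measurable_fun [set: Theta] (V i).
  exact: (measurableT_comp (fine_measurable measurableT) (hmu (mkap _))).
have V01 i t : 0 <= V i t <= 1.
  rewrite mass_ge0/= -lee_fin /V /mass fineK ?fin//.
  exact: probability_le1.
have [J [lam [th [lam0 lam1 lamE]]]] := mean_in_convex_hull m mV V01.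
exists J, lam, th; split=> // k.
have := lamE (enum_rank k); rewrite /V enum_rankK => ->.
rewrite /mass /Rintegral; congr fine.
by apply: eq_integral => t _; rewrite fineK ?fin.
Qed.

Section tilted.
Context (nu : probability R R) (f : R -> R) (f0 : forall x, 0 <= f x).
Context (mf : measurable_fun [set: R] f).
Context (nuE : forall B, measurable B -> (nu B = \int[mix]_(x in B) (f x)%:E)%E).
Context (ig : mix.-integrable [set: R] (EFin \o (fun x => f x * ln (f x)))).
Context (tailg : (\int[mix]_(x in bin kt) `|f x * ln (f x)|%:E <= e%:E)%E).
Let H := \int[mix]_x (f x * ln (f x)).
Let phi k := mass kap nu k / mass kap mix k.

Let mix1 : (mix : {measure set R -> \bar R}) [set: R] = 1%E.
Proof. exact: probability_setT. Qed.

Let nu1 : (nu : {measure set R -> \bar R}) [set: R] = 1%E.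
Proof. exact: probability_setT. Qed.

Let phi0 k : 0 <= phi k.
Proof. by rewrite divr_ge0 ?mass_ge0. Qed.

Let phi_mass k : phi k * mass kap mix k = mass kap nu k.
Proof.
have [mz|mz] := eqVneq (mass kap mix k) 0; last by rewrite divfK.
rewrite mz mulr0 /mass nuE// null_set_integral//.
  by apply/measurable_EFinP; exact: measurable_funTS.
have h := bin_fin_num mix1 (mkap k).
exact: (etrans (esym (fineK h)) (congr1 EFin mz)).
Qed.

(** One [e] comes from the bounded bins; on the tail bin Fenchel's inequality gives one for the
    entropy of [f] and one for the exponential moment of the mixture. *)
Let nu_round : (\int[nu]_x (cerr x)%:E <= (3 * e)%:E)%E.
Proof.
apply: le_trans (integral_rounding_le CC mkap e0 off_tail nu) _.
have -> : 3 * e = e + (e + e) by ring.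
rewrite [leRHS]EFinD; apply: leeD2l.
have c0 x : 0 <= cerr x by exact: C_ge0.
pose F := (fun x => (cerr x)%:E) \_ (bin kt).
have F0 x : (0 <= F x)%E.
  by rewrite /F patchE; case: ifP => // _; rewrite lee_fin.
have mF : measurable_fun [set: R] F.
  apply/(measurable_restrict _ (mkap kt) measurableT)/measurable_EFinP.
  exact: measurable_funTS.
have mg : measurable_fun [set: R] (fun x => `|f x * ln (f x)|%:E).
  apply/measurable_EFinP; apply: measurableT_comp => //.
  by apply: measurable_funM => //; exact: measurableT_comp.
have me : measurable_fun [set: R] (fun x => (expR (cerr x))%:E).
  by apply/measurable_EFinP; exact: measurableT_comp.
have FE : (\int[nu]_(x in bin kt) (cerr x)%:E = \int[nu]_x F x)%E.
  by rewrite integral_mkcond.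
rewrite [X in (X <= _)%E]FE (ge0_integral_density mf nuE F0 mF).
have -> : (\int[mix]_x (F x * (f x)%:E) =
    \int[mix]_(x in bin kt) (cerr x * f x)%:E)%E.
  rewrite [RHS]integral_mkcond; apply: eq_integral => x _.
  by rewrite /F !patchE; case: ifP => _; rewrite ?mul0e ?EFinM.
apply: (@le_trans _ _ (\int[mix]_(x in bin kt)
    (`|f x * ln (f x)|%:E + (expR (cerr x))%:E))%E).
  apply: ge0_le_integral => //.
  - by move=> x _; rewrite lee_fin mulr_ge0.
  - by apply/measurable_EFinP; apply: measurable_funTS; exact: measurable_funM.
  - by apply: emeasurable_funD; exact: measurable_funTS.
  move=> x _; rewrite -EFinD lee_fin.
  have := fenchel_xlnx (cerr x) (f0 x); have := f0 x.
  by have := ler_norm (f x * ln (f x)); rewrite [cerr x * _]mulrC; lra.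
rewrite ge0_integralD//; last 2 first.
- exact: measurable_funTS.
- exact: measurable_funTS.
by rewrite [leRHS]EFinD; apply: leeD => //; exact: mix_tail.
Qed.

Let bin_entropy k : mass kap mix k * (phi k * ln (phi k)) <=
  \int[mix]_(x in bin k) (f x * ln (f x)).
Proof. exact: (entropy_jensen f0 mf nuE ig (mkap k)). Qed.

Let entropy_bins : \sum_k mass kap mix k * (phi k * ln (phi k)) <= H.
Proof. by rewrite /H (Rintegral_bins mkap ig); exact: ler_sum. Qed.

Let entropy_tail : mass kap mix kt * (phi kt * ln (phi kt)) <= e.
Proof.
apply: le_trans (bin_entropy kt) _.
have igk := integrableS measurableT (mkap kt) (@subsetT _ _) ig.
apply: le_trans (ler_norm _) _; apply: le_trans (le_normr_Rintegral (mkap kt) igk) _.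
rewrite -lee_fin /Rintegral fineK//.
exact: (integrable_fin_num (mkap kt) (integrable_norm igk)).
Qed.

Let smaller_scale (Q : probability R R) (v : R) :
  (\int[Q]_x (cerr x)%:E <= v%:E)%E ->
  (\int[Q]_x (C (3 * (b / 24) * (x - z (kap x))))%:E <= v%:E)%E.
Proof.
apply: le_trans; apply: ge0_le_integral => //.
- by move=> x _; rewrite lee_fin; exact: C_ge0.
- apply: (measurable_EFin_cost CC); apply: measurable_funM => //.
  by apply: measurable_funB => //; exact: measurable_comp_bin.
- exact/measurable_EFinP.
move=> x _; rewrite lee_fin; apply: (cost_mono CC).
rewrite [leLHS]normrM [leRHS]normrM ler_wpM2r// !ger0_norm ?mulr_ge0 ?ltW ?divr_gt0//.
by move: b0; lra.
Qed.

(** The discrete couplings cost at most [H + 5 * e] at scale [b / 8]; the return to the line divides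
    the scale by 3 and adds the rounding costs, [2 * e] for the mixture and [3 * e] for [nu]. *)
Lemma binned_transport :
  (weak_transport_cost (fun x => C (b / 24 * x)) mix nu <= (H + 10 * e)%:E /\
   weak_transport_cost (fun x => C (b / 24 * x)) nu mix <= (H + 10 * e)%:E)%E.
Proof.
have [J [lam [th [lam0 lam1 lamE]]]] := finite_mixture.
have comp j := exists_binned_component CC mkap b0 e0 off_tail ab (mom (th j))
  (wti (th j)) (theta_tail (th j)) phi0.
(* Couplings are chosen over the finite index [J], where measurability of the choice is no issue. *)
pose dj j := sval (cid (comp j)).
have phi1 : \sum_k phi k * \sum_j lam j * mass kap (mu (th j)) k = 1.
  under eq_bigr do rewrite lamE phi_mass.
  exact: (sum_mass mkap nu1).
have tl : (\sum_j lam j * mass kap (mu (th j)) kt) * (phi kt * ln (phi kt)) <= e.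
  by rewrite lamE.
have tau0 : 0 <= (2^-1 : R) <= 2^-1 by rewrite lexx andbT invr_ge0.
have mass0 j k : 0 <= mass kap (mu (th j)) k by exact: mass_ge0.
have m1 j : \sum_k mass kap (mu (th j)) k = 1 by exact: (sum_mass mkap (mu1 _)).
have cen j r (r01 : 0 <= r <= 1) := @centered (th j) r r01.
have cent i j r (r01 : 0 <= r <= 1) := @centers (th i) (th j) r r01.
have b24 : 0 < b / 24 by rewrite divr_gt0.
have b8 : 3 * (b / 24) = b / 8 by field.
have SE : \sum_k (\sum_j lam j * mass kap (mu (th j)) k) * (phi k * ln (phi k)) <= H.
  by under eq_bigr do rewrite lamE.
split.
- have [P [P0 P1 P2 P3 P4]] := tilt_to_mixture CC dj lam0 lam1 mass0 m1 phi0 e0 tau0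
    phi1 tl cen cent.
  have Q2 l : \sum_k mass kap nu k * P k l = mass kap mix l.
    by rewrite -lamE -P2; apply: eq_bigr => k _; rewrite lamE phi_mass.
  have Q3 k l : mass kap mix l = 0 -> P k l = 0 by rewrite -lamE; exact: P3.
  have h := weak_transport_cost_le CC mkap P0 P1 Q2 Q3 b24
    (smaller_scale nu_round) (smaller_scale mix_round).
  apply: le_trans h _.
  rewrite lee_fin b8.
  under eq_bigr do rewrite -phi_mass -lamE.
  by move: P4 SE; lra.
- have [P [P0 P1 P2 P3 P4]] := mixture_to_tilt CC dj lam0 lam1 mass0 m1 phi0 e0 tau0
    phi1 tl cen cent.
  have Q2 l : \sum_k mass kap mix k * P k l = mass kap nu l.
    by rewrite -phi_mass -lamE -P2; apply: eq_bigr => k _; rewrite lamE.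
  have Q3 k l : mass kap nu l = 0 -> P k l = 0.
    by rewrite -phi_mass -lamE; exact: P3.
  have h := weak_transport_cost_le CC mkap P0 P1 Q2 Q3 b24
    (smaller_scale mix_round) (smaller_scale nu_round).
  apply: le_trans h _.
  rewrite lee_fin b8.
  under eq_bigr do rewrite -lamE.
  by move: P4 SE; lra.
Qed.

End tilted.

End binned.

Let approximate_transport (nu : probability R R) (e : R) :
  (relative_entropy nu mix < +oo)%E -> 0 < e ->
  (weak_transport_cost (fun x => C (b / 24 * x)) mix nu <=
     relative_entropy nu mix + (10 * e)%:E /\
   weak_transport_cost (fun x => C (b / 24 * x)) nu mix <=
     relative_entropy nu mix + (10 * e)%:E)%E.
Proof.
move=> Hfin e0.
have numix : nu `<< mix by move: Hfin; rewrite /relative_entropy; case: pselect.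
have [f [f0 mf nuE]] := exists_density numix.
have HE := relative_entropyE f0 mf nuE; rewrite HE in Hfin.
have ig := integrable_xlnx f0 mf Hfin.
have HH : relative_entropy nu mix = (\int[mix]_x (f x * ln (f x)))%:E.
  by rewrite HE /Rintegral fineK//; exact: (integrable_fin_num measurableT ig).
have [N1 hN1] := uniform_tail e0.
have [N2 hN2] := integrable_norm_tail m0 ig e0.
pose N := Num.max N1 N2.
(* [s <= t0] makes [C s] equal to [s ^+ 2], which is at most [s <= e] as [s <= 1]. *)
pose s := Num.min t0 (Num.min 1 e).
have s0 : 0 < s by rewrite !lt_min t0_gt0 ltr01 e0.
have s3b : 0 < s / (3 * b) by rewrite divr_gt0// mulr_gt0.
have Cs : C s <= e.
  have [st [s1 se]] : s <= t0 /\ s <= 1 /\ s <= e.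
    by rewrite /s !ge_min !lexx ?orbT.
  rewrite (cost_sq CC) ?ger0_norm ?(ltW s0)//.
  by apply: le_trans se; rewrite expr2 ler_piMl// ltW.
have [K [kap [z [kt [mkap zkt ktE near_z]]]]] := exists_bins m0 N s3b.
have off_tail x : kap x != kt -> C (3 * b * (x - z (kap x))) <= e.
  move=> /near_z hx; apply: le_trans Cs; apply: (cost_mono CC).
  rewrite normrM gtr0_norm ?mulr_gt0// (gtr0_norm s0).
  by rewrite mulrC -ler_pdivlMr ?mulr_gt0.
have ktA : kap @^-1` [set kt] = [set x | N <= `|x - m0|].
  by apply/seteqP; split => x /=; rewrite -ktE => /eqP.
have theta_tail t :
    (\int[mu t]_(x in kap @^-1` [set kt]) (expR (C (3 * b * (x - z (kap x)))))%:E
      <= e%:E)%E.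
  rewrite (eq_integral (fun x => (expR (G x))%:E)); last first.
    by move=> x; rewrite inE /= => ->; rewrite zkt.
  by rewrite ktA; apply: hN1; rewrite /N le_max lexx.
have tailg : (\int[mix]_(x in kap @^-1` [set kt]) `|f x * ln (f x)|%:E <= e%:E)%E.
  by rewrite ktA; apply: hN2; rewrite /N le_max lexx orbT.
rewrite HH -EFinD.
exact: (binned_transport e0 mkap off_tail theta_tail f0 mf nuE ig tailg).
Qed.

Lemma mixture_transport (nu : probability R R) :
  (weak_transport_cost (fun x => C (b / 24 * x)) mix nu <= relative_entropy nu mix /\
   weak_transport_cost (fun x => C (b / 24 * x)) nu mix <= relative_entropy nu mix)%E.
Proof.
have [->|Hfin] := eqVneq (relative_entropy nu mix) +oo%E; first by rewrite !leey.
have {}Hfin : (relative_entropy nu mix < +oo)%E by rewrite ltey.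
by split; apply/lee_addgt0Pr => e e0;
  have [h1 h2] := approximate_transport Hfin (divr_gt0 e0 (ltr0n _ 10));
  move: h1 h2; rewrite [10 * _]mulrC divfK.
Qed.

End mixture_transport.

(** Composing [c] with the absolute value preserves convexity because [c] is nondecreasing, which
    follows from convexity, [c 0 = 0] and nonnegativity. *)
Lemma even_convex_cost_abs (R : realType) (c : R -> R) (t0 : R) :
  (forall t, 0 <= t -> 0 <= c t) ->
  @convex_function R R^o `[0, +oo[%classic c ->
  0 < t0 -> (forall t, 0 <= t <= t0 -> c t = t ^+ 2) ->
  even_convex_cost (fun x => c `|x|) t0.
Proof.
move=> c0 cc t00 csq.
have c00 : c 0 = 0 by rewrite csq ?lexx ?ltW// expr0n.
have conv t x y : 0 <= t <= 1 -> 0 <= x -> 0 <= y ->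
    c (t * x + (1 - t) * y) <= t * c x + (1 - t) * c y.
  move=> /andP[t1 t2] x0 y0.
  by apply: (cc (Itv01 t1 t2)); rewrite inE /= in_itv/= ?x0 ?y0.
have mono x y : 0 <= x -> x <= y -> c x <= c y.
  move=> x0 xy; have [y0|y0] := eqVneq y 0.
    by have -> : x = y by apply/eqP; rewrite eq_le xy y0 x0.
  have yp : 0 < y by rewrite lt_neqAle eq_sym y0 (le_trans x0 xy).
  have xy01 : 0 <= x / y <= 1 by rewrite divr_ge0 ?(ltW yp)//= ler_pdivrMr// mul1r.
  have := conv _ _ _ xy01 (ltW yp) (lexx 0).
  rewrite c00 !mulr0 !addr0 divfK// => /le_trans; apply.
  by rewrite ler_piMl ?c0 ?(ltW yp)//; case/andP: xy01.
split=> //.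
- by move=> x; exact: c0.
- by move=> x; rewrite normrN.
- move=> t x y t01; apply: le_trans (conv _ _ _ t01 (normr_ge0 x) (normr_ge0 y)).
  have /andP[ta tb] := t01.
  apply: mono (normr_ge0 _) _; apply: le_trans (ler_normD _ _) _.
  by rewrite !normrM (ger0_norm ta) [`|1 - t|]ger0_norm ?subr_ge0.
- by move=> x xt; rewrite csq ?normr_ge0// real_normK ?num_real.
Qed.

Theorem theorem2p13 (R : realType) (c : R -> R)
    (c_ge0 : forall t : R, 0 <= t -> 0 <= c t)
    (c_convex : @convex_function R R^o `[0, +oo[%classic c)
    (c_quad : exists2 t0 : R, 0 < t0 &
       forall t : R, 0 <= t <= t0 -> c t = t ^+ 2) :
  exists2 kappa : R, 0 < kappa &
    forall (d : measure_display) (Theta : measurableType d)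
      (m : probability Theta R) (mu : Theta -> probability R R)
      (hmu : forall A : set R, measurable A ->
         measurable_fun [set: Theta] (fun t => mu t A))
      (a : R),
      0 < a ->
      (forall t : Theta,
         weak_transport_inequality (fun x => c (a * `|x|)) 1 (mu t)) ->
      (mean_diameter mu < +oo)%E ->
      let a' := kappa * (a^-1 + fine (mean_diameter mu))^-1 in
      weak_transport_inequality (fun x => c (a' * `|x|)) 1 (mixture m hmu).
Proof.
have [t0 t00 csq] := c_quad.
have CC := even_convex_cost_abs c_ge0 c_convex t00 csq.
have [M M0 hM] := cost_scale_sq CC.
have [K0 K00 hK] := exponential_moment CC.
(* The components are compared at the scale [b = 24 a']: a factor 2 is lost in
   splitting displacements, 4 in gluing couplings and 3 in rounding. *)
pose kappa := Num.min (576^-1) (Num.min (t0 / 36) ((1152 * (M * K0))^-1)).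
have MK : 0 < M * K0 by rewrite mulr_gt0.
have kappa0 : 0 < kappa.
  have n0 n : 0 < n.+1%:R :> R by rewrite ltr0n.
  rewrite !lt_min; apply/and3P; split.
  - by rewrite invr_gt0; exact: n0.
  - by apply: divr_gt0 t00 _; exact: n0.
  - by rewrite invr_gt0; apply: mulr_gt0 MK; exact: n0.
(* With [b = 24 * a'], [k1] gives [ab] ([576 = 24 * 24]) and [bE], [k2] gives [bEt]
   ([36 = 3 / 2 * 24]), and [k3] together with [k1] gives [bM]. *)
have [k1 [k2 k3]] : kappa <= 576^-1 /\ kappa <= t0 / 36 /\
    kappa <= (1152 * (M * K0))^-1.
  by rewrite /kappa !ge_min !lexx ?orbT.
exists kappa => // d Theta m mu hmu a a0 wti diam a'.
pose E := fine (mean_diameter mu).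
have [th0 _] := probability_inhabited m.
have mean_diam t t' :
    ((`| \int[mu t]_x x - \int[mu t']_x x |)%:E <= mean_diameter mu)%E.
  by apply: ereal_sup_ubound; exists t => //; exists t'.
have diam0 : (0 <= mean_diameter mu)%E.
  by apply: le_trans (mean_diam th0 th0); rewrite lee_fin.
have EE : mean_diameter mu = E%:E by rewrite fineK// ge0_fin_numE.
have mean_bd t t' : `| \int[mu t]_x x - \int[mu t']_x x | <= E.
  by rewrite -lee_fin -EE.
have E0 : 0 <= E by rewrite -lee_fin -EE.
have aE : 0 < a^-1 + E by rewrite ltr_wpDr// invr_gt0.
have a'0 : 0 < a' by rewrite mulr_gt0// invr_gt0.
have a'E : a' * (a^-1 + E) = kappa by rewrite divfK// gt_eqF.
have a'a : a' / a <= kappa.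
  by rewrite -a'E ler_wpM2l ?(ltW a'0)// lerDl.
have a'E' : a' * E <= kappa.
  by rewrite -a'E ler_wpM2l ?(ltW a'0)// lerDr invr_ge0 ltW.
have scale s : 0 < s -> (fun x => c (s * `|x|)) = (fun x => c `|s * x|).
  by move=> s0; apply/funext => x; rewrite normrM gtr0_norm.
rewrite /weak_transport_inequality scale//.
have mom t : finite_first_moment (mu t) := (wti t).1.
have wti' t nu : finite_first_moment nu ->
   (weak_transport_cost (fun x => c `|a * x|)%R (mu t) nu <=
     relative_entropy nu (mu t) /\
   weak_transport_cost (fun x => c `|a * x|)%R nu (mu t) <=
     relative_entropy nu (mu t))%E.
  by move=> /(wti t).2; rewrite scale// mul1e.
have expm t := hK (mu t) a a0 (mom t) (fun nu nu_mom => (wti' t nu nu_mom).2).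
have b0 : 0 < 24 * a' by rewrite mulr_gt0 ?ltr0n.
have ab : 24 * (24 * a') <= a.
  have : a' <= kappa * a by rewrite -ler_pdivrMr.
  have : kappa * a <= 576^-1 * a by rewrite ler_pM2r.
  lra.
have bE : 6 * (24 * a') * E <= 1 by move: a'E' k1; lra.
have bEt : 3 / 2 * (24 * a') * E <= t0 by move: a'E' k2; lra.
have bM : (12 * (24 * a') / a) ^+ 2 * (M * K0) <= 2^-1.
  pose B := 1152 * (M * K0).
  have B0 : 0 < B by apply: mulr_gt0 MK; rewrite ltr0n.
  have h : kappa * B <= 1 by rewrite -ler_pdivlMr// div1r.
  set q := a' / a in a'a; have q0 : 0 <= q by rewrite divr_ge0 ?ltW.
  have -> : 12 * (24 * a') / a = 288 * q by rewrite /q; field; rewrite gt_eqF.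
  have h1 : q * B <= 1 by apply: le_trans h; rewrite ler_wpM2r// ltW.
  have h2 : q * 576 <= 1.
    by rewrite -ler_pdivlMr ?ltr0n// div1r; exact: le_trans a'a k1.
  have -> : (288 * q) ^+ 2 * (M * K0) = (q * 576) * (q * B) / 8.
    by rewrite /B; field.
  have q576 : 0 <= q * 576 by apply: mulr_ge0 q0 _; exact: ler0n.
  have qB : 0 <= q * B by exact: mulr_ge0 q0 (ltW B0).
  by have := mulr_ile1 q576 qB h2 h1; lra.
split.
  exact: (mixture_first_moment CC m hmu th0 a0 b0 mean_bd expm ab bE).
move=> nu _; rewrite mul1e.
have := mixture_transport CC m hmu th0 a0 b0 E0 M0 K00 mom wti' mean_bd expm hM
  ab bE bEt bM nu.
by rewrite [24 * a']mulrC mulfK ?pnatr_eq0.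
Qed.
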